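(* Let $X_1,X_2$ be Polish spaces and let $E=(E_1,E_2)$ be a pair of relations $E_i\subseteq X_i\times\Delta(X_j)$, where $\{i,j\}=\{1,2\}$. (a) If each $E_i$ is $\mathbf{\Sigma}^1_1$, then $\mathrm{RAT}(E)=\mathrm{RCBR}(E)$. (b) Assume $\mathbf{\Pi}^1_3$-Determinacy. If each $E_i$ is $\mathbf{\Pi}^1_2$, then $\mathrm{RAT}(E)=\mathrm{RCBR}(E)$.
   Context: Conventions. $\mathbf{\Sigma}^1_n,\mathbf{\Pi}^1_n$ are the boldface projective classes; $\mathbf{\Pi}^1_n$-Determinacy says every Gale–Stewart game on $\omega$ with $\mathbf{\Pi}^1_n$ payoff set is determined. For a Polish space $X$, $\Delta(X)$ is the Polish space of Borel probability measures on $X$ (weak topology). A measure is identified with its completion; for arbitrary $S\subseteq X$, ''$\mu(S)=1$'' means $S$ is measurable for the completion of $\mu$ and has measure one. Always $\{i,j\}=\{1,2\}$. $\mathrm{RAT}(E)$. A rectangle $B_1\times B_2\subseteq X_1\times X_2$ is $E$-justified if for each $i$ and every $s\in B_i$ there is $\mu\in\Delta(X_j)$ with $(s,\mu)\in E_i$ and $\mu(B_j)=1$. $\mathrm{RAT}_i(E)$ is the union of the projections to $X_i$ of all $E$-justified rectangles, and $\mathrm{RAT}(E)=\mathrm{RAT}_1(E)\times\mathrm{RAT}_2(E)$. Type spaces. Put $X_i^{(0)}=X_j$ and $X_i^{(n)}=X_i^{(n-1)}\times\Delta(X_j^{(n-1)})$ for $n>0$. Let $T_i^0=\prod_{n>0}\Delta(X_i^{(n-1)})$,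 and let $T_i^1\subseteq T_i^0$ be the set of sequences $\delta_i=(\delta_i^1,\delta_i^2,\dots)$ with $\mathrm{marg}_{X_i^{(n-2)}}(\delta_i^n)=\delta_i^{n-1}$ for all $n>1$. By Kolmogorov extension each $\delta_i\in T_i^1$ determines a unique $\delta_i^*\in\Delta(X_j\times T_j^0)$ with $\mathrm{marg}_{X_i^{(n)}}\delta_i^*=\delta_i^{n+1}$ for all $n\ge 0$. For $k>1$ let $T_i^k=\{\delta_i\in T_i^1:\delta_i^*(X_j\times T_j^{k-1})=1\}$ and $T_i=\bigcap_{k\geq 1}T_i^k$. Then $T_i$ is Polish and $\lambda_i(\delta_i)=\delta_i^*$ defines a homeomorphism $\lambda_i:T_i\to\Delta(X_j\times T_j)$. $\mathrm{RCBR}(E)$. Let $R_i^1=\{(s,t)\in X_i\times T_i:(s,\mathrm{marg}_{X_j}\lambda_i(t))\in E_i\}$, $R_i^{n+1}=\{(s,t)\in R_i^n:\lambda_i(t)(R_j^n)=1\}$ for $n\ge1$, $\mathrm{RCBR}_i(E)=\{s\in X_i:\exists t\in T_i\ \forall n\ge1\ (s,t)\in R_i^n\}$, and $\mathrm{RCBR}(E)=\mathrm{RCBR}_1(E)\times\mathrm{RCBR}_2(E)$. *)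

(* Defs.v *)
From HB Require Import structures.
From mathcomp Require Import all_boot all_order all_algebra.
From mathcomp Require Import all_classical all_reals all_analysis.

Set Implicit Arguments.
Unset Strict Implicit.
Unset Printing Implicit Defensive.
Import Order.TTheory GRing.Theory Num.Theory.
Import numFieldNormedType.Exports.

Local Open Scope classical_set_scope.
Local Open Scope ring_scope.

Definition is_metric (R : realType) (T : Type) (d : T -> T -> R) : Prop :=
  [/\ forall x y, 0 <= d x y,
      forall x y, d x y = 0 <-> x = y,
      forall x y, d x y = d y x &
      forall x y z, d x z <= d x y + d y z].

Definition metrizes (R : realType) (T : topologicalType) (d : T -> T -> R) :=
  forall (x : T) (A : set T),
    nbhs x A <-> exists2 e : R, 0 < e & [set y | d x y < e] `<=` A.

Definition complete_metric (R : realType) (T : Type) (d : T -> T -> R) :=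
  forall u : nat -> T,
    (forall e : R, 0 < e -> exists N, forall m n,
       (N <= m)%N -> (N <= n)%N -> d (u m) (u n) < e) ->
    exists l, forall e : R, 0 < e -> exists N, forall n,
       (N <= n)%N -> d (u n) l < e.

(* The empty space is allowed. *)
Definition polish (R : realType) (T : topologicalType) : Prop :=
  (exists D : set T, countable D /\ dense D) /\
  (exists d : T -> T -> R,
     [/\ is_metric d, metrizes d & complete_metric d]).

(* [prod_topology] is the product topology, here of discrete copies of [nat]. *)
Definition Baire : topologicalType := prod_topology (fun _ : nat => nat).

(* Index 0 stands for the open (Sigma) and closed (Pi) sets, so that the
   Sigma^1_1 sets are the projections of closed subsets of [X * Baire]. *)
Fixpoint Sigma1 (n : nat) (X : topologicalType) (A : set X) : Prop :=
  if n is m.+1 then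
    exists B : set (X * Baire)%type,
      @Sigma1 m (X * Baire)%type (~` B) /\ A = fst @` B
  else open A.

Definition Pi1 (n : nat) (X : topologicalType) (A : set X) : Prop :=
  Sigma1 n (~` A).

(* In the run [x], player I chooses [x 0, x 2, ...] and player II chooses
   [x 1, x 3, ...]; a strategy maps a finite position to the next move. *)
Definition strategy := seq nat -> nat.

Definition followsI (s : strategy) (x : nat -> nat) : Prop :=
  forall n, x n.*2 = s (mkseq x n.*2).

Definition followsII (s : strategy) (x : nat -> nat) : Prop :=
  forall n, x n.*2.+1 = s (mkseq x n.*2.+1).

Definition determined (A : set Baire) : Prop :=
  (exists s : strategy, forall x : Baire, followsI s x -> A x) \/
  (exists s : strategy, forall x : Baire, followsII s x -> ~ A x).

Definition Pi1_determinacy (n : nat) : Prop :=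
  forall A : set Baire, Pi1 n A -> determined A.

Definition borel (T : topologicalType) : set (set T) := <<s (@open T) >>.

Lemma borel_preimage (S T : topologicalType) (f : S -> T) (A : set T) :
  continuous f -> borel A -> borel (f @^-1` A).
Proof.
move=> /continuousP cf.
have sf : sigma_algebra setT [set B : set T | borel (f @^-1` B)].
  split => /=.
  - by rewrite preimage_set0; exact: sigma_algebra0.
  - by move=> B /sigma_algebraCD; rewrite !setTD preimage_setC.
  - by move=> F FB; rewrite preimage_bigcup; exact: sigma_algebra_bigcup.
apply: (smallest_sub sf) => B oB /=.
by apply: sub_sigma_algebra; exact: cf.
Qed.

(* The library's [probability] needs a pointed carrier and leaves the values on
   non-measurable sets unconstrained.  Here the carrier is arbitrary, and the
   value outside the Borel sets is fixed to 0 so that Leibniz equality is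
   equality of Borel measures. *)
Record Delta (R : realType) (T : topologicalType) := MkDelta {
  Dval :> set T -> \bar R ;
  Dval0 : Dval set0 = 0%E ;
  Dval_ge0 : forall A, (0 <= Dval A)%E ;
  Dval_sigma_additive : forall F : nat -> set T,
    (forall n, borel (F n)) -> trivIset setT F ->
    (fun n => \sum_(0 <= i < n) Dval (F i))%E @ \oo --> Dval (\bigcup_n F n) ;
  Dval_setT : Dval setT = 1%E ;
  Dval_nonborel : forall A, ~ borel A -> Dval A = 0%E
}.

HB.instance Definition _ (R : realType) (T : topologicalType) :=
  gen_eqMixin (Delta R T).
HB.instance Definition _ (R : realType) (T : topologicalType) :=
  gen_choiceMixin (Delta R T).

(* [T] with a chosen point, so that it can carry a [measurableType] structure
   and [mu : Delta R T] can be seen as a library [probability]. *)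
Definition pointed_at (T : Type) (x : T) : Type := T.
HB.instance Definition _ (T : topologicalType) (x : T) :=
  Choice.on (pointed_at x).
HB.instance Definition _ (T : topologicalType) (x : T) :=
  isPointed.Build (pointed_at x) x.

Definition borel_at (T : topologicalType) (x : T) :=
  g_sigma_algebraType (@open T : set (set (pointed_at x))).
HB.instance Definition _ (T : topologicalType) (x : T) :=
  Measurable.on (borel_at x).

Definition prob_at (R : realType) (T : topologicalType) (mu : Delta R T)
  (x : T) : set (borel_at x) -> \bar R := mu.

Lemma prob_at_sigma_additive (R : realType) (T : topologicalType)
  (mu : Delta R T) (x : T) : semi_sigma_additive (prob_at mu (x := x)).
Proof. by move=> F mF tF _; exact: Dval_sigma_additive. Qed.

HB.instance Definition _ (R : realType) (T : topologicalType)
    (mu : Delta R T) (x : T) :=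
  isMeasure.Build _ _ _ (prob_at mu (x := x)) (Dval0 mu) (Dval_ge0 mu)
    (@prob_at_sigma_additive R T mu x).
HB.instance Definition _ (R : realType) (T : topologicalType)
    (mu : Delta R T) (x : T) :=
  Measure_isProbability.Build _ _ _ (prob_at mu (x := x)) (Dval_setT mu).

Lemma Delta_inhabited (R : realType) (T : topologicalType) (mu : Delta R T) :
  exists x : T, True.
Proof.
apply: contrapT => noT.
have T0 : [set: T] = set0 by apply/seteqP; split=> x // _; apply: noT; exists x.
by have /eqP := Dval_setT mu; rewrite T0 Dval0 eq_sym onee_eq0.
Qed.

(* The chosen point has no influence on the value of the integral. *)
Definition expect (R : realType) (T : topologicalType) (mu : Delta R T)
    (f : T -> R) : R :=
  \int[prob_at mu (x := projT1 (cid (Delta_inhabited mu)))]_x f x.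

(* Bounded continuous functions. *)
Definition Cb (R : realType) (T : topologicalType) : Type :=
  {f : T -> R | continuous f /\ exists M : R, forall x, `|f x| <= M}.
HB.instance Definition _ (R : realType) (T : topologicalType) :=
  gen_eqMixin (Cb R T).
HB.instance Definition _ (R : realType) (T : topologicalType) :=
  gen_choiceMixin (Cb R T).

Definition expects (R : realType) (T : topologicalType) (mu : Delta R T) :
    prod_topology (fun _ : Cb R T => (R : topologicalType)) :=
  fun f => expect mu (sval f).

(* The weak topology: the coarsest one that makes [mu |-> expect mu f]
   continuous for every bounded continuous [f]. *)
HB.instance Definition _ (R : realType) (T : topologicalType) :=
  Topological.copy (Delta R T) (initial_topology (@expects R T)).

Definition push_val (R : realType) (S T : topologicalType) (f : S -> T)
    (mu : Delta R S) (A : set T) : \bar R :=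
  if `[< borel A >] then mu (f @^-1` A) else 0%E.

Section push.
Context (R : realType) (S T : topologicalType) (f : S -> T).
Context (cf : continuous f) (mu : Delta R S).

Let push_borel A : borel A -> push_val f mu A = mu (f @^-1` A).
Proof. by move=> /asboolT bA; rewrite /push_val bA. Qed.

Let push0 : push_val f mu set0 = 0%E.
Proof. by rewrite push_borel ?preimage_set0 ?Dval0//; exact: sigma_algebra0. Qed.

Let push_ge0 A : (0 <= push_val f mu A)%E.
Proof. by rewrite /push_val; case: ifP => // _; exact: Dval_ge0. Qed.

Let push_sigma_additive F : (forall n, borel (F n)) -> trivIset setT F ->
  (fun n => \sum_(0 <= i < n) push_val f mu (F i))%E @ \oo -->
  push_val f mu (\bigcup_n F n).
Proof.
move=> bF tF; rewrite push_borel; last exact: sigma_algebra_bigcup.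
rewrite preimage_bigcup.
under eq_fun do under eq_bigr do rewrite push_borel//.
apply: Dval_sigma_additive; first by move=> n; exact: borel_preimage.
apply/trivIsetP => i j _ _ ij; rewrite -preimage_setI.
by move/trivIsetP : tF => -> //; rewrite preimage_set0.
Qed.

Let pushT : push_val f mu setT = 1%E.
Proof.
rewrite push_borel ?preimage_setT ?Dval_setT//.
by apply: sub_sigma_algebra; exact: openT.
Qed.

Let push_nonborel A : ~ borel A -> push_val f mu A = 0%E.
Proof. by move=> /asboolF bA; rewrite /push_val bA. Qed.

(* Image measure; marginals are image measures under projections. *)
Definition push : Delta R T :=
  MkDelta push0 push_ge0 push_sigma_additive pushT push_nonborel.

End push.

(* [mu(S) = 1] for the completion of [mu]: the arbitrary set [S] differs from a
   Borel set [A] by a subset of a null set, and [A] has measure one. *)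
Definition prob1 (R : realType) (T : topologicalType) (mu : Delta R T)
    (S : set T) : Prop :=
  exists A N : set T,
    [/\ borel A, borel N, mu N = 0%E, (S `\` A) `|` (A `\` S) `<=` N &
        mu A = 1%E].

(* The players are [false] and [true]; the opponent of [i] is [~~ i]. *)
Definition justified (R : realType) (X : bool -> topologicalType)
    (E : forall i, set (X i * Delta R (X (~~ i)))%type)
    (B : forall i, set (X i)) : Prop :=
  forall i s, B i s ->
    exists2 mu : Delta R (X (~~ i)), E i (s, mu) & prob1 mu (B (~~ i)).

(* The product of [X false] and [X true] is [forall i, X i]. *)
Definition rect (X : bool -> Type) (B : forall i, set (X i)) :
    set (forall i, X i) :=
  [set p | forall i, B i (p i)].

Definition RATi (R : realType) (X : bool -> topologicalType)
    (E : forall i, set (X i * Delta R (X (~~ i)))%type) (i : bool) :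
    set (X i) :=
  \bigcup_(B in justified E) ((fun p => p i) @` rect B).

Definition RAT (R : realType) (X : bool -> topologicalType)
    (E : forall i, set (X i * Delta R (X (~~ i)))%type) :
    set (forall i, X i) :=
  rect (RATi E).

Fixpoint hier (R : realType) (X : bool -> topologicalType) (n : nat)
    (i : bool) : topologicalType :=
  if n is m.+1 then (hier R X m i * Delta R (hier R X m (~~ i)))%type
  else X (~~ i).

(* The coordinate [d n] is the measure of order [n + 1]. *)
Definition T0 (R : realType) (X : bool -> topologicalType) (i : bool) :
    topologicalType :=
  prod_topology (fun n : nat => (Delta R (hier R X n i) : topologicalType)).

Lemma fst_continuous (S T : topologicalType) : continuous (@fst S T).
Proof. by move=> x; exact: cvg_fst. Qed.

Definition T1 (R : realType) (X : bool -> topologicalType) (i : bool) :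
    set (T0 R X i) :=
  [set d | forall n,
     push (@fst_continuous (hier R X n i) (Delta R (hier R X n (~~ i))))
       (d n.+1) = d n].

(* [(x, (t 0, t 1, ...))] is sent to [(x, t 0, ..., t (n - 1))]. *)
Fixpoint trunc (R : realType) (X : bool -> topologicalType) (i : bool)
    (n : nat) : X (~~ i) * T0 R X (~~ i) -> hier R X n i :=
  if n is m.+1 then fun p => (trunc m p, p.2 m) else fun p => p.1.

Lemma pair_continuous (S T U : topologicalType) (f : S -> T) (g : S -> U) :
  continuous f -> continuous g -> continuous (fun x => (f x, g x)).
Proof. by move=> cf cg x; apply: cvg_pair; [exact: cf|exact: cg]. Qed.

Lemma comp_continuous (S T U : topologicalType) (f : S -> T) (g : T -> U) :
  continuous f -> continuous g -> continuous (fun x => g (f x)).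
Proof. by move=> cf cg x; apply: continuous_comp; [exact: cf|exact: cg]. Qed.

Lemma snd_continuous (S T : topologicalType) : continuous (@snd S T).
Proof. by move=> x; exact: cvg_snd. Qed.

Lemma trunc_continuous (R : realType) (X : bool -> topologicalType) (i : bool)
  (n : nat) : continuous (@trunc R X i n).
Proof.
elim: n => [|n IH]; first exact: fst_continuous.
apply: (pair_continuous IH).
have cn : continuous (fun t : T0 R X (~~ i) => t n).
  exact: (@proj_continuous _ (fun n => Delta R (hier R X n (~~ i))) n).
exact: (comp_continuous (@snd_continuous _ _) cn).
Qed.

(* The graph of [d |-> d*]: [m] is the measure d* that Kolmogorov extension
   associates with [d].  On Polish spaces it is a function on [T1 i], which is
   why [exists2 m, is_star d m & ...] below means that d* has the property. *)
Definition is_star (R : realType) (X : bool -> topologicalType) (i : bool)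
    (d : T0 R X i) (m : Delta R (X (~~ i) * T0 R X (~~ i))%type) : Prop :=
  forall n, push (@trunc_continuous R X i n) m = d n.

(* [Tk k i] is the set T_i^{k+1}. *)
Fixpoint Tk (R : realType) (X : bool -> topologicalType) (k : nat) (i : bool) :
    set (T0 R X i) :=
  if k is l.+1 then
    [set d | T1 d /\ exists2 m, is_star d m &
       prob1 m (setT `*` @Tk R X l (~~ i))]
  else @T1 R X i.

Definition Tset (R : realType) (X : bool -> topologicalType) (i : bool) :
    set (T0 R X i) :=
  \bigcap_k (@Tk R X k i).

(* T_i with the topology induced by T_i^0. *)
Definition types (R : realType) (X : bool -> topologicalType) (i : bool) :
    topologicalType :=
  set_type (@Tset R X i).

Definition incl (R : realType) (X : bool -> topologicalType) (i : bool)
    (p : X i * types R X i) : X i * T0 R X i :=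
  (p.1, set_val p.2).

Lemma incl_continuous (R : realType) (X : bool -> topologicalType) (i : bool) :
  continuous (@incl R X i).
Proof.
apply: pair_continuous; first exact: fst_continuous.
have cv : continuous (fun t : types R X i => set_val t).
  exact: (@initial_continuous (set_type (@Tset R X i)) (T0 R X i) set_val).
exact: (comp_continuous (@snd_continuous _ _) cv).
Qed.

(* The graph of lambda_i: [m], viewed as a measure on the larger space, is the
   Kolmogorov extension of [t]. *)
Definition is_lambda (R : realType) (X : bool -> topologicalType) (i : bool)
    (t : types R X i) (m : Delta R (X (~~ i) * types R X (~~ i))%type) : Prop :=
  is_star (set_val t) (push (@incl_continuous R X (~~ i)) m).

(* [RB E n i] is the set R_i^{n+1}. *)
Fixpoint RB (R : realType) (X : bool -> topologicalType)
    (E : forall i, set (X i * Delta R (X (~~ i)))%type) (n : nat) (i : bool) :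
    set (X i * types R X i)%type :=
  if n is m.+1 then
    @RB R X E m i `&`
    [set p | exists2 l, is_lambda p.2 l & prob1 l (@RB R X E m (~~ i))]
  else
    [set p | exists2 l, is_lambda p.2 l &
       E i (p.1, push (@fst_continuous (X (~~ i)) (types R X (~~ i))) l)].

Arguments RB {R X} E n i _.

Definition RCBRi (R : realType) (X : bool -> topologicalType)
    (E : forall i, set (X i * Delta R (X (~~ i)))%type) (i : bool) :
    set (X i) :=
  [set s | exists t : types R X i, forall n, RB E n i (s, t)].

Definition RCBR (R : realType) (X : bool -> topologicalType)
    (E : forall i, set (X i * Delta R (X (~~ i)))%type) :
    set (forall i, X i) :=
  rect (RCBRi E).

(* Main.v *)
Require Import Defs.
From HB Require Import structures.
From mathcomp Require Import all_boot all_order all_algebra.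
From mathcomp Require Import all_classical all_reals all_analysis.
From mathcomp Require Import measurable_realfun.
From mathcomp Require Import ring lra.

(* [RCBRi E] is itself justified: every measure on a continuous image of Baire
   space is the image of a measure on Baire space, so the measurability of the
   sets [RCBRi E i] for the relevant completions is automatic.  This gives
   RCBR <= RAT for arbitrary [E].

   For RAT <= RCBR, let [kappa] be a continuous map of Baire space onto the
   probability measures on Baire space such that the [k]-th digit of some code
   of a measure is determined by its marginal on the first [k] coordinates.  A
   point [z] of Baire space then codes a strategy together with a witness for
   [E] and a belief about the code of the opponent.  Let [O k] be a decreasing
   sequence of sets of codes, stable under one more round of mutual belief, and
   whose intersection only codes strategies in RCBR (an iterated belief operator
   in case (b), a clopen approximation of it in case (a)).  For strategies [xi]
   of player i and [xi'] of player j, consider the game in which I completes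
   [xi] to a code, II completes [xi'], and I wins when the code of II leaves
   the sets [O k] strictly before that of I.  Call [xi] doomed when all its codes
   leave the sets [O k].  If [xi] is doomed and lies in a justified set [B], then I
   wins against some [xi'] in [B], which is again doomed: otherwise II wins against all
   of them, the winning strategies can be selected along a measure justifying
   [xi], and I can play a code of the distribution of the answers to that very
   play; this code stays in all [O k].  Along a chain of doomed strategies the
   winning strategies of I are played against each other, and the least [k] with
   a code outside [O k] decreases forever.

   In case (a) the games are open and the set of winning strategies of II is
   closed.  In case (b) the games are Pi^1_3 and the selection from a Pi^1_3 set
   is obtained by a covering game, itself Pi^1_3. *)

(* A second time, since [Baire] also names a theorem of the library. *)
Import Defs.
Set Implicit Arguments.
Unset Strict Implicit.
Unset Printing Implicit Defensive.
Import Order.TTheory GRing.Theory Num.Theory.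
Import numFieldNormedType.Exports.

Local Open Scope classical_set_scope.
Local Open Scope ring_scope.

(** The obstacle is that a justified set [B] is arbitrary: attaching a type to each of its
    strategies would call for a choice measurable along every measure involved. The game replaces
    this choice by a fixed point, found digit by digit during a play. Selection is asked for in a
    weak form, a continuous map whose range has outer measure one: measures lift along such maps
    ([lift_measure]), and continuous images in Hausdorff spaces of sets of measure one in Baire
    space are measurable for the completion ([prob1_push]). Spaces are therefore handled through
    maps from Baire space rather than through metrics, which also covers the type spaces, obtained
    here as Suslin subspaces. The index 3 in case (b) arises as follows. The belief sets [O k] stay
    Pi^1_2 because a failure of [prob1] is witnessed by a dominated measure living on a set one
    level lower. Comparing these sets with their complements costs Pi^1_3. The covering game for a
    Pi^1_3 set remains Pi^1_3 because the point that player I builds is determined by the moves. *)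

(** * Product topologies and Baire space *)

Lemma prod_cvg (I : Type) (K : I -> topologicalType)
    (F : set_system (prod_topology K)) (x : prod_topology K) : Filter F ->
  (forall i B, nbhs (x i) B -> F [set y : prod_topology K | B (y i)]) -> F --> x.
Proof.
move=> FF h; apply/cvg_sup => i A /= [_ [[B oB <-] Bx sBA]].
apply: (filterS _ (h i B _)) => //.
exact: open_nbhs_nbhs.
Qed.

Lemma prod_continuous (Y : topologicalType) (I : Type) (K : I -> topologicalType)
    (f : Y -> prod_topology K) :
  (forall i, continuous (fun y => f y i)) -> continuous f.
Proof. by move=> cf y; apply: prod_cvg => i B Bfy; exact: cf. Qed.

Lemma coord_continuous (I : Type) (K : I -> topologicalType) (i : I) :
  continuous (fun x : prod_topology K => x i).
Proof.
move=> x B Bxi; have : nbhs x --> x by exact: cvg_id.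
move/cvg_sup => /(_ i); apply.
exact: (@initial_continuous (forall i, K i) (K i) (fun f => f i) x B Bxi).
Qed.

Definition cyl (x : nat -> nat) (k : nat) : set Baire :=
  [set y | forall i, (i < k)%N -> y i = x i].

Lemma cyl_refl x k : cyl x k x. Proof. by []. Qed.

Lemma cyl_sym x y k : cyl x k y -> cyl y k x.
Proof. by move=> xy i ik; rewrite xy. Qed.

Lemma nbhs_coord (x : Baire) (i : nat) : nbhs x [set y : Baire | y i = x i].
Proof.
apply: (@coord_continuous nat (fun _ => nat) i x [set n | n = x i]).
exact: discrete_set1.
Qed.

Lemma nbhs_cyl (x : Baire) k : nbhs x (cyl x k).
Proof.
elim: k => [|k IH]; first by apply: filterS filterT => y _ i.
apply: filterS (filterI IH (nbhs_coord x k)) => y [yx yk] i.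
by rewrite ltnS leq_eqVlt => /orP[/eqP ->//|]; exact: yx.
Qed.

Lemma nbhs_BaireP (x : Baire) (A : set Baire) :
  nbhs x A <-> exists k, cyl x k `<=` A.
Proof.
split=> [xA|[k xA]]; last exact: filterS xA (nbhs_cyl x k).
pose F : set_system Baire := [set B : set Baire | exists k, cyl x k `<=` B].
have FF : Filter F.
  split; first by exists 0%N.
  - move=> P Q [k kP] [l lQ]; exists (maxn k l) => y yx; split.
      by apply: kP => i ik; apply: yx; rewrite leq_max ik.
    by apply: lQ => i ik; apply: yx; rewrite leq_max ik orbT.
  - by move=> P Q PQ [k kP]; exists k; exact: subset_trans PQ.
suff : F --> x by exact.
apply: prod_cvg => i B Bxi; exists i.+1 => y yx /=.
by rewrite yx//; exact: nbhs_singleton.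
Qed.

Lemma clopen_prefix (A : set Baire) k :
  (forall x y, cyl x k y -> A x -> A y) -> clopen A.
Proof.
move=> h; split; first by rewrite openE => x Ax; apply/nbhs_BaireP; exists k => y /h; exact.
rewrite -openC openE => x nAx; apply/nbhs_BaireP; exists k => y xy Ay.
by apply: nAx; apply: h Ay; exact: cyl_sym.
Qed.

Lemma clopen_cyl x k : clopen (cyl x k).
Proof.
apply: (@clopen_prefix _ k) => y z yz xy i ik.
by rewrite yz// xy.
Qed.

Lemma Baire_continuous (Y : topologicalType) (f : Y -> Baire) :
  (forall y i, nbhs y [set z | f z i = f y i]) -> continuous f.
Proof.
move=> h; apply: prod_continuous => i y B By.
by apply: filterS (h y i) => z /= ->; exact: nbhs_singleton.
Qed.

Lemma Baire_prefix_continuous (f : Baire -> Baire) :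
  (forall i, exists k, forall x y, cyl x k y -> f y i = f x i) -> continuous f.
Proof.
move=> h; apply: Baire_continuous => x i; have [k hk] := h i.
by apply/nbhs_BaireP; exists k => y /hk.
Qed.

Lemma continuous_Baire_nbhs (Y : topologicalType) (f : Y -> Baire) y i :
  continuous f -> nbhs y [set z | f z i = f y i].
Proof. by move=> cf; exact: (cf y _ (nbhs_coord (f y) i)). Qed.

(** * Completely regular images of Baire space *)

Section nice.
Context (R : realType).

(** Complete regularity without normalisation: asking only for [0 < f x] lets bumps be multiplied,
    which settles products. *)
Definition creg (S : topologicalType) := forall (x : S) A, nbhs x A ->
  exists f : S -> R, [/\ continuous f, forall y, 0 <= f y <= 1, 0 < f x &
    forall y, 0 < f y -> A y].

Definition t1 (S : topologicalType) := forall x y : S,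
  (forall A, nbhs x A -> A y) -> x = y.

(** Nonempty analytic sets: the empty set is excluded, hence the inhabitation hypotheses in what
    follows. *)
Definition suslin (S : topologicalType) (A : set S) :=
  exists2 f : Baire -> S, continuous f & range f = A.

(** The working substitute for Polish spaces. It is stable under countable products, [Delta] and
    Suslin subspaces without any metric to construct, and it suffices for the Lindelof property and
    the regularity of measures. *)
Definition nice (S : topologicalType) :=
  [/\ creg S, t1 S & suslin [set: S]].

Lemma creg_hausdorff (S : topologicalType) : creg S -> t1 S -> hausdorff_space S.
Proof.
move=> cS tS x y cxy; apply: tS => A xA.
apply: contrapT => nAy.
have [f [cf f01 fx fA]] := cS x A xA.
have fy : f y = 0.
  apply/eqP; rewrite eq_le (andP (f01 y)).1 andbT leNgt; apply/negP => /fA //.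
have o1 : nbhs x [set z | f x / 2 < f z].
  by apply: (cf x [set r | f x / 2 < r]); apply: open_nbhs_nbhs; split; [exact: open_gt|rewrite /=; lra].
have o2 : nbhs y [set z | f z < f x / 2].
  by apply: (cf y [set r | r < f x / 2]); apply: open_nbhs_nbhs; split; [exact: open_lt|rewrite /= fy; lra].
have [z [/= z1 z2]] := cxy _ _ o1 o2.
by move: (lt_trans z1 z2); rewrite ltxx.
Qed.

Lemma creg_prod (I : Type) (K : I -> topologicalType) :
  (forall i, creg (K i)) -> creg (prod_topology K).
Proof.
move=> cK x A xA.
(* The sets that admit a bump at [x] form a filter, so convergence has to be checked on single
   coordinates only. *)
pose F : set_system (prod_topology K) := [set B : set (prod_topology K) | exists f : prod_topology K -> R,
  [/\ continuous f, forall y, 0 <= f y <= 1, 0 < f x & forall y, 0 < f y -> B y]].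
have FF : Filter F.
  split.
  - exists (fun=> 1); split => //; first exact: cst_continuous.
    by move=> _; rewrite ler01 lexx.
  - move=> P Q [f [cf f01 fx fP]] [g [cg g01 gx gQ]].
    exists (fun y => f y * g y); split => [y|y||y].
    + by apply: (@continuousM R (prod_topology K) f g); [exact: cf|exact: cg].
    + have /andP[f0 f1] := f01 y; have /andP[g0 g1] := g01 y.
      by rewrite mulr_ge0//= mulr_ile1.
    + exact: mulr_gt0.
    + have /andP[f0 f1] := f01 y; have /andP[g0 g1] := g01 y.
      move=> fg; split; [apply: fP|apply: gQ]; rewrite lt0r ?f0 ?g0 andbT; apply/eqP => e0;
      by move: fg; rewrite e0 ?mul0r ?mulr0 ltxx.
  - by move=> P Q PQ [f [cf f01 fx fP]]; exists f; split => // y /fP /PQ.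
suff : F --> x by exact.
apply: prod_cvg => i B Bxi.
have [f [cf f01 fx fB]] := cK i _ _ Bxi.
exists (fun y => f (y i)); split => //; last by move=> y /fB.
exact: (comp_continuous (@coord_continuous I K i) cf).
Qed.

Lemma t1_prod (I : Type) (K : I -> topologicalType) :
  (forall i, t1 (K i)) -> t1 (prod_topology K).
Proof.
move=> tK x y h; apply: functional_extensionality_dep => i.
by apply: tK => A xA; apply: (h _ (@coord_continuous I K i x A xA)).
Qed.

Lemma creg_pair (S T : topologicalType) : creg S -> creg T -> creg (S * T)%type.
Proof.
move=> cS cT [x y] A [[P Q] /= [xP yQ] PQA].
have [f [cf f01 fx fP]] := cS _ _ xP.
have [g [cg g01 gx gQ]] := cT _ _ yQ.
exists (fun z => f z.1 * g z.2); split => [z|z||z].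
- apply: (@continuousM R (S * T)%type (fun z => f z.1) (fun z => g z.2)).
    exact: (comp_continuous (@fst_continuous _ _) cf).
  exact: (comp_continuous (@snd_continuous _ _) cg).
- have /andP[f0 f1] := f01 z.1; have /andP[g0 g1] := g01 z.2.
  by rewrite mulr_ge0//= mulr_ile1.
- exact: mulr_gt0.
- have /andP[f0 f1] := f01 z.1; have /andP[g0 g1] := g01 z.2.
  move=> fg; apply: PQA; split => /=; [apply: fP|apply: gQ];
  rewrite lt0r ?f0 ?g0 andbT; apply/eqP => e0;
  by move: fg; rewrite e0 ?mul0r ?mulr0 ltxx.
Qed.

Lemma t1_pair (S T : topologicalType) : t1 S -> t1 T -> t1 (S * T)%type.
Proof.
move=> tS tT [x y] [x' y'] h; congr (_, _).
  by apply: tS => A xA; exact: (h _ (@fst_continuous S T (x, y) A xA)).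
by apply: tT => A yA; exact: (h _ (@snd_continuous S T (x, y) A yA)).
Qed.

Lemma creg_initial (S : choiceType) (T : topologicalType) (f : S -> T) :
  creg T -> creg (initial_topology f).
Proof.
move=> cT x A /= [_ [[B oB <-] Bx sBA]].
have [|g [cg g01 gx gB]] := cT (f x) B; first exact: open_nbhs_nbhs.
exists (fun y => g (f y)); split => //; last by move=> y /gB /sBA.
exact: (comp_continuous (@initial_continuous S T f) cg).
Qed.

Lemma t1_initial (S : choiceType) (T : topologicalType) (f : S -> T) :
  injective f -> t1 T -> t1 (initial_topology f).
Proof.
move=> fi tT x y h; apply: fi; apply: tT => A xA.
exact: (h (f @^-1` A) (@initial_continuous S T f x A xA)).
Qed.

Lemma nbhs_nat (n : nat) : nbhs n [set n].
Proof. exact: discrete_set1. Qed.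

Lemma creg_nat : creg nat.
Proof.
move=> n A nA; exists (fun m => (m == n)%:R); split.
- move=> m B Bm; change (nbhs m [set k : nat | B (k == n)%:R]).
  have FF : Filter (nbhs (m : (nat : topologicalType))) := nbhs_filter _.
  refine (@filterS _ _ FF _ _ _ (@nbhs_nat m)) => k ->.
  exact: (@nbhs_singleton _ _ _ Bm).
- by move=> y; case: (_ == _) => /=; rewrite ?lexx ?ler01.
- by rewrite eqxx.
- by move=> y; case: eqP => [-> _|]; [exact: nbhs_singleton|rewrite ltxx].
Qed.

Lemma t1_nat : t1 nat.
Proof. by move=> m n h; apply/esym; exact: (h _ (@nbhs_nat m)). Qed.

Lemma creg_Baire : creg Baire. Proof. by apply: creg_prod => _; exact: creg_nat. Qed.
Lemma t1_Baire : t1 Baire. Proof. by apply: t1_prod => _; exact: t1_nat. Qed.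

Lemma nice_Baire : nice Baire.
Proof.
split; [exact: creg_Baire|exact: t1_Baire|].
by exists id; [move=> x; exact: cvg_id|apply/seteqP; split => // x _; exists x].
Qed.
End nice.

(** * Borel sets, probabilities and measure one for the completion *)

Section borel.
Context (T : topologicalType).
Implicit Types A B : set T.

Lemma borel0 : borel (@set0 T). Proof. exact: sigma_algebra0. Qed.

Lemma borel_open A : open A -> borel A.
Proof. by move=> oA; apply: sub_sigma_algebra. Qed.

Lemma borelC A : borel A -> borel (~` A). Proof. by move=> bA; have := sigma_algebraCD bA; rewrite setTD. Qed.

Lemma borelT : borel [set: T]. Proof. by apply: borel_open; exact: openT. Qed.

Lemma borel_closed A : closed A -> borel A.
Proof.
by move=> cA; rewrite -(setCK A); apply: borelC; apply: borel_open; exact: closed_openC.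
Qed.

Lemma borel_bigcup (F : nat -> set T) : (forall n, borel (F n)) -> borel (\bigcup_n F n).
Proof. exact: sigma_algebra_bigcup. Qed.

Lemma borel_bigcap (F : nat -> set T) : (forall n, borel (F n)) -> borel (\bigcap_n F n).
Proof.
move=> bF; rewrite -(setCK (\bigcap_n F n)) setC_bigcap; apply: borelC.
by apply: borel_bigcup => n; exact: borelC.
Qed.

Lemma borelU A B : borel A -> borel B -> borel (A `|` B).
Proof.
move=> bA bB; rewrite -bigcup2E; apply: borel_bigcup => -[|[|n]] //=.
exact: borel0.
Qed.

Lemma borelI A B : borel A -> borel B -> borel (A `&` B).
Proof.
move=> bA bB; rewrite -(setCK (A `&` B)) setCI; apply: borelC.
by apply: borelU; exact: borelC.
Qed.

Lemma borelD A B : borel A -> borel B -> borel (A `\` B).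
Proof. by move=> bA bB; rewrite setDE; apply: borelI => //; exact: borelC. Qed.

Lemma borel_bigcup_lt (F : nat -> set T) n :
  (forall i, borel (F i)) -> borel (\bigcup_(i in [set i | (i < n)%N]) F i).
Proof.
move=> bF; rewrite bigcup_mkcond; apply: borel_bigcup => i.
by case: ifP => _ //; exact: borel0.
Qed.

End borel.

Section pr.
Context (R : realType) (T : topologicalType).
Implicit Types (m : Delta R T) (A B : set T).

Definition pr m A : R := fine (m A).

Lemma Dval_le m A B : borel A -> borel B -> A `<=` B -> (m A <= m B)%E.
Proof.
move=> bA bB AB; have [x _] := Delta_inhabited m.
by apply: (@le_measure _ _ _ (prob_at m (x := x))); rewrite ?inE.
Qed.

Lemma Dval_le1 m A : borel A -> (m A <= 1)%E.
Proof. by move=> bA; rewrite -(Dval_setT m); apply: Dval_le => //; exact: borelT. Qed.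

Lemma Dval_fin m A : m A \is a fin_num.
Proof.
have [bA|nbA] := pselect (borel A); last by rewrite Dval_nonborel.
by rewrite ge0_fin_numE ?Dval_ge0// (le_lt_trans (Dval_le1 m bA))// ltry.
Qed.

Lemma prE m A : m A = (pr m A)%:E. Proof. by rewrite fineK// Dval_fin. Qed.

Lemma pr_ge0 m A : 0 <= pr m A.
Proof. by rewrite -lee_fin -prE Dval_ge0. Qed.

Lemma pr_le m A B : borel A -> borel B -> A `<=` B -> pr m A <= pr m B.
Proof. by move=> bA bB AB; rewrite -lee_fin -!prE Dval_le. Qed.

Lemma pr_le1 m A : borel A -> pr m A <= 1.
Proof. by move=> bA; rewrite -lee_fin -prE Dval_le1. Qed.

Lemma prT m : pr m setT = 1. Proof. by rewrite /pr Dval_setT. Qed.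

Lemma pr0 m : pr m set0 = 0. Proof. by rewrite /pr Dval0. Qed.

Lemma Delta_eq m m' : (forall A, borel A -> pr m A = pr m' A) -> m = m'.
Proof.
move=> h; have e : Dval m = Dval m'.
  apply/funext => A; have [bA|nbA] := pselect (borel A); last by rewrite !Dval_nonborel.
  by rewrite !prE h.
case: m m' e {h} => v v0 v1 v2 v3 v4 [w w0 w1 w2 w3 w4] /= e; subst w.
by congr MkDelta; exact: Prop_irrelevance.
Qed.

Lemma prDU m A B : borel A -> borel B -> A `&` B = set0 ->
  pr m (A `|` B) = pr m A + pr m B.
Proof.
move=> bA bB AB; apply: EFin_inj; rewrite EFinD -!prE.
have [x _] := Delta_inhabited m.
exact: (@measureU _ _ _ (prob_at m (x := x))).
Qed.

Lemma prC m A : borel A -> pr m (~` A) = 1 - pr m A.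
Proof.
move=> bA; rewrite -(prT m) -(setUv A) prDU ?setICr//; last exact: borelC.
by rewrite addrC addKr.
Qed.

Lemma prD m A B : borel A -> borel B -> B `<=` A -> pr m (A `\` B) = pr m A - pr m B.
Proof.
move=> bA bB BA; rewrite -{2}(setDUK BA) prDU//.
- by rewrite addrC addKr.
- exact: borelD.
- by rewrite setDE setICA setICr setI0.
Qed.

Lemma prIDe m A B : borel A -> borel B -> pr m A = pr m (A `&` B) + pr m (A `\` B).
Proof.
move=> bA bB; rewrite -prDU; last by rewrite setDE setIACA setICr setI0.
- by rewrite setUIDK.
- exact: borelI.
- exact: borelD.
Qed.

Lemma prU_le m A B : borel A -> borel B -> pr m (A `|` B) <= pr m A + pr m B.
Proof.
move=> bA bB; have -> : A `|` B = A `|` (B `\` A).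
  apply/seteqP; split=> x; last by case=> [|[]]; [left|right].
  by case=> [Ax|Bx]; have [Ax'|nAx] := pselect (A x); [left|left|left|right].
rewrite prDU//; first by rewrite lerD2l pr_le//; exact: borelD.
- exact: borelD.
- by rewrite setDE setICA setICr setI0.
Qed.

Lemma pr_cvg_up m (F : nat -> set T) : (forall n, borel (F n)) ->
  (forall n, F n `<=` F n.+1) -> pr m \o F @ \oo --> pr m (\bigcup_n F n).
Proof.
move=> bF nF; have [x _] := Delta_inhabited m.
have : (prob_at m (x := x)) \o F @ \oo --> (prob_at m (x := x)) (\bigcup_n F n).
  apply: nondecreasing_cvg_mu => //; first exact: borel_bigcup.
  by apply/nondecreasing_seqP => n; exact/subsetPset.
rewrite /prob_at prE => /fine_cvgP[_]; exact.
Qed.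

Lemma pr_cvg_down m (F : nat -> set T) : (forall n, borel (F n)) ->
  (forall n, F n.+1 `<=` F n) -> pr m \o F @ \oo --> pr m (\bigcap_n F n).
Proof.
move=> bF nF.
have h : pr m \o (fun n => ~` F n) @ \oo --> pr m (\bigcup_n ~` F n).
  by apply: pr_cvg_up => n; [exact: borelC|apply: subsetC].
rewrite -setC_bigcap prC in h; last exact: borel_bigcap.
have -> : pr m \o F = (fun n => 1 - (pr m \o (fun n => ~` F n)) n).
  by apply/funext => n /=; rewrite prC// opprB addrC subrK.
rewrite -[X in _ --> X](subKr 1 (pr m (\bigcap_n F n))).
by apply: cvgB => //; exact: cvg_cst.
Qed.

Lemma pr_bigcup_series m (F : nat -> set T) : (forall n, borel (F n)) ->
  trivIset setT F -> (fun n => \sum_(0 <= i < n) pr m (F i)) @ \oo --> pr m (\bigcup_n F n).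
Proof.
move=> bF tF; have := @Dval_sigma_additive _ _ m F bF tF; rewrite prE.
rewrite (_ : (fun n => \sum_(0 <= i < n) m (F i))%E = EFin \o (fun n => \sum_(0 <= i < n) pr m (F i))).
  by move=> /fine_cvgP[_]; exact.
by apply/funext => n /=; rewrite -sumEFin; apply: eq_bigr => i _; rewrite prE.
Qed.

End pr.

Section pr2.
Context (R : realType) (T : topologicalType).
Implicit Types (m : Delta R T) (A B : set T).

Lemma pr_bigcup_le m (F : nat -> set T) (e : R) : (forall n, borel (F n)) ->
  (forall n, \sum_(0 <= i < n) pr m (F i) <= e) -> pr m (\bigcup_n F n) <= e.
Proof.
move=> bF le_e.
pose G n := \bigcup_(i in [set i | (i < n)%N]) F i.
have bG n : borel (G n) by exact: borel_bigcup_lt.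
have -> : \bigcup_n F n = \bigcup_n G n.
  apply/seteqP; split=> x; first by case=> n _ Fx; exists n.+1 => //; exists n => //=.
  by case=> n _ [i _ Fx]; exists i.
have GS n : G n.+1 = G n `|` F n.
  apply/seteqP; split=> x.
    case=> i; rewrite /= ltnS leq_eqVlt => /orP[/eqP ->|ik] Fx; first by right.
    by left; exists i.
  by case=> [[i ik Fx]|Fx]; [exists i => //=; exact: ltnW|exists n => /=].
have h := @pr_cvg_up _ _ m G bG.
have nG n : G n `<=` G n.+1 by rewrite GS => x; left.
have leG n : pr m (G n) <= \sum_(0 <= i < n) pr m (F i).
  elim: n => [|n IH].
    rewrite big_nil (_ : G 0%N = set0) ?pr0//.
    by apply/seteqP; split=> x // -[].
  rewrite big_nat_recr//= GS; apply: (le_trans (prU_le _ _ _)) => //.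
  by rewrite lerD2r.
rewrite -(cvg_lim (@Rhausdorff R) (h nG)).
apply: limr_le; first by apply/cvg_ex; eexists; exact: h.
by apply: nearW => n /=; exact: le_trans (leG n) (le_e n).
Qed.

Lemma pr_bigcup0 m (F : nat -> set T) : (forall n, borel (F n)) ->
  (forall n, pr m (F n) = 0) -> pr m (\bigcup_n F n) = 0.
Proof.
move=> bF F0; apply/eqP; rewrite eq_le pr_ge0 andbT.
by apply: pr_bigcup_le => // n; rewrite big1.
Qed.

Lemma pr_bigcap1 m (F : nat -> set T) : (forall n, borel (F n)) ->
  (forall n, pr m (F n) = 1) -> pr m (\bigcap_n F n) = 1.
Proof.
move=> bF F1.
have := @pr_bigcup0 m (fun n => ~` F n) (fun n => borelC (bF n)).
rewrite -setC_bigcap prC; last exact: borel_bigcap.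
move=> h; apply/eqP; rewrite eq_sym -subr_eq0 h// => n.
by rewrite prC// F1 subrr.
Qed.

Lemma pr_le0 m A B : borel A -> borel B -> A `<=` B -> pr m B = 0 -> pr m A = 0.
Proof. by move=> bA bB AB B0; apply/eqP; rewrite eq_le pr_ge0 -B0 pr_le. Qed.

Lemma Delta_eq_setI (G : set (set T)) m m' :
  @open T `<=` <<s G >> -> G `<=` @borel T -> setI_closed G -> G setT ->
  (forall A, G A -> pr m A = pr m' A) -> m = m'.
Proof.
move=> oG Gb GI GT h; apply: Delta_eq => A bA.
have dyn : dynkin [set A | borel A /\ pr m A = pr m' A].
  split.
  - by split; [exact: borelT|rewrite !prT].
  - by move=> B [bB e]; split; [exact: borelC|rewrite !prC ?e].
  - move=> F tF bF; have bF' n : borel (F n) := (bF n).1.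
    split; first exact: borel_bigcup.
    have h1 := @pr_bigcup_series _ _ m F bF' tF.
    have h2 := @pr_bigcup_series _ _ m' F bF' tF.
    rewrite -(cvg_lim (@Rhausdorff R) h1) -(cvg_lim (@Rhausdorff R) h2).
    congr (lim (_ @ \oo)); apply/funext => n.
    by apply: eq_bigr => i _; rewrite (bF i).2.
have sub : <<s G >> `<=` [set A | borel A /\ pr m A = pr m' A].
  rewrite -setI_closed_g_dynkin_g_sigma_algebra//.
  by apply: smallest_sub => // B GB; split; [exact: Gb|exact: h].
suff : <<s G >> A by move=> /sub [].
by move: A bA; apply: smallest_sub => //; exact: smallest_sigma_algebra.
Qed.

Lemma Delta_eq_open m m' : (forall U, open U -> pr m U = pr m' U) -> m = m'.
Proof.
apply: Delta_eq_setI.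
- by move=> U oU; apply: sub_sigma_algebra.
- by move=> U oU; apply: borel_open.
- by move=> U V; exact: openI.
- exact: openT.
Qed.

(** Removing the null set [N] from [A] leaves a Borel subset of [S] of full measure; [prob1] is used
    in this form below. *)
Lemma prob1P m S : prob1 m S <-> exists A, [/\ borel A, A `<=` S & pr m A = 1].
Proof.
split=> [[A [N [bA bN N0 h A1]]]|[A [bA AS A1]]].
  exists (A `\` N); split; first exact: borelD.
    by move=> x [Ax nNx]; apply: contrapT => nSx; apply: nNx; apply: h; right.
  have N0' : pr m N = 0 by rewrite /pr N0.
  have A1' : pr m A = 1 by rewrite /pr A1.
  have AN0 : pr m (A `&` N) = 0 by apply: (pr_le0 _ _ _ N0') => //; exact: borelI.
  by have := @prIDe _ _ m A N bA bN; rewrite A1' AN0 add0r.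
exists A, (~` A); split => //; first exact: borelC.
- by rewrite prE prC// A1 subrr.
- by move=> x [[_]|[/AS]].
- by rewrite prE A1.
Qed.

Lemma prob1_borel m A : borel A -> prob1 m A <-> pr m A = 1.
Proof.
move=> bA; rewrite prob1P; split=> [[B [bB BA B1]]|A1]; last by exists A; split.
by apply/eqP; rewrite eq_le pr_le1//= -B1 pr_le.
Qed.

Lemma prob1S m A B : A `<=` B -> prob1 m A -> prob1 m B.
Proof.
by move=> AB /prob1P[C [bC CA C1]]; apply/prob1P; exists C; split => //; exact: subset_trans AB.
Qed.

Lemma prob1T m : prob1 m setT.
Proof. by apply/prob1_borel; [exact: borelT|exact: prT]. Qed.

Lemma prob1_bigcap m (F : nat -> set T) :
  (forall n, prob1 m (F n)) -> prob1 m (\bigcap_n F n).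
Proof.
move=> F1; have /choice[G hG] : forall n, exists A, [/\ borel A, A `<=` F n & pr m A = 1].
  by move=> n; apply/prob1P.
apply/prob1P; exists (\bigcap_n G n); split.
- by apply: borel_bigcap => n; case: (hG n).
- by move=> x Gx n _; have [_ GF _] := hG n; apply: GF; exact: Gx.
- by apply: pr_bigcap1 => n; case: (hG n).
Qed.

Lemma pr_gt0_nonempty m A : 0 < pr m A -> A !=set0.
Proof.
move=> A0; apply/set0P; apply: contraTneq A0 => ->; by rewrite pr0 ltxx.
Qed.

Lemma prob1_nonempty m A : prob1 m A -> A !=set0.
Proof.
by move=> /prob1P[B [_ BA B1]]; have [|x Bx] := @pr_gt0_nonempty m B;
  [rewrite B1|exists x; exact: BA].
Qed.

(** Outer measure one. No measurability is implied, in contrast to [prob1]. *)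
Definition outer1 m A := forall B, borel B -> A `<=` B -> pr m B = 1.

Lemma prob1_outer1 m A : prob1 m A -> outer1 m A.
Proof.
move=> /prob1P[C [bC CA C1]] B bB AB; apply/eqP.
by rewrite eq_le pr_le1//= -C1 pr_le//; exact: subset_trans AB.
Qed.

(** Measurable hull: intersect Borel supersets whose measures approach the infimum; no other Borel
    superset can then cut off a part of positive measure. *)
Lemma hull m A : exists H, [/\ borel H, A `<=` H &
  forall B, borel B -> A `<=` B -> pr m (H `\` B) = 0].
Proof.
pose S := [set r | exists B, [/\ borel B, A `<=` B & r = pr m B]].
have hS : has_inf S.
  split; first by exists (pr m setT), setT; split => //; exact: borelT.
  by exists 0 => _ [B [_ _ ->]]; exact: pr_ge0.
have /choice[F hF] : forall n, exists B, [/\ borel B, A `<=` B & pr m B < inf S + n.+1%:R^-1].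
  move=> n; have [_ [B [bB AB ->]] lt] := @inf_adherent _ S n.+1%:R^-1 ltac:(by rewrite invr_gt0 ltr0n) hS.
  by exists B.
have bF n : borel (F n) by case: (hF n).
exists (\bigcap_n F n); split; first exact: borel_bigcap.
  by move=> x Ax n _; have [_ AF _] := hF n; exact: AF.
move=> B bB AB; set H := \bigcap_n F n.
have bH : borel H by exact: borel_bigcap.
have leS : inf S <= pr m (H `&` B).
  apply: inf_lbound; first by exists 0 => _ [C [_ _ ->]]; exact: pr_ge0.
  exists (H `&` B); split => //; first exact: borelI.
  move=> x Ax; split; last exact: AB.
  by move=> n _; have [_ AF _] := hF n; exact: AF.
have Hle : pr m H <= inf S.
  apply/ler_addgt0Pr => e e0.
  have [n _ hn] := near_infty_natSinv_lt (PosNum e0).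
  have := hn n (leqnn n); rewrite /= => ltn.
  have [_ _ lt] := hF n.
  apply: (@le_trans _ _ (pr m (F n))); first by apply: pr_le => // x; exact.
  by apply: ltW; apply: (lt_trans lt); rewrite ltrD2l.
apply/eqP; rewrite eq_le pr_ge0 andbT.
have := @prIDe _ _ m H B bH bB; lra.
Qed.

Lemma Delta_make (v : set T -> R) : (forall A, borel A -> 0 <= v A) -> v setT = 1 ->
  (forall F, (forall n, borel (F n)) -> trivIset setT F ->
    (fun n => \sum_(0 <= i < n) v (F i)) @ \oo --> v (\bigcup_n F n)) ->
  exists m : Delta R T, forall A, borel A -> pr m A = v A.
Proof.
move=> v0 v1 vs.
pose w A : \bar R := if `[< borel A >] then (v A)%:E else 0%E.
have wE A : borel A -> w A = (v A)%:E by move=> /asboolT bA; rewrite /w bA.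
(* For the constant sequence [set0], the shifted partial sums tend both to [v set0] and to
   [v set0 + v set0]. *)
have vset0 : v set0 = 0.
  have := vs (fun _ => set0) (fun _ => @borel0 T) (@trivIset_set0 _ _ _).
  rewrite bigcup0// => h; apply/eqP.
  have h2 : (fun n => \sum_(0 <= i < n.+1) v (@set0 T)) @ \oo --> v set0.
    have := h; rewrite -(cvg_shiftS (fun n => \sum_(0 <= i < n) v (@set0 T))); exact.
  have e : (fun n => \sum_(0 <= i < n.+1) v (@set0 T)) =
      (fun n => \sum_(0 <= i < n) v (@set0 T) + v set0).
    by apply/funext => n; rewrite big_nat_recr.
  rewrite e in h2.
  have h3 : (fun n => \sum_(0 <= i < n) v (@set0 T) + v set0) @ \oo --> v (@set0 T) + v set0.
    by apply: cvgD => //; exact: cvg_cst.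
  have e2 : v set0 = v set0 + v set0 by exact: (cvg_unique (@Rhausdorff R) h2 h3).
  by rewrite -(subrr (v set0)) eq_sym subr_eq -e2.
have w0 : w set0 = 0%E by rewrite wE ?vset0//; exact: borel0.
have wge0 A : (0 <= w A)%E.
  by rewrite /w; case: ifPn => // /asboolP bA; rewrite lee_fin v0.
have ws F : (forall n, borel (F n)) -> trivIset setT F ->
    (fun n => \sum_(0 <= i < n) w (F i))%E @ \oo --> w (\bigcup_n F n).
  move=> bF tF; rewrite wE; last exact: borel_bigcup.
  rewrite (_ : (fun n => _) = EFin \o (fun n => \sum_(0 <= i < n) v (F i))); last first.
    by apply/funext => n /=; rewrite -sumEFin; apply: eq_bigr => i _; rewrite wE.
  by apply: cvg_EFin; [exact: nearW|exact: vs].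
have w1 : w setT = 1%E by rewrite wE ?v1//; exact: borelT.
have wn A : ~ borel A -> w A = 0%E by move=> /asboolF bA; rewrite /w bA.
exists (MkDelta w0 wge0 ws w1 wn) => A bA.
by rewrite /pr /= wE.
Qed.

Lemma pr_cond m A : borel A -> 0 < pr m A ->
  exists m', forall B, borel B -> pr m' B = pr m (B `&` A) / pr m A.
Proof.
move=> bA A0; apply: (@Delta_make (fun B => pr m (B `&` A) / pr m A)).
- by move=> B bB; rewrite divr_ge0// pr_ge0.
- by rewrite setTI divff// gt_eqF.
- move=> F bF tF.
  have -> : (fun n => \sum_(0 <= i < n) (pr m (F i `&` A) / pr m A)) =
      (fun n => (\sum_(0 <= i < n) pr m (F i `&` A)) / pr m A).
    by apply/funext => n; rewrite mulr_suml.
  apply: cvgMl; rewrite setI_bigcupl.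
  apply: (@pr_bigcup_series _ _ m (fun n => F n `&` A)).
    by move=> n; exact: borelI.
  apply/trivIsetP => i j _ _ ij; rewrite setIACA setIid.
  by move/trivIsetP : tF => -> //; rewrite set0I.
Qed.

End pr2.

Lemma pr_push (R : realType) (S T : topologicalType) (f : S -> T) (cf : continuous f) (m : Delta R S)
    (A : set T) : borel A -> pr (push cf m) A = pr m (f @^-1` A).
Proof. by move=> bA; rewrite /pr /= /push_val asboolT. Qed.

Section push_lemmas.
Context (R : realType) (S T U : topologicalType).

Lemma push_comp (f : S -> T) (g : T -> U) (h : S -> U) (cf : continuous f)
    (cg : continuous g) (ch : continuous h) (m : Delta R S) :
  (forall x, g (f x) = h x) -> push cg (push cf m) = push ch m.
Proof.
move=> e; apply: Delta_eq => A bA; rewrite !pr_push//; last exact: borel_preimage.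
by congr pr; apply/seteqP; split=> x /=; rewrite e.
Qed.

Lemma prob1_preimage (f : S -> T) (cf : continuous f) (m : Delta R S) A :
  prob1 (push cf m) A -> prob1 m (f @^-1` A).
Proof.
move=> /prob1P[B [bB BA B1]]; apply/prob1P; exists (f @^-1` B); split.
- exact: borel_preimage.
- by move=> x; exact: BA.
- by rewrite -B1 pr_push.
Qed.

End push_lemmas.

(** * Cylinders, the Lindelof property and regularity of measures *)

Definition N (u : seq nat) : set Baire := [set y | mkseq y (size u) = u].

Lemma NP (u : seq nat) (y : Baire) : N u y <-> forall i, (i < size u)%N -> y i = nth 0%N u i.
Proof.
split=> [yu i iu|h]; first by rewrite -[in RHS]yu nth_mkseq.
apply: (@eq_from_nth _ 0%N); rewrite size_mkseq// => i iu.
by rewrite nth_mkseq// h.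
Qed.

Lemma N_mkseq (x : nat -> nat) k : N (mkseq x k) = cyl x k.
Proof.
apply/seteqP; split=> y.
  by move=> /NP; rewrite size_mkseq => h i ik; rewrite h// nth_mkseq.
by move=> h; apply/NP; rewrite size_mkseq => i ik; rewrite h// nth_mkseq.
Qed.

Lemma N_nth (u : seq nat) : N u = cyl (nth 0%N u) (size u).
Proof. by rewrite -N_mkseq mkseq_nth. Qed.

Lemma clopen_N u : clopen (N u). Proof. by rewrite N_nth; exact: clopen_cyl. Qed.

Lemma open_N u : open (N u). Proof. by case: (clopen_N u). Qed.

Lemma borel_N u : borel (N u). Proof. exact: borel_open (open_N u). Qed.

Lemma N_nil : N [::] = setT.
Proof. by apply/seteqP; split. Qed.

Lemma N_rcons u n : N (rcons u n) = N u `&` [set y : Baire | y (size u) = n].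
Proof.
apply/seteqP; split=> y.
  rewrite /N /= size_rcons mkseqS => /eqP; rewrite eqseq_rcons => /andP[/eqP -> /eqP ->].
  by [].
by rewrite /N /= size_rcons mkseqS => -[-> ->].
Qed.

(* An enumeration of all finite sequences, with repetitions of [::]. *)
Definition enumseq (n : nat) : seq nat := odflt [::] (unpickle n).

Lemma enumseqK u : enumseq (pickle u) = u.
Proof. by rewrite /enumseq pickleK. Qed.

Lemma open_Baire_bigcup (U : set Baire) : open U ->
  U = \bigcup_(n in [set n | N (enumseq n) `<=` U]) N (enumseq n).
Proof.
move=> oU; apply/seteqP; split=> y; last by case=> n nU /nU.
move=> Uy; have /nbhs_BaireP[k kU] : nbhs y U by exact: open_nbhs_nbhs.
by exists (pickle (mkseq y k)); rewrite /= enumseqK N_mkseq.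
Qed.

Section lindelof.
Context (R : realType).

(** By continuity each point [s] of [U] lies in the image of some cylinder contained in [V s]. There
    are countably many cylinders, and one centre is kept for each. *)
Lemma suslin_lindelof (S : topologicalType) (U : set S) (V : S -> set S) :
  suslin [set: S] -> (forall x, U x -> nbhs x (V x)) -> U !=set0 ->
  exists x : nat -> S, (forall n, U (x n)) /\ U `<=` \bigcup_n V (x n).
Proof.
move=> [f cf fT] UV [x0 Ux0].
have /choice[x hx] : forall n, exists x, U x /\
    ((exists2 x', U x' & f @` N (enumseq n) `<=` V x') -> f @` N (enumseq n) `<=` V x).
  move=> n; have [[x' Ux' h]|nh] := pselect (exists2 x', U x' & f @` N (enumseq n) `<=` V x').
    by exists x'.
  by exists x0; split=> // /nh.
exists x; split=> [n|s Us]; first by case: (hx n).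
have [y _ ys] : range f s by rewrite fT.
have /nbhs_BaireP[k kV] : nbhs y (f @^-1` V s) by apply: cf; rewrite ys; exact: UV.
exists (pickle (mkseq y k)) => //.
have [_ /(_ _)] := hx (pickle (mkseq y k)); rewrite enumseqK N_mkseq; apply.
  by exists s => // _ [z zk <-]; exact: kV.
by exists y.
Qed.

(** The Lindelof property reduces [U] to countably many bumps. Each one is divided by half its peak
    and cut at 1, so that it equals 1 where the bump exceeds half the peak; [g n] is the maximum of
    the first ones. *)
Lemma nice_urysohn (S : topologicalType) (U : set S) : nice R S -> open U ->
  exists g : nat -> S -> R, [/\ forall n, continuous (g n), forall n x, 0 <= g n x <= 1,
    forall n x, g n x <= g n.+1 x, forall n x, 0 < g n x -> U x &
    forall x, U x -> exists n, g n x = 1].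
Proof.
move=> [cS _ sS] oU.
have [U0|/set0P nU0] := eqVneq U set0.
  exists (fun _ _ => 0); split=> //.
  - by move=> n; exact: cst_continuous.
  - by move=> _ _; rewrite lexx ler01.
  - by move=> n x; rewrite ltxx.
  - by move=> x; rewrite U0.
have nU x : U x -> nbhs x U by move=> Ux; exact: open_nbhs_nbhs.
have /choice[f hf] : forall x, exists f : S -> R, U x -> [/\ continuous f,
   forall y, 0 <= f y <= 1, 0 < f x & forall y, 0 < f y -> U y].
  move=> x; have [Ux|nUx] := pselect (U x); last by exists (fun=> 0) => /nUx.
  by have [f ?] := cS _ _ (nU _ Ux); exists f.
have [|x [Ux Ucov]] := @suslin_lindelof S U (fun x => [set y | f x x / 2 < f x y]) sS _ nU0.
  move=> x Ux; have [cf f01 fx fU] := hf x Ux.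
  by apply: (cf x [set r | f x x / 2 < r]); apply: open_nbhs_nbhs; split;
    [exact: open_gt|rewrite /=; lra].
pose h n y := Num.min 1 (f (x n) y / (f (x n) (x n) / 2)).
have ch n : continuous (h n).
  have [cf f01 fx fU] := hf _ (Ux n).
  move=> y.
  apply: (@continuous_min R S (fun=> 1) (fun y => f (x n) y / (f (x n) (x n) / 2)) y).
    exact: cst_continuous.
  apply: (@continuousM R S (f (x n)) (fun=> (f (x n) (x n) / 2)^-1) y); first exact: cf.
  exact: cst_continuous.
have h01 n y : 0 <= h n y <= 1.
  have [cf f01 fx fU] := hf _ (Ux n).
  rewrite /h le_min ler01/= ge_min lexx/= andbT divr_ge0//; first by case/andP: (f01 y).
  by rewrite divr_ge0// ltW.
have hU n y : 0 < h n y -> U y.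
  have [cf f01 fx fU] := hf _ (Ux n).
  rewrite /h lt_min ltr01/= => h0; apply: fU.
  by move: h0; rewrite pmulr_lgt0// invr_gt0 divr_gt0.
have h1 y : U y -> exists n, h n y = 1.
  move=> /Ucov[n _ /= ltn]; exists n; apply/eqP; rewrite /h minElt.
  have [cf f01 fx fU] := hf _ (Ux n).
  by rewrite ltr_pdivlMr ?divr_gt0// mul1r ltn.
pose g := fix g n y := if n is k.+1 then Num.max (g k y) (h k.+1 y) else h 0%N y.
have gE n y : g n y = if n is k.+1 then Num.max (g k y) (h k.+1 y) else h 0%N y by case: n.
exists g; split.
- elim=> [|n IH]; first exact: ch.
  by move=> y; apply: (@continuous_max R S (g n) (h n.+1) y); [exact: IH|exact: ch].
- elim=> [|n IH] y; first exact: h01.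
  rewrite gE; have /andP[a b] := IH y; have /andP[c d] := h01 n.+1 y.
  by rewrite le_max a/= ge_max b d.
- by move=> n y; rewrite [leRHS]gE le_max lexx.
- elim=> [|n IH] y; first exact: hU.
  by rewrite gE lt_max => /orP[/IH|/hU].
- move=> y /h1[n hn]; exists n; apply/eqP; rewrite eq_le.
  have g1 : forall n y, g n y <= 1.
    elim=> [|k IH] z; first by case/andP: (h01 0%N z).
    by rewrite gE ge_max IH; case/andP: (h01 k.+1 z).
  rewrite g1/= -hn; case: (n) => [|k]; first by [].
  by rewrite gE le_max lexx orbT.
Qed.

Lemma nice_Fsigma (S : topologicalType) (U : set S) : nice R S -> open U ->
  exists C : nat -> set S, [/\ forall n, closed (C n), forall n, C n `<=` C n.+1 &
    U = \bigcup_n C n].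
Proof.
move=> nS oU; have [g [cg g01 gS gU g1]] := nice_urysohn nS oU.
exists (fun n => [set x | 1 <= g n x]); split.
- move=> n; apply: (@closed_comp _ _ (g n) [set r | 1 <= r]); first by move=> x _; exact: cg.
  exact: closed_ge.
- by move=> n x /= h; exact: le_trans (gS n x).
- apply/seteqP; split=> x; first by move=> /g1[n gn]; exists n => //=; rewrite gn.
  by case=> n _ /= h; apply: (gU n); exact: lt_le_trans ltr01 h.
Qed.

Lemma nice_hausdorff (S : topologicalType) : nice R S -> hausdorff_space S.
Proof. by case=> cS tS _; exact: creg_hausdorff cS tS. Qed.

Lemma sum_half_le (e : R) n : 0 <= e -> \sum_(0 <= i < n) (e / 2 ^+ i.+1) <= e.
Proof.
move=> e0; suff -> : \sum_(0 <= i < n) (e / 2 ^+ i.+1) = e - e / 2 ^+ n.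
  by rewrite gerBl divr_ge0// exprn_ge0.
elim: n => [|n IH]; first by rewrite big_nil expr0 divr1 subrr.
rewrite big_nat_recr//= IH exprS.
have : (2 ^+ n : R) != 0 by rewrite expf_neq0.
by move=> h; field.
Qed.

(** The sets that can be approximated for every [e] form a sigma-algebra, and open sets belong to it
    because they are increasing unions of closed sets. *)
Lemma regular (S : topologicalType) (m : Delta R S) (A : set S) (e : R) :
  nice R S -> borel A -> 0 < e ->
  exists C O, [/\ closed C, open O, C `<=` A, A `<=` O & pr m (O `\` C) < e].
Proof.
move=> nS bA e0.
pose good (A : set S) := forall e : R, 0 < e ->
  exists C O, [/\ closed C, open O, C `<=` A, A `<=` O & pr m (O `\` C) < e].
suff sg : sigma_algebra setT good.
  have : good A; last exact.
  apply: (smallest_sub sg _ bA) => U oU d d0.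
  have [C [cC CinS UE]] := nice_Fsigma nS oU.
  have : pr m \o (fun n => U `\` C n) @ \oo --> pr m (\bigcap_n (U `\` C n)).
    apply: pr_cvg_down; first by move=> n; apply: borelD; [exact: borel_open|exact: borel_closed].
    by move=> n x [Ux nC]; split=> // /CinS.
  have -> : \bigcap_n (U `\` C n) = set0.
    apply/seteqP; split=> // x h; have [Ux _] := h 0%N I.
    by move: Ux; rewrite UE => -[n _ Cx]; have [_] := h n I.
  rewrite pr0 => cv; have [n _ hn] := @cvgr_lt _ _ _ _ _ _ cv _ d0.
  have /= lt := hn n (leqnn n).
  by exists (C n), U; split=> //; rewrite UE => x Cx; exists n.
split.
- move=> d d0; exists set0, set0; split=> //; [exact: closed0|exact: open0|].
  by rewrite set0D pr0.
- move=> B gB; rewrite setTD => d d0; have [C [W [cC oW CB BW lt]]] := gB d d0.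
  exists (~` W), (~` C); split; [exact: open_closedC|exact: closed_openC| | |].
  + exact: subsetC.
  + exact: subsetC.
  + by rewrite (_ : _ `\` _ = W `\` C)// setDE setCK setIC -setDE.
- move=> F gF d d0.
  have /choice[CO hCO] : forall n, exists CO : set S * set S, [/\ closed CO.1, open CO.2,
      CO.1 `<=` F n, F n `<=` CO.2 & pr m (CO.2 `\` CO.1) < d / 2 / 2 ^+ n.+1].
    move=> n; have [|C [W h]] := gF n (d / 2 / 2 ^+ n.+1); last by exists (C, W).
    by rewrite !divr_gt0// exprn_gt0.
  pose C n := \bigcup_(i in [set i | (i < n)%N]) (CO i).1.
  pose O := \bigcup_i (CO i).2.
  pose CC := \bigcup_i (CO i).1.
  have bC1 i : borel (CO i).1 by apply: borel_closed; case: (hCO i).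
  have bC2 i : borel (CO i).2 by apply: borel_open; case: (hCO i).
  have bO : borel O by exact: borel_bigcup.
  have bCC : borel CC by exact: borel_bigcup.
  have cC n : closed (C n).
    elim: n => [|n IH].
      by rewrite (_ : C 0%N = set0); [exact: closed0|apply/seteqP; split=> x // -[]].
    rewrite (_ : C n.+1 = C n `|` (CO n).1); first by apply: closedU => //; case: (hCO n).
    apply/seteqP; split=> x.
      case=> i; rewrite /= ltnS leq_eqVlt => /orP[/eqP ->|ik] Fx; first by right.
      by left; exists i.
    by case=> [[i ik Fx]|Fx]; [exists i => //=; exact: ltnW|exists n => /=].
  have bC n : borel (C n) by exact: borel_closed.
  have le1 : pr m (O `\` CC) <= d / 2.
    apply: (@le_trans _ _ (pr m (\bigcup_i ((CO i).2 `\` (CO i).1)))).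
      apply: pr_le; first exact: borelD.
        by apply: borel_bigcup => i; exact: borelD.
      by move=> x [[i _ Ox] nC]; exists i => //; split=> // Cx; apply: nC; exists i.
    apply: pr_bigcup_le => [i|n]; first exact: borelD.
    apply: (le_trans _ (@sum_half_le (d / 2) n _)); last by rewrite divr_ge0// ltW.
    by apply: ler_sum => i _; apply: ltW; case: (hCO i).
  have : pr m \o (fun n => O `\` C n) @ \oo --> pr m (\bigcap_n (O `\` C n)).
    apply: pr_cvg_down; first by move=> n; exact: borelD.
    move=> n x [Ux nC]; split=> // -[i ik Cx]; apply: nC; exists i => //=.
    exact: leq_trans ik (leqnSn n).
  have -> : \bigcap_n (O `\` C n) = O `\` CC.
    apply/seteqP; split=> x.
      move=> h; split; first by have [] := h 0%N I.
      by move=> [i _ Cx]; have [_] := h i.+1 I; apply; exists i => /=.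
    by move=> [Ox nC] n _; split=> // -[i _ Cx]; apply: nC; exists i.
  have lt : pr m (O `\` CC) < d by lra.
  move=> cv; have [n _ hn] := @cvgr_lt _ _ _ _ _ _ cv _ lt; have /= ltn := hn n (leqnn n).
  exists (C n), O; split=> //.
  + by apply: bigcup_open => i _; case: (hCO i).
  + by move=> x [i _ Cx]; exists i => //; case: (hCO i) => _ _ /(_ x Cx).
  + by move=> x [i _ Fx]; exists i => //; case: (hCO i) => _ _ _ /(_ x Fx).
Qed.

End lindelof.

(** * Tightness and images of sets of measure one *)

Section tight.
Context (R : realType).

Lemma compact_bounded_Baire (b : nat -> nat) : compact [set y : Baire | forall i, (y i <= b i)%N].
Proof.
apply: (@tychonoff nat (fun _ => nat) (fun i => [set k | (k <= b i)%N])) => i.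
by apply: finite_compact; apply: (sub_finite_set _ (finite_II (b i).+1)) => k /=.
Qed.

Lemma tight_Baire (m : Delta R Baire) (e : R) : 0 < e ->
  exists b : nat -> nat, 1 - e <= pr m [set y : Baire | forall i, (y i <= b i)%N].
Proof.
move=> e0.
pose G i n := [set y : Baire | (n < y i)%N].
have clG i n : clopen (G i n).
  by apply: (@clopen_prefix _ i.+1) => x y xy /=; rewrite /G /= => h; rewrite xy.
have bG i n : borel (G i n) by apply: borel_open; case: (clG i n).
have /choice[b hb] : forall i, exists n, pr m (G i n) < e / 2 ^+ i.+1.
  move=> i; have : pr m \o G i @ \oo --> pr m (\bigcap_n G i n).
    by apply: pr_cvg_down => // n y; rewrite /G /=; exact: ltnW.
  have -> : \bigcap_n G i n = set0.
    by apply/seteqP; split=> // y /(_ (y i) I); rewrite /G /= ltnn.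
  rewrite pr0 => cv; have [|n _ hn] := @cvgr_lt _ _ _ _ _ _ cv (e / 2 ^+ i.+1).
    by rewrite divr_gt0// exprn_gt0.
  by exists n; exact: (hn n (leqnn n)).
exists b; have -> : [set y : Baire | forall i, (y i <= b i)%N] = ~` \bigcup_i G i (b i).
  apply/seteqP; split=> y /=; first by move=> h [i _]; rewrite /G /= ltnNge h.
  by move=> h i; rewrite leqNgt; apply/negP => ?; apply: h; exists i.
rewrite prC; last exact: borel_bigcup.
rewrite lerD2l lerN2; apply: pr_bigcup_le => // n.
apply: (le_trans _ (@sum_half_le R e n (ltW e0))).
by apply: ler_sum => i _; exact: ltW.
Qed.

Lemma prob1_compact (m : Delta R Baire) (A : set Baire) (e : R) : prob1 m A -> 0 < e ->
  exists K, [/\ compact K, K `<=` A & 1 - e <= pr m K].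
Proof.
move=> /prob1P[B [bB BA B1]] e0.
have [C [W [cC oW CB BW lt]]] := @regular R _ m B (e / 2) (nice_Baire R) bB ltac:(lra).
have [b hb] := @tight_Baire m (e / 2) ltac:(lra).
set D := [set y : Baire | _] in hb.
have cD : compact D by exact: compact_bounded_Baire.
have clD : closed D by apply: compact_closed => //; exact: nice_hausdorff (nice_Baire R).
exists (C `&` D); split.
- by rewrite setIC; apply: compact_closedI.
- by move=> x [/CB /BA].
have bC := borel_closed cC; have bD := borel_closed clD.
have C1 : 1 - e / 2 <= pr m C.
  have := @prD _ _ m W C (borel_open oW) bC (subset_trans CB BW).
  have := @pr_le _ _ m B W bB (borel_open oW) BW; rewrite B1; lra.
have := @prU_le _ _ m (~` C) (~` D) (borelC bC) (borelC bD).
rewrite -setCI !prC//; last exact: borelI.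
lra.
Qed.

(** [C] is arbitrary. Compact subsets of its preimage exhaust the measure, and their images are
    compact, hence closed: their union is a Borel subset of [C] of measure one. *)
Lemma prob1_push (S : topologicalType) (f : Baire -> S) (cf : continuous f)
    (m : Delta R Baire) (C : set S) : hausdorff_space S ->
  prob1 m (f @^-1` C) -> prob1 (push cf m) C.
Proof.
move=> hS h.
have /choice[K hK] : forall n : nat, exists K, [/\ compact K, K `<=` f @^-1` C & 1 - n.+1%:R^-1 <= pr m K].
  by move=> n; apply: prob1_compact => //; rewrite invr_gt0 ltr0n.
have clK n : closed (f @` K n).
  apply: compact_closed => //; apply: continuous_compact; last by case: (hK n).
  exact: continuous_subspaceT.
have bK n : borel (f @` K n) by exact: borel_closed.
have bKB n : borel (K n).
  by apply: borel_closed; apply: compact_closed; [exact: nice_hausdorff (nice_Baire R)|case: (hK n)].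
apply/prob1P; exists (\bigcup_n (f @` K n)); split; first exact: borel_bigcup.
  by move=> _ [n _ [y Ky <-]]; case: (hK n) => _ /(_ y Ky).
apply/eqP; rewrite eq_le pr_le1/=; last exact: borel_bigcup.
rewrite leNgt; apply/negP => lt1.
rewrite -subr_gt0 in lt1.
have [n _ hn] := near_infty_natSinv_lt (PosNum lt1).
have := hn n (leqnn n); rewrite /= ltrBrDr -ltrBrDl.
rewrite ltNge => /negP; apply; case: (hK n) => _ _ /le_trans; apply.
rewrite pr_push; last exact: borel_bigcup.
apply: pr_le => //; first by apply: borel_preimage => //; exact: borel_bigcup.
by move=> y Ky; exists n => //; exists y.
Qed.

End tight.

(** * Expectations, the portmanteau theorem and the weak topology *)

Section expect_lemmas.
Context (R : realType) (T : topologicalType) (m : Delta R T).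
Implicit Types f g : T -> R.

Local Notation B0 := (borel_at (projT1 (cid (Delta_inhabited m)))).
Local Notation P := (prob_at m (x := projT1 (cid (Delta_inhabited m)))).

Definition bmeas f := measurable_fun setT (f : B0 -> R) /\ exists M, forall x, `|f x| <= M.

Lemma bmeas_continuous f : continuous f -> (exists M, forall x, `|f x| <= M) -> bmeas f.
Proof.
move=> cf bf; split=> //.
apply: (measurability _ (RGenOInfty.measurableE R)) => _ [_ [r ->] <-].
rewrite setTI; have -> : f @^-1` `]r, +oo[%classic = [set x | r < f x].
  by apply/seteqP; split=> x /=; rewrite in_itv /= andbT.
apply: (@borel_open T).
by apply: (@open_comp _ _ f [set y | r < y]) => [x _|]; [exact: cf|exact: open_gt].
Qed.

Lemma bmeas_indic (A : set T) : borel A -> bmeas (fun x => (x \in A)%:R).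
Proof.
move=> bA; split; last by exists 1 => x; case: (_ \in _); rewrite ?normr1 ?normr0.
exact: (@measurable_indic _ B0 R setT A bA).
Qed.

Lemma bmeasD f g : bmeas f -> bmeas g -> bmeas (fun x => f x + g x).
Proof.
move=> [mf [M fM]] [mg [M' gM]]; split; first exact: (@measurable_funD _ B0 R setT f g).
by exists (M + M') => x; apply: (le_trans (ler_normD _ _)); rewrite lerD.
Qed.

Lemma bmeasZ r f : bmeas f -> bmeas (fun x => r * f x).
Proof.
move=> [mf [M fM]]; split.
  by apply: (@measurable_funM _ B0 R setT (fun=> r) f) => //; exact: measurable_cst.
by exists (`|r| * M) => x; rewrite normrM ler_wpM2l.
Qed.

Lemma bmeas_integrable f : bmeas f -> P.-integrable setT (EFin \o f).
Proof.
move=> [bf [M fM]]; apply: measurable_bounded_integrable => //.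
- by rewrite /= /prob_at Dval_setT ltry.
- exists M; split; first exact: num_real.
  by move=> y My x _ /=; apply: le_trans (fM x) (ltW My).
Qed.

Lemma expect_le f g : bmeas f -> bmeas g -> (forall x, f x <= g x) -> expect m f <= expect m g.
Proof.
by move=> bf bg fg; apply: le_Rintegral => //; exact: bmeas_integrable.
Qed.

Lemma expect_indic (A : set T) : borel A -> expect m (fun x => (x \in A)%:R) = pr m A.
Proof.
move=> bA; rewrite /expect /Rintegral /=; congr fine.
have := @integral_indic _ _ _ P setT measurableT A bA.
by rewrite setIT.
Qed.

Lemma expectD f g : bmeas f -> bmeas g ->
  expect m (fun x => f x + g x) = expect m f + expect m g.
Proof. by move=> bf bg; apply: RintegralD => //; exact: bmeas_integrable. Qed.

Lemma expectZ r f : bmeas f -> expect m (fun x => r * f x) = r * expect m f.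
Proof. by move=> bf; apply: RintegralZl => //; exact: bmeas_integrable. Qed.

Lemma expect_cst r : expect m (fun=> r) = r.
Proof. by rewrite /expect Rintegral_cst//= /prob_at Dval_setT mulr1. Qed.

End expect_lemmas.

Section portmanteau.
Context (R : realType).

Lemma expect_continuous (S : topologicalType) (g : S -> R) : continuous g ->
  (exists M, forall x, `|g x| <= M) -> continuous (fun m : Delta R S => expect m g).
Proof.
move=> cg bg; pose G : Cb R S := exist _ g (conj cg bg).
have ce : continuous (@expects R S) by exact: initial_continuous.
exact: (comp_continuous ce (@coord_continuous _ (fun _ : Cb R S => (R : topologicalType)) G)).
Qed.

Lemma Delta_continuousP (Y S : topologicalType) (F : Y -> Delta R S) :
  (forall g : S -> R, continuous g -> (exists M, forall x, `|g x| <= M) ->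
     continuous (fun y => expect (F y) g)) -> continuous F.
Proof.
move=> h; apply/continuousP => A [B oB <-].
have cF : continuous (fun y => @expects R S (F y)).
  by apply: prod_continuous => -[g [cg bg]]; exact: h.
by move/continuousP : cF => /(_ B oB).
Qed.

(* The layer-cake approximation of [g : T -> [0, 1]] with [K] layers. *)
Definition layers (S : topologicalType) (g : S -> R) (K n : nat) (x : S) : R :=
  \sum_(0 <= i < n) K%:R^-1 * (x \in [set x | i.+1%:R / K%:R < g x])%:R.

Lemma layersS (S : topologicalType) (g : S -> R) K n x :
  layers g K n.+1 x = layers g K n x +
    K%:R^-1 * (x \in [set x | n.+1%:R / K%:R < g x])%:R.
Proof. by rewrite /layers big_nat_recr. Qed.

Lemma layers_approx (S : topologicalType) (g : S -> R) K x : (0 < K)%N ->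
  0 <= g x <= 1 -> layers g K K x <= g x <= layers g K K x + K%:R^-1.
Proof.
move=> K0 /andP[g0 g1].
have K0' : 0 < K%:R :> R by rewrite ltr0n.
have Ki0 : 0 < K%:R^-1 :> R by rewrite invr_gt0.
(* Either all [n] layers seen so far lie below [g x] and the sum is exactly [n / K], or the level of
   [g x] has been passed and later layers add nothing. *)
suff H n : (n%:R / K%:R < g x /\ layers g K n x = n%:R / K%:R) \/
    (g x <= n%:R / K%:R /\ layers g K n x <= g x <= layers g K n x + K%:R^-1).
  case: (H K) => [[]|[_ //]]; rewrite divff ?gt_eqF// => h; exfalso; lra.
elim: n => [|n IH].
  rewrite mul0r /layers big_nil; case: (ltP 0 (g x)) => h; [by left|right].
  by split => //; apply/andP; split; lra.
have nE : n.+1%:R / K%:R = n%:R / K%:R + K%:R^-1 :> R by rewrite -natr1 mulrDl mul1r.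
rewrite layersS; case: (boolP (x \in _)) => [/set_mem /= h|/negP h].
  rewrite mulr1; left; split=> //; case: IH => [[_ ->]|[h2 _]]; first by rewrite nE.
  by exfalso; rewrite nE in h; lra.
have {}h : g x <= n.+1%:R / K%:R.
  by rewrite leNgt; apply/negP => h'; apply: h; rewrite mem_set.
rewrite mulr0 addr0; right; split=> //.
case: IH => [[h1 ->]|[_ //]].
by rewrite -nE h ltW.
Qed.

Lemma expect_layers (S : topologicalType) (g : S -> R) K n m : continuous g ->
  bmeas m (layers g K n) /\ expect m (layers g K n) =
    \sum_(0 <= i < n) K%:R^-1 * pr m [set x | i.+1%:R / K%:R < g x].
Proof.
move=> cg.
have bU i : borel [set x | i.+1%:R / K%:R < g x].
  apply: borel_open; apply: (@open_comp _ _ g [set y | i.+1%:R / K%:R < y]).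
    by move=> x _; exact: cg.
  exact: open_gt.
elim: n => [|n [IHb IH]].
  have -> : layers g K 0 = fun=> 0 by apply/funext => x; rewrite /layers big_nil.
  rewrite big_nil expect_cst; split=> //; apply: bmeas_continuous; first exact: cst_continuous.
  by exists 0 => x; rewrite normr0.
have -> : layers g K n.+1 = fun x => layers g K n x +
    K%:R^-1 * (x \in [set x | n.+1%:R / K%:R < g x])%:R.
  by apply/funext => x; rewrite layersS.
have bi := bmeas_indic m (bU n).
split; first by apply: bmeasD => //; exact: bmeasZ.
by rewrite big_nat_recr//= expectD ?expectZ ?expect_indic ?IH//; exact: bmeasZ.
Qed.

(** A layer sum is a nonnegative combination of measures of open sets, hence lower semicontinuous.
    Half of [e] pays for this and half for the layer approximation. *)
Lemma expect_lsc (Y S : topologicalType) (F : Y -> Delta R S) (g : S -> R) y e :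
  (forall U, open U -> forall y r, r < pr (F y) U -> \forall z \near y, r < pr (F z) U) ->
  continuous g -> (forall x, 0 <= g x <= 1) -> 0 < e ->
  \forall z \near y, expect (F y) g - e <= expect (F z) g.
Proof.
move=> h cg g01 e0.
have bg m : bmeas m g.
  apply: bmeas_continuous => //; exists 1 => x; case/andP: (g01 x) => g0 g1.
  by rewrite ger0_norm.
have e20 : 0 < e / 2 by lra.
have [k _ hk] := near_infty_natSinv_lt (PosNum e20).
have /= ltk := hk k (leqnn k).
set K := k.+1 in ltk; have K0 : (0 < K)%N by [].
have H n (d : R) : 0 < d ->
    \forall z \near y, expect (F y) (layers g K n) - d <= expect (F z) (layers g K n).
  elim: n d => [|n IH] d d0.
    apply: nearW => z.
    by rewrite !(@expect_layers _ g K 0 _ cg).2 !big_nil sub0r oppr_le0 ltW.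
  have d20 : 0 < d / 2 by lra.
  have := IH _ d20.
  have oU : open [set x | n.+1%:R / K%:R < g x].
    apply: (@open_comp _ _ g [set r | n.+1%:R / K%:R < r]); last exact: open_gt.
    by move=> x _; exact: cg.
  have := h _ oU y (pr (F y) [set x | n.+1%:R / K%:R < g x] - d / 2) ltac:(lra).
  apply: filterS2 => z.
  rewrite !(expect_layers K n.+1 _ cg).2 !(expect_layers K n _ cg).2 !big_nat_recr//=.
  set p := pr (F y) _; set q := pr (F z) _ => pq IHz.
  have : K%:R^-1 * (p - d / 2) <= K%:R^-1 * q by rewrite ler_wpM2l ?invr_ge0// ltW.
  have : K%:R^-1 * (d / 2) <= d / 2.
    by rewrite ler_piMl ?(ltW d20)// invf_le1 ?ltr0n// ler1n.
  by rewrite mulrBr; lra.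
have := H K _ e20; apply: filterS => z hz.
have lay x := layers_approx K0 (g01 x).
have [bL _] := expect_layers K K (F z) cg; have [bL' _] := expect_layers K K (F y) cg.
have h1 : expect (F z) (layers g K K) <= expect (F z) g.
  by apply: expect_le => // x; case/andP: (lay x).
have h2 : expect (F y) g <= expect (F y) (layers g K K) + K%:R^-1.
  have bc : bmeas (F y) (fun=> K%:R^-1).
    by apply: bmeas_continuous; [exact: cst_continuous|exists `|K%:R^-1| => x].
  rewrite -[X in _ + X](expect_cst (F y)) -expectD//.
  by apply: expect_le => //; [exact: bmeasD|move=> x; case/andP: (lay x)].
lra.
Qed.

(** Lower semicontinuity is applied to the rescalings [u] of [g] and [v] of [- g] into the unit
    interval; together they bound the integral of [g] on both sides. *)
Lemma Delta_continuous_lsc (Y S : topologicalType) (F : Y -> Delta R S) :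
  (forall U, open U -> forall y r, r < pr (F y) U -> \forall z \near y, r < pr (F z) U) ->
  continuous F.
Proof.
move=> h; apply: Delta_continuousP => g cg [M gM] y.
pose M1 := `|M| + 1; have M0 : 0 < M1 by rewrite /M1; have := normr_ge0 M; lra.
have gM1 x : - M1 <= g x <= M1.
  by rewrite -ler_norml; apply: (le_trans (gM x)); rewrite /M1; have := ler_norm M; lra.
pose u x := (2 * M1)^-1 * (g x + M1); pose v x := (2 * M1)^-1 * (M1 - g x).
have cu : continuous u.
  move=> x; apply: (@continuousM R S (fun=> (2 * M1)^-1) (fun x => g x + M1) x).
    exact: cst_continuous.
  by apply: (@continuousD _ _ _ g (fun=> M1) x); [exact: cg|exact: cst_continuous].
have cv : continuous v.
  move=> x; apply: (@continuousM R S (fun=> (2 * M1)^-1) (fun x => M1 - g x) x).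
    exact: cst_continuous.
  by apply: (@continuousB _ _ _ (fun=> M1) g x); [exact: cst_continuous|exact: cg].
have u01 x : 0 <= u x <= 1.
  have /andP[a b] := gM1 x; rewrite /u mulr_ge0 ?invr_ge0/=; [|lra|lra].
  by rewrite ler_pdivrMl ?mulr1; lra.
have v01 x : 0 <= v x <= 1.
  have /andP[a b] := gM1 x; rewrite /v mulr_ge0 ?invr_ge0/=; [|lra|lra].
  by rewrite ler_pdivrMl ?mulr1; lra.
have bg m : bmeas m g by apply: bmeas_continuous => //; exists M.
have bc m r : bmeas m (fun=> r).
  by apply: bmeas_continuous; [exact: cst_continuous|exists `|r| => x].
have uE m : expect m u = (2 * M1)^-1 * (expect m g + M1).
  by rewrite /u expectZ ?expectD ?expect_cst//; exact: bmeasD.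
have vE m : expect m v = (2 * M1)^-1 * (M1 - expect m g).
  have -> : v = fun x => (2 * M1)^-1 * (M1 + (-1) * g x).
    by apply/funext => x; rewrite /v mulN1r.
  have bgN : bmeas m (fun x => (-1) * g x) by exact: bmeasZ.
  rewrite expectZ ?expectD ?expect_cst ?expectZ ?mulN1r//; exact: bmeasD.
apply/cvgrPdist_le => e e0.
have d0 : 0 < (2 * M1)^-1 * e by rewrite mulr_gt0// invr_gt0; lra.
have := expect_lsc y h cu u01 d0; have := expect_lsc y h cv v01 d0.
apply: filterS2 => z; rewrite !uE !vE -!mulrBr !ler_pM2l ?invr_gt0; [|lra|lra].
by rewrite ler_norml => a b; apply/andP; split; lra.
Qed.

(** Some [g n] between the indicators of a closed subset and of [U] already has expectation above
    [r], and its expectation is continuous in the measure. *)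
Lemma near_pr_open (S : topologicalType) (U : set S) (m : Delta R S) r : nice R S ->
  open U -> r < pr m U -> \forall m' \near m, r < pr m' U.
Proof.
move=> nS oU rU; have [g [cg g01 gS gU g1]] := nice_urysohn nS oU.
have bg n m' : bmeas m' (g n).
  by apply: bmeas_continuous => //; exists 1 => x; case/andP: (g01 n x) => a b; rewrite ger0_norm.
have cC n : closed [set x | 1 <= g n x].
  apply: (@closed_comp _ _ (g n) [set r | 1 <= r]); first by move=> x _; exact: cg.
  exact: closed_ge.
have bC n : borel [set x | 1 <= g n x] by exact: borel_closed.
have [n ltn] : exists n, r < expect m (g n).
  have : pr m \o (fun n => [set x | 1 <= g n x]) @ \oo --> pr m (\bigcup_n [set x | 1 <= g n x]).
    by apply: pr_cvg_up => // n x /= h; exact: le_trans (gS n x).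
  have -> : \bigcup_n [set x | 1 <= g n x] = U.
    apply/seteqP; split=> x; last by move=> /g1[n gn]; exists n => //=; rewrite gn.
    by case=> n _ /= h; apply: (gU n); exact: lt_le_trans ltr01 h.
  move=> cv; have [n _ hn] := @cvgr_gt _ _ _ _ _ _ cv _ rU.
  exists n; apply: (lt_le_trans (hn n (leqnn n))).
  rewrite /= -expect_indic//; apply: expect_le => //; first exact: bmeas_indic.
  move=> x; case: (boolP (x \in _)) => [/set_mem //|_].
  by case/andP: (g01 n x).
have ce : continuous (fun m : Delta R S => expect m (g n)).
  apply: expect_continuous => //.
  by exists 1 => x; case/andP: (g01 n x) => a b; rewrite ger0_norm.
have o : nbhs (expect m (g n)) [set s | r < s] by apply: open_nbhs_nbhs; split=> //; exact: open_gt.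
have {}o : nbhs m [set m' | r < expect m' (g n)] by exact: (ce m _ o).
apply: filterS o => m' /= /lt_le_trans; apply.
rewrite -expect_indic; last exact: borel_open.
apply: expect_le => //; first by apply: bmeas_indic; exact: borel_open.
move=> x; case: (boolP (x \in U)) => [_|/negP nU]; first by case/andP: (g01 n x).
rewrite leNgt; apply/negP => /gU Ux; apply: nU; exact: mem_set.
Qed.

Lemma push_continuous (S T : topologicalType) (f : S -> T) (cf : continuous f) :
  nice R S -> continuous (fun m : Delta R S => push cf m).
Proof.
move=> nS; apply: Delta_continuous_lsc => U oU m r.
rewrite pr_push; last exact: borel_open.
have oV : open (f @^-1` U) by move/continuousP : cf; exact.
move=> /(near_pr_open nS oV); apply: filterS => m'.
by rewrite pr_push//; exact: borel_open.
Qed.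

(** Complements reverse the inequality on closed sets, and open sets are increasing unions of closed
    sets. *)
Lemma Delta_le_open (S : topologicalType) (m m' : Delta R S) : nice R S ->
  (forall U, open U -> pr m U <= pr m' U) -> m = m'.
Proof.
move=> nS h; apply: Delta_eq_open => U oU; apply/eqP; rewrite eq_le h//=.
have [C [cC CC ->]] := nice_Fsigma nS oU.
have bC n := borel_closed (cC n).
have h1 := @pr_cvg_up _ _ m C bC CC; have h2 := @pr_cvg_up _ _ m' C bC CC.
rewrite -(cvg_lim (@Rhausdorff R) h1) -(cvg_lim (@Rhausdorff R) h2).
apply: ler_lim; [by apply/cvg_ex; eexists; exact: h2|by apply/cvg_ex; eexists; exact: h1|].
apply: nearW => n /=; have := h _ (closed_openC (cC n)); rewrite !prC//; lra.
Qed.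

Lemma creg_R : creg R R.
Proof.
move=> x A /nbhs_ballP[e /= e0 eA].
pose f y := Num.max 0 (1 - `|x - y| / e).
exists f; split.
- move=> y; apply: (@continuous_max R R (fun=> 0) (fun y => 1 - `|x - y| / e) y).
    exact: cst_continuous.
  have c1 : (fun y : R => `|x - y| / e) z @[z --> y] --> `|x - y| / e.
    by apply: cvgMl; apply: cvg_norm; apply: cvgB; [exact: cvg_cst|exact: cvg_id].
  by apply: cvgB => //; exact: cvg_cst.
- by move=> y; rewrite le_max lexx/= ge_max ler01/= gerBl divr_ge0// ltW.
- have xx : x - x = 0 by rewrite addrN.
  by rewrite /f lt_max xx normr0 mul0r subr0 ltr01 orbT.
- move=> y; rewrite /f lt_max ltxx/= subr_gt0 ltr_pdivrMr// mul1r => h.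
  by apply: eA.
Qed.

Lemma creg_Delta (S : topologicalType) : creg R (Delta R S).
Proof.
apply: (@creg_initial R _ _ (@expects R S)).
by apply: creg_prod => _; exact: creg_R.
Qed.

Lemma t1_Delta (S : topologicalType) : nice R S -> t1 (Delta R S).
Proof.
move=> nS m m' h; apply: Delta_le_open => // U oU.
apply/ler_addgt0Pr => e e0.
have := near_pr_open nS oU (_ : pr m U - e < pr m U).
by move=> /(_ ltac:(lra)) /h /=; lra.
Qed.

End portmanteau.

(** * Measures on Baire space from the masses of cylinders *)

Section kolmogorov.
Context (R : realType) (p : seq nat -> R).
Context (p0 : forall u, 0 <= p u) (p1 : p [::] = 1)
  (pS : forall u, (fun k => \sum_(0 <= n < k) p (rcons u n)) @ \oo --> p u).

Let ps u n := \sum_(0 <= i < n) p (rcons u i).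

Let psS u n : ps u n.+1 = ps u n + p (rcons u n).
Proof. by rewrite /ps big_nat_recr. Qed.

Let ps_mono u m n : (m <= n)%N -> ps u m <= ps u n.
Proof.
elim: n => [|n IH]; first by rewrite leqn0 => /eqP ->.
rewrite leq_eqVlt => /orP[/eqP -> //|]; rewrite ltnS => /IH h.
by rewrite psS (le_trans h)// lerDl.
Qed.

Let ps_le u n : ps u n <= p u.
Proof.
rewrite -(cvg_lim (@Rhausdorff R) (@pS u)); apply: limr_ge.
  by apply/cvg_ex; eexists; exact: pS.
by exists n => // k /= nk; exact: ps_mono.
Qed.

Let next u s := get [set n | ps u n <= s < ps u n.+1].

Let next_ex u s : 0 <= s < p u -> exists n, ps u n <= s < ps u n.+1.
Proof.
move=> /andP[s0 su].
have [k hk] : exists k, s < ps u k.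
  have [k _ hk] := @cvgr_gt _ _ _ _ _ _ (@pS u) _ su.
  by exists k; exact: (hk k (leqnn k)).
elim: k hk => [|k IH] hk.
  by exfalso; move: hk; rewrite /ps big_nil; lra.
by case: (ltP s (ps u k)) => h; [exact: IH|exists k; rewrite h hk].
Qed.

Let nextP u s n : 0 <= s < p u -> (next u s = n) <-> ps u n <= s < ps u n.+1.
Proof.
move=> /next_ex h; have /= hn : [set n | ps u n <= s < ps u n.+1] (next u s) by exact: getPex h.
split=> [<- //|h2]; move: hn h2; move: (next u s) => l /andP[a b] /andP[c d].
apply/eqP; rewrite eqn_leq; apply/andP; split; rewrite leqNgt; apply/negP => /(@ps_mono u); lra.
Qed.

(** The interval from 0 to 1 is cut into intervals of lengths [p u], nested as the words [u].
    [w t k] is the word of length [k] whose interval contains [t], with the offset of [t] from the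
    left end of that interval; [a u] below is this left end. *)
Let w t := fix w k := if k is l.+1 then
  let n := next (w l).1 (w l).2 in (rcons (w l).1 n, (w l).2 - ps (w l).1 n) else ([::], t).

Let wS t k : w t k.+1 = (rcons (w t k).1 (next (w t k).1 (w t k).2),
   (w t k).2 - ps (w t k).1 (next (w t k).1 (w t k).2)).
Proof. by []. Qed.

Let size_w t k : size (w t k).1 = k.
Proof. by elim: k => // k IH; rewrite wS /= size_rcons IH. Qed.

Let a u := \sum_(0 <= k < size u) ps (take k u) (nth 0%N u k).

Let a_rcons u n : a (rcons u n) = a u + ps u n.
Proof.
rewrite /a size_rcons big_nat_recr//= nth_rcons ltnn eqxx -cats1 take_size_cat//.
congr (_ + _); apply: eq_big_nat => k /andP[_ ku].
by rewrite take_cat nth_cat ku.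
Qed.

Let w_itv u t : 0 <= t < 1 ->
  ((w t (size u)).1 = u <-> a u <= t < a u + p u) /\
  ((w t (size u)).1 = u -> (w t (size u)).2 = t - a u).
Proof.
move=> t01; elim/last_ind: u => [|u n [IH1 IH2]].
  by rewrite /a /= big_nil subr0 add0r p1.
rewrite size_rcons wS a_rcons /=.
have key : rcons (w t (size u)).1 (next (w t (size u)).1 (w t (size u)).2) = rcons u n <->
    (w t (size u)).1 = u /\ next u (t - a u) = n.
  split=> [/eqP|[wu nn]]; last by rewrite (IH2 wu) wu nn.
  rewrite eqseq_rcons => /andP[/eqP wu /eqP nn]; split=> //.
  by rewrite -(IH2 wu) -nn wu.
have un : ps u n + p (rcons u n) <= p u by rewrite -psS; exact: ps_le.
have pn0 := p0 (rcons u n).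
have sn0 : 0 <= ps u n by rewrite /ps; apply: sumr_ge0.
split; last first.
  by move=> /key[wu nn]; rewrite (IH2 wu) wu nn; lra.
rewrite key IH1; split=> [[/andP[h1 h2] hn]|/andP[h1 h2]].
  have b : 0 <= t - a u < p u by apply/andP; split; lra.
  by move/(@nextP u _ n b) : hn; rewrite psS => /andP[? ?]; apply/andP; split; lra.
split; first by apply/andP; split; lra.
have b : 0 <= t - a u < p u by apply/andP; split; lra.
by apply/(@nextP u _ n b); rewrite psS; apply/andP; split; lra.
Qed.

Let X t : Baire := fun k => next (w t k).1 (w t k).2.

Let X_w t k : mkseq (X t) k = (w t k).1.
Proof. by elim: k => // k IH; rewrite mkseqS IH. Qed.

Let X_N u : [set t | 0 <= t < 1 /\ N u (X t)] = `[a u, a u + p u[%classic.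
Proof.
have a0 v : 0 <= a v by apply: sumr_ge0 => k _; apply: sumr_ge0.
have a1 v : a v + p v <= 1.
  elim/last_ind: v => [|v n IH]; first by rewrite /a /= big_nil add0r p1.
  rewrite a_rcons; have := ps_le v n.+1; rewrite psS; lra.
apply/seteqP; split=> t /=; rewrite in_itv/= /N /= X_w.
  by move=> [t01 /(w_itv u t01).1].
move=> h; have t01 : 0 <= t < 1.
  by case/andP: h => h1 h2; have := a0 u; have := a1 u => ? ?; apply/andP; split; lra.
by split=> //; apply/(w_itv u t01).1.
Qed.

Let I := `[0%R, 1%R[%classic : set R.

Let XI A := I `&` X @^-1` A.

Let XI_N u : XI (N u) = `[a u, a u + p u[%classic.
Proof.
by rewrite -X_N /XI /I; apply/seteqP; split=> t [h1 h2]; split=> //; move: h1; rewrite /= in_itv.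
Qed.

Let mXI A : borel A -> measurable (XI A).
Proof.
have sg : sigma_algebra setT [set A | measurable (XI A)].
  split => /=.
  - by rewrite /XI preimage_set0 setI0.
  - move=> B mB; rewrite setTD /XI preimage_setC -setDE.
    rewrite (_ : _ `\` _ = I `\` XI B); first by apply: measurableD => //; exact: measurable_itv.
    apply/seteqP; split=> t [tI h]; first by split=> // -[_ /h].
    by split=> // Bt; apply: h; split.
  - move=> F mF; rewrite /XI preimage_bigcup setI_bigcupr.
    by apply: bigcupT_measurable.
apply: (smallest_sub sg) => U oU /=.
rewrite (open_Baire_bigcup oU) /XI preimage_bigcup setI_bigcupr.
by apply: bigcup_measurable => n _; rewrite -/(XI _) XI_N.
Qed.

(** [X t] is the branch of intervals containing [t], and the measure is the image under [X] of
    Lebesgue measure on the unit interval: the preimage of [N u] is an interval of length [p u]. *)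
Lemma Baire_measure : exists m : Delta R Baire, forall u, pr m (N u) = p u.
Proof.
pose v A := fine (@lebesgue_measure R (XI A)).
have fin A : borel A -> @lebesgue_measure R (XI A) \is a fin_num.
  move=> bA; rewrite ge0_fin_numE// (@le_lt_trans _ _ (@lebesgue_measure R I))//.
    apply: le_measure; rewrite ?inE//; [exact: mXI|exact: measurable_itv|].
    by move=> t [].
  by rewrite /I lebesgue_measure_itv/= lte_fin ltr01 -EFinB ltry.
have vN u : v (N u) = p u.
  rewrite /v XI_N lebesgue_measure_itv/= lte_fin; case: ifPn => [_|]; first by rewrite /= addrC addKr.
  by rewrite -leNgt gerDl => h; apply/eqP; rewrite /= eq_sym eq_le h p0.
have [A bA|||m hm] := @Delta_make R Baire v.
- exact: fine_ge0.
- by rewrite -N_nil vN.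
- move=> F bF tF.
  have := @measure_semi_sigma_additive _ _ _ (@lebesgue_measure R) (fun n => XI (F n)).
  rewrite -setI_bigcupr -preimage_bigcup => h.
  have cv : (fun n => \sum_(0 <= i < n) lebesgue_measure (XI (F i)))%E @ \oo -->
      (v (\bigcup_n F n))%:E.
    rewrite /v fineK; last by apply: fin; exact: borel_bigcup.
    apply: h.
    + by move=> n; exact: mXI.
    + apply/trivIsetP => i j _ _ ij; rewrite /XI setIACA setIid -preimage_setI.
      by move/trivIsetP : tF => -> //; rewrite preimage_set0 setI0.
    + by apply: (mXI (borel_bigcup bF)).
  have e : (fun n => \sum_(0 <= i < n) lebesgue_measure (XI (F i)))%E =
      EFin \o (fun n => \sum_(0 <= i < n) v (F i)).
    by apply/funext => n /=; rewrite -sumEFin; apply: eq_bigr => i _; rewrite /v fineK// fin.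
  by move: cv; rewrite e => /fine_cvgP[_].
by exists m => u; rewrite hm//; exact: borel_N.
Qed.

End kolmogorov.

Lemma take_mkseq (T : Type) (f : nat -> T) n k : (n <= k)%N -> take n (mkseq f k) = mkseq f n.
Proof. by move=> nk; rewrite /mkseq -map_take take_iota; congr (map _ (iota _ _)); apply/minn_idPl. Qed.

(** * A continuous coding of the measures on Baire space *)

Section coding.
Context (R : realType).

Definition lev k (S : set (seq nat)) : set Baire := [set x | S (mkseq x k)].

Lemma clopen_lev k S : clopen (lev k S).
Proof.
apply: (@clopen_prefix _ k) => x y xy; rewrite /lev /=.
suff -> : mkseq x k = mkseq y k by [].
by apply/(@eq_from_nth _ 0%N); rewrite !size_mkseq// => i ik; rewrite !nth_mkseq// xy.
Qed.

Lemma borel_lev k S : borel (lev k S).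
Proof. by apply: borel_open; case: (clopen_lev k S). Qed.

Lemma N_lev u k : (size u <= k)%N -> N u = lev k [set v | take (size u) v = u].
Proof.
move=> uk; apply/seteqP; split=> x; rewrite /N /lev /=.
  by move=> <-; rewrite size_mkseq take_mkseq.
by rewrite take_mkseq.
Qed.

Lemma lev_take n k S : (n <= k)%N -> lev n S = lev k [set v | S (take n v)].
Proof. by move=> nk; apply/seteqP; split=> x; rewrite /lev /= take_mkseq. Qed.

(** A nonempty list of words codes the law of a uniformly drawn entry: finite support and rational
    weights, hence countably many codes. *)
Definition freq (l : seq (seq nat)) (S : set (seq nat)) : R :=
  (count (fun v => `[< S v >]) l)%:R / (size l)%:R.

Lemma freq_le l S S' : (forall v, v \in l -> S v -> S' v) -> freq l S <= freq l S'.
Proof.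
move=> h; rewrite /freq ler_wpM2r ?invr_ge0// ler_nat.
elim: l h => //= v l IH h; apply: leq_add; last first.
  by apply: IH => w wl; apply: h; rewrite inE wl orbT.
case: (asboolP (S v)) => // Sv; case: (asboolP (S' v)) => // nS; exfalso.
by apply: nS; apply: h => //; rewrite inE eqxx.
Qed.

Lemma freq_eq l S S' : (forall v, v \in l -> S v <-> S' v) -> freq l S = freq l S'.
Proof. by move=> h; apply/eqP; rewrite eq_le !freq_le// => v /h[]. Qed.

Lemma freqT l : l != [::] -> freq l setT = 1.
Proof.
move=> l0; rewrite /freq (eq_count (a2 := predT)); last by move=> v; rewrite asboolT.
by rewrite count_predT divff// pnatr_eq0 -lt0n lt0n size_eq0.
Qed.

Lemma freq0 l : freq l set0 = 0.
Proof.
rewrite /freq (eq_count (a2 := pred0)) ?count_pred0 ?mul0r//.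
by move=> v; rewrite asboolF.
Qed.

Lemma freqU l S S' : (forall v, S v -> S' v -> False) -> freq l (S `|` S') = freq l S + freq l S'.
Proof.
move=> d; rewrite /freq -mulrDl -natrD; congr (_%:R / _).
elim: l => //= v l ->; rewrite addnACA; congr (_ + _)%N.
rewrite asbool_or; case: (asboolP (S v)) => // Sv; case: (asboolP (S' v)) => // S'v.
by exfalso; exact: d Sv S'v.
Qed.

Lemma freqC l S : l != [::] -> freq l (~` S) = 1 - freq l S.
Proof.
move=> l0; rewrite -(freqT l0) -(setUv S) freqU; last by move=> v ? nS.
by rewrite addrC addKr.
Qed.

Lemma freq_rcons l n k S : (forall v, v \in l -> size v = k) ->
  freq (map (rcons ^~ n) l) [set v | S (take k v)] = freq l S.
Proof.
move=> h; rewrite /freq size_map; congr (_%:R / _); rewrite count_map.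
by apply: eq_in_count => v vl /=; rewrite -(h v vl) -cats1 take_size_cat.
Qed.

Definition words k (l : seq (seq nat)) := l != [::] /\ forall v, v \in l -> size v = k.

(** Total decoder: a number that codes no legal list gets the point mass at the zero word. *)
Definition dec k (n : nat) : seq (seq nat) :=
  let l := odflt [::] (unpickle n : option (seq (seq nat))) in
  if `[< words k l >] then l else [:: nseq k 0%N].

Lemma words_dec k n : words k (dec k n).
Proof.
rewrite /dec; case: asboolP => // _; split=> // v.
by rewrite inE => /eqP ->; rewrite size_nseq.
Qed.

Lemma dec_pickle k l : words k l -> dec k (pickle l) = l.
Proof. by move=> w; rewrite /dec pickleK /= asboolT. Qed.

(* The [k]-th digit of [y] proposes a law on words of length [k]; the proposal
   is ignored when it does not nearly extend the law already reached, so that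
   every [y] codes a measure. *)
Fixpoint L (y : nat -> nat) k : seq (seq nat) :=
  if k is j.+1 then
    let l := dec k (y k) in
    if `[< forall S, `|freq (L y j) S - freq l [set v | S (take j v)]| <= 2^-1 ^+ j >]
    then l else map (rcons ^~ 0%N) (L y j)
  else [:: [::]].

Lemma words_L y k : words k (L y k).
Proof.
elim: k => [|k [IH0 IH]] /=; first by split=> // v; rewrite inE => /eqP ->.
case: ifP => _; first exact: words_dec.
split; first by move: IH0; case: (L y k).
by move=> _ /mapP[v vl ->]; rewrite size_rcons IH.
Qed.

Lemma L_eq y y' k : (forall i, (i <= k)%N -> y i = y' i) -> L y k = L y' k.
Proof.
elim: k => //= k IH h; rewrite IH ?h// => i ik; apply: h; exact: leq_trans ik (leqnSn k).
Qed.

Lemma L_step y k S :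
  `|freq (L y k) S - freq (L y k.+1) [set v | S (take k v)]| <= 2^-1 ^+ k.
Proof.
rewrite /=; case: asboolP => // _.
by rewrite freq_rcons ?subrr ?normr0 ?exprn_ge0//; case: (words_L y k).
Qed.

(** The approximation at stage [k] of the mass of the event [S] about the first [n] digits. The
    steps are geometric, and [G] is the limit. *)
Definition F y k n S := freq (L y k) [set v | S (take n v)].

Lemma F_step y n k S : (n <= k)%N -> `|F y k n S - F y k.+1 n S| <= 2^-1 ^+ k.
Proof.
move=> nk; have := L_step y k [set v | S (take n v)]; rewrite /F.
rewrite (_ : [set v | [set v | S (take n v)] (take k v)] = [set v | S (take n v)])//.
by apply/funext => v /=; rewrite take_takel.
Qed.

Lemma F_cauchy y n k j S : (n <= k)%N -> `|F y k n S - F y (j + k) n S| <= 2 * 2^-1 ^+ k - 2 * 2^-1 ^+ (j + k).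
Proof.
move=> nk; elim: j => [|j IH]; first by rewrite add0n !subrr normr0.
have st := F_step y S (leq_trans nk (leq_addl j k)).
apply: (le_trans (ler_distD (F y (j + k) n S) _ _)).
rewrite addSn exprS; set x := 2^-1 ^+ (j + k) in st IH *; lra.
Qed.

Lemma F_cauchy2 y n k j S : (n <= k)%N -> (k <= j)%N -> `|F y k n S - F y j n S| <= 2 * 2^-1 ^+ k.
Proof.
move=> nk kj; have := F_cauchy y (j - k) S nk; rewrite subnK//.
move=> /le_trans; apply; rewrite gerBl mulr_ge0// exprn_ge0//.
Qed.

Lemma half_small (e : R) : 0 < e -> exists k, forall j, (k <= j)%N -> 2 * 2^-1 ^+ j < e.
Proof.
move=> e0; have [|k _ hk] := @cvgr_lt _ _ _ _ _ _ (@cvg_geometric R 2 2^-1 _) _ e0.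
  by rewrite ger0_norm; lra.
by exists k => j kj; exact: (hk j kj).
Qed.

Lemma F_cvg y n S : cvg ((fun k => F y k n S) @ \oo).
Proof.
apply/cauchy_cvgP; apply: cauchy_exP => e e0.
have [k hk] := half_small e0.
exists (F y (maxn k n) n S); exists (maxn k n) => // j /= kj.
rewrite /ball /=; apply: le_lt_trans (hk (maxn k n) (leq_maxl k n)).
by apply: F_cauchy2 => //; exact: leq_maxr.
Qed.

Definition G y n S : R := lim ((fun k => F y k n S) @ \oo).

Lemma G_F y n k S : (n <= k)%N -> `|G y n S - F y k n S| <= 2 * 2^-1 ^+ k.
Proof.
move=> nk; rewrite /G distrC.
have cv : (fun j => `|F y k n S - F y j n S|) @ \oo --> `|F y k n S - lim ((fun k => F y k n S) @ \oo)|.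
  by apply: cvg_norm; apply: cvgB; [exact: cvg_cst|exact: F_cvg].
rewrite -(cvg_lim (@Rhausdorff R) cv); apply: limr_le.
  by apply/cvg_ex; eexists; exact: cv.
by exists k => // j /= kj; exact: F_cauchy2.
Qed.

Lemma G_unique y n S r : (forall k, (n <= k)%N -> `|r - F y k n S| <= 2 * 2^-1 ^+ k) -> r = G y n S.
Proof.
move=> h; apply/eqP; rewrite -subr_eq0 -normr_le0.
apply/ler_addgt0Pr => e e0; rewrite add0r.
have [k hk] := half_small (divr_gt0 e0 (ltr0n R 2)).
have nk := leq_maxr k n; have kk := leq_maxl k n.
have h1 := h _ nk; have h2 := G_F y S nk; have h3 := hk _ kk.
move: h1 h2 h3; set a := F _ _ _ _; set b := 2 * _ => h1 h2 h3.
have := ler_distD a r (G y n S); rewrite [`|a - _|]distrC; lra.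
Qed.

Lemma F_levS y k n m S : (n <= m)%N -> F y k n S = F y k m [set v | S (take n v)].
Proof.
by move=> nm; rewrite /F; congr freq; apply/seteqP; split=> v /=; rewrite take_takel.
Qed.

Lemma G_levS y n m S : (n <= m)%N -> G y n S = G y m [set v | S (take n v)].
Proof.
move=> nm; apply: G_unique => k mk; rewrite -F_levS//.
by apply: G_F; exact: leq_trans mk.
Qed.

Definition tree y (u : seq nat) : R := G y (size u) [set u].

Lemma G_ge0 y n S : 0 <= G y n S.
Proof.
by apply: limr_ge; [exact: F_cvg|apply: nearW => k; rewrite /F /freq divr_ge0].
Qed.

Lemma G_T y n : G y n setT = 1.
Proof.
apply/esym/G_unique => k nk; rewrite (_ : F y k n setT = 1).
  by rewrite subrr normr0 mulr_ge0// exprn_ge0.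
by rewrite /F -(freqT (words_L y k).1).
Qed.

Lemma G_0 y n : G y n set0 = 0.
Proof.
apply/esym/G_unique => k nk; rewrite (_ : F y k n set0 = 0).
  by rewrite subrr normr0 mulr_ge0// exprn_ge0.
by rewrite /F -(freq0 (L y k)).
Qed.

Lemma G_U y n S S' : (forall v, S v -> S' v -> False) -> G y n (S `|` S') = G y n S + G y n S'.
Proof.
move=> d; rewrite /G -limD; [|exact: F_cvg|exact: F_cvg].
congr (lim (_ @ \oo)); apply/funext => k.
change (F y k n (S `|` S') = F y k n S + F y k n S').
by rewrite /F -freqU// => v; exact: d.
Qed.

Lemma G_C y n S : G y n (~` S) = 1 - G y n S.
Proof.
rewrite -(G_T y n) -(setUv S) G_U; last by move=> v ? nS.
by rewrite addrC addKr.
Qed.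

(** The source of countable additivity: a stage of [L] is a finite list, so finitely many words of
    [S] carry its mass up to [e]. *)
Lemma G_near y n S e : 0 < e ->
  exists M, forall S', S' `<=` S -> (forall i, (i < M)%N -> S (enumseq i) -> S' (enumseq i)) ->
    `|G y n S' - G y n S| < e.
Proof.
move=> e0; have [k hk] := half_small (divr_gt0 e0 (ltr0n R 2)).
pose j := maxn k n; have nj : (n <= j)%N by exact: leq_maxr.
exists (\max_(v <- L y j) (pickle (take n v)).+1) => S' S'S h.
have FE : F y j n S' = F y j n S.
  apply: freq_eq => v vl /=; split; first exact: S'S.
  have := h (pickle (take n v)); rewrite enumseqK; apply.
  by apply: (@leq_bigmax_seq _ (L y j) xpredT (fun v => (pickle (take n v)).+1) v).
have h1 := G_F y S nj; have h2 := G_F y S' nj; have h3 := hk _ (leq_maxl k n).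
move: h1 h2 h3; rewrite FE -/j; set a := F _ _ _ _; set b := 2 * _ => h1 h2 h3.
have := ler_distD a (G y n S') (G y n S); rewrite [`|a - _|]distrC; lra.
Qed.

Lemma tree_sum y u : (fun k => \sum_(0 <= n < k) tree y (rcons u n)) @ \oo --> tree y u.
Proof.
pose S := [set v : seq nat | take (size u) v = u].
pose T k := [set v : seq nat | exists2 n, (n < k)%N & v = rcons u n].
have E k : \sum_(0 <= n < k) tree y (rcons u n) = G y (size u).+1 (T k).
  elim: k => [|k IH].
    by rewrite big_nil (_ : T 0%N = set0) ?G_0//; apply/seteqP; split=> // v [].
  rewrite big_nat_recr//= IH /tree size_rcons -G_U.
    congr G; apply/seteqP; split=> v.
      by case=> [[n nk ->]|->]; [exists n => //; exact: leq_trans nk (leqnSn k)|exists k].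
    case=> n; rewrite ltnS leq_eqVlt => /orP[/eqP ->|nk] ->; first by right.
    by left; exists n.
  by move=> v [n nk ->] /eqP; rewrite eqseq_rcons eqxx /= => /eqP nE; rewrite nE ltnn in nk.
have -> : tree y u = G y (size u).+1 [set v | size v = (size u).+1 /\ S v].
  rewrite /tree (@G_levS y (size u) (size u).+1)//; apply: G_unique => k nk.
  rewrite (_ : F y k _ _ = F y k (size u).+1 [set v | [set u] (take (size u) v)]).
    exact: G_F.
  apply: freq_eq => v vl /=; split=> [[]//|h]; split=> //.
  by rewrite size_takel// ((words_L y k).2 v vl).
apply/cvgrPdist_lt => e e0.
have [M hM] := @G_near y (size u).+1 [set v | size v = (size u).+1 /\ S v] e e0.
exists (\max_(i < M) (nth 0%N (enumseq i) (size u)).+1) => // k /= Mk.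
rewrite E distrC; apply: hM.
  move=> v [n nk ->]; rewrite /S /= size_rcons; split=> //.
  by rewrite -cats1 take_size_cat.
move=> i iM [szv Sv]; exists (nth 0%N (enumseq i) (size u)).
  by apply: leq_trans Mk; exact: (leq_bigmax (Ordinal iM)).
rewrite -[LHS](cat_take_drop (size u)) Sv -cats1; congr cat.
apply: (@eq_from_nth _ 0%N); rewrite size_drop szv subSnn// => -[|]// _.
by rewrite nth_drop addn0.
Qed.

(** The two sides agree on finite sets of words. Monotone limits then give [<=] for every [S], and
    the same inequality for the complement gives equality. *)
Lemma pr_lev (m : Delta R Baire) y : (forall u, pr m (N u) = tree y u) ->
  forall n S, pr m (lev n S) = G y n S.
Proof.
move=> hm.
have fin n S j : pr m (lev n (S `&` [set v | size v = n /\ (pickle v < j)%N])) =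
    G y n (S `&` [set v | size v = n /\ (pickle v < j)%N]).
  elim: j => [|j IH].
    rewrite (_ : S `&` _ = set0); last by apply/seteqP; split=> // v [_ []].
    by rewrite G_0 (_ : lev n set0 = set0) ?pr0.
  set A := S `&` [set v | size v = n /\ (pickle v < j)%N] in IH.
  have [|nx] := pselect (exists v, [/\ S v, size v = n & pickle v = j]).
    move=> [v [Sv sv vj]].
    have -> : S `&` [set v | size v = n /\ (pickle v < j.+1)%N] = A `|` [set v].
      apply/seteqP; split=> w.
        move=> [Sw [sw]]; rewrite ltnS leq_eqVlt => /orP[/eqP wj|wj]; last by left.
        by right; rewrite /=; apply: (pcan_inj pickleK); rewrite wj vj.
      case=> [[Sw [sw wj]]|->]; first by split=> //; split=> //; exact: leq_trans wj _.
      by split=> //; split=> //; rewrite vj.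
    rewrite G_U; last by move=> w [_ [_]] + we; rewrite we vj ltnn.
    have -> : lev n (A `|` [set v]) = lev n A `|` N v.
      by rewrite (@N_lev v n) ?sv//; apply/seteqP; split=> x;
        rewrite /lev /= take_oversize ?size_mkseq.
    rewrite prDU; first by rewrite IH hm /tree sv.
    - exact: borel_lev.
    - exact: borel_N.
    - apply/seteqP; split=> // x [[_ [_]]] + xv; rewrite /N /= sv in xv.
      by rewrite xv vj ltnn.
  have -> // : S `&` [set v | size v = n /\ (pickle v < j.+1)%N] = A.
  apply/seteqP; split=> w [Sw [sw wj]]; split=> //; split=> //; last exact: leq_trans wj _.
  move: wj; rewrite ltnS leq_eqVlt => /orP[/eqP wj|//].
  by exfalso; apply: nx; exists w.
have le n S : pr m (lev n S) <= G y n S.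
  have h : pr m \o (fun j => lev n (S `&` [set v | size v = n /\ (pickle v < j)%N])) @ \oo -->
      pr m (\bigcup_j lev n (S `&` [set v | size v = n /\ (pickle v < j)%N])).
    apply: pr_cvg_up; first by move=> j; exact: borel_lev.
    by move=> j x [Sx [sx xj]]; split=> //; split=> //; exact: leq_trans xj _.
  rewrite (_ : \bigcup_j _ = lev n S) in h; last first.
    apply/seteqP; split=> x; first by case=> j _ [].
    by move=> Sx; exists (pickle (mkseq x n)).+1 => //; split=> //=; rewrite size_mkseq.
  rewrite -(cvg_lim (@Rhausdorff R) h); apply: limr_le.
    by apply/cvg_ex; eexists; exact: h.
  apply: nearW => j /=; rewrite fin.
  rewrite -subr_ge0.
  have -> : G y n S = G y n (S `&` [set v | size v = n /\ (pickle v < j)%N]) +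
     G y n (S `\` [set v | size v = n /\ (pickle v < j)%N]).
    by rewrite -G_U ?setUIDK// => v [_ ?] [].
  by rewrite addrC addKr G_ge0.
move=> n S; apply/eqP; rewrite eq_le le/=.
have := le n (~` S); rewrite G_C (_ : lev n (~` S) = ~` lev n S)// prC; last exact: borel_lev.
lra.
Qed.

Lemma kappa_ex y : exists m : Delta R Baire, forall n S, pr m (lev n S) = G y n S.
Proof.
have [|||m hm] := @Baire_measure R (tree y).
- by move=> u; exact: G_ge0.
- rewrite /tree -(G_T y 0); apply: G_unique => k _.
  rewrite -(_ : F y k 0 [set [::]] = F y k 0 setT); first exact: G_F.
  by apply: freq_eq => v vl /=; rewrite take0; split.
- exact: tree_sum.
- by exists m; exact: pr_lev.
Qed.

Definition kappa y : Delta R Baire := projT1 (cid (kappa_ex y)).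

Lemma kappa_G y n S : pr (kappa y) (lev n S) = G y n S.
Proof. exact: (projT2 (cid (kappa_ex y))). Qed.

Lemma kappa_freq y k S : `|pr (kappa y) (lev k S) - freq (L y k) S| <= 2 * 2^-1 ^+ k.
Proof.
rewrite kappa_G; have := G_F y S (leqnn k).
rewrite (_ : F y k k S = freq (L y k) S)//; apply: freq_eq => v vl /=.
by rewrite take_oversize// (words_L y k).2.
Qed.

(** The first [k + 1] digits of [y] fix [L y k], hence [kappa y] on events of level [k] up to a
    small error, and such events nearly fill an open set. *)
Lemma kappa_continuous : continuous (kappa : Baire -> Delta R Baire).
Proof.
apply: Delta_continuous_lsc => U oU y r ry.
pose S k := [set v : seq nat | size v = k /\ N v `<=` U].
have lS k x : lev k (S k) x -> U x.
  by move=> [_]; apply; rewrite N_mkseq; exact: cyl_refl.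
(* The margin is twice the error of [kappa_freq], once for [y] and once for the nearby [z]. *)
have [k [ltk k1]] : exists k, r + 4 * 2^-1 ^+ k < pr (kappa y) (lev k (S k)) /\ True.
  have d0 : 0 < (pr (kappa y) U - r) / 2 by lra.
  have : pr (kappa y) \o (fun k => lev k (S k)) @ \oo --> pr (kappa y) (\bigcup_k lev k (S k)).
    apply: pr_cvg_up => [k|k x [_ xU]]; first exact: borel_lev.
    split; first by rewrite size_mkseq.
    apply: subset_trans xU; rewrite !N_mkseq; move=> z zx i ik.
    by apply: zx; exact: leq_trans ik (leqnSn k).
  rewrite (_ : \bigcup_k _ = U); last first.
    apply/seteqP; split=> x; first by case=> k _ /lS.
    move=> Ux; have /nbhs_BaireP[k kU] : nbhs x U by exact: open_nbhs_nbhs.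
    by exists k => //; split; rewrite ?size_mkseq// N_mkseq.
  move=> cv; have [|k _ hk] := @cvgr_gt _ _ _ _ _ _ cv (r + (pr (kappa y) U - r) / 2); first by lra.
  have [j hj] := half_small (divr_gt0 d0 (ltr0n R 2)).
  exists (maxn k j); split=> //.
  have /= := hk _ (leq_maxl k j); have := hj _ (leq_maxr k j); lra.
apply/nbhs_BaireP; exists k.+1 => z zy /=.
have LE : L z k = L y k by apply: L_eq => i ik; exact: zy.
have := kappa_freq z k (S k); have := kappa_freq y k (S k); rewrite LE.
have := @pr_le _ _ (kappa z) (lev k (S k)) U (borel_lev k _) (borel_open oU) (@lS k).
rewrite !ler_norml => h1 /andP[h2 h3] /andP[h4 h5]; lra.
Qed.

Lemma Delta_eq_N (m m' : Delta R Baire) : (forall u, pr m (N u) = pr m' (N u)) -> m = m'.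
Proof.
move=> h; apply: (@Delta_eq_setI R Baire [set A | A = set0 \/ exists u, A = N u]).
- move=> U oU; rewrite (open_Baire_bigcup oU) bigcup_mkcond.
  apply: sigma_algebra_bigcup => i; case: ifP => _; last exact: sigma_algebra0.
  by apply: sub_sigma_algebra; right; exists (enumseq i).
- by move=> A [->|[u ->]]; [exact: borel0|exact: borel_N].
- have sub u v : (size u <= size v)%N -> N u `&` N v = set0 \/ N u `&` N v = N v.
    move=> uv; have [e|ne] := eqVneq (take (size u) v) u; [right|left].
      apply/seteqP; split=> x; [by case|move=> xv; split=> //].
      by rewrite /N /= -{2}e -[in RHS]xv take_mkseq.
    apply/seteqP; split=> // x [xu xv]; move/eqP: ne; apply.
    by rewrite -xv take_mkseq.
  move=> A B [->|[u ->]] [->|[v ->]]; rewrite ?set0I ?setI0; [by left|by left|by left|].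
  case: (leqP (size u) (size v)) => [/sub|/ltnW /sub]; last rewrite setIC.
    by case=> ->; [left|right; exists v].
  by case=> ->; [left|right; exists u].
- by right; exists [::]; rewrite N_nil.
- by move=> A [->|[u ->]]; [rewrite !pr0|exact: h].
Qed.

End coding.

Section coder.
Context (R : realType).
Implicit Type m : Delta R Baire.

(** Each word [v] is repeated as often as the integer part of [K * m (N v)] says, so each word of
    [s] loses less than one count. *)
Lemma floor_list m k (K : nat) (s : seq (seq nat)) : uniq s -> (forall v, v \in s -> size v = k) ->
  exists l, (forall v, v \in l -> size v = k) /\ forall S,
    K%:R * pr m (lev k (S `&` [set v | v \in s])) - (size s)%:R <=
    (count (fun v => `[< S v >]) l)%:R <= K%:R * pr m (lev k (S `&` [set v | v \in s])).
Proof.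
elim: s => [|v s IH] /=.
  move=> _ _; exists [::]; split=> // S; rewrite (_ : lev _ _ = set0) ?pr0 ?mulr0 ?subrr ?lexx//.
  by apply/seteqP; split=> // x [].
move=> /andP[vs us] hs.
have [||l [hl IHl]] := IH => //; first by move=> w ws; apply: hs; rewrite inE ws orbT.
have sv : size v = k by apply: hs; rewrite inE eqxx.
exists (nseq (Num.truncn (K%:R * pr m (N v))) v ++ l); split.
  by move=> w; rewrite mem_cat mem_nseq => /orP[/andP[_ /eqP ->]//|/hl].
move=> S; rewrite count_cat count_nseq natrD.
have Kp : 0 <= K%:R * pr m (N v) by rewrite mulr_ge0// pr_ge0.
have /andP[t1 t2] := truncn_itv Kp; rewrite -natr1 in t2.
have /andP[a b] := IHl S.
have [Sv|nSv] := pselect (S v).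
  rewrite asboolT// mul1n.
  have -> : lev k (S `&` [set v0 | v0 \in v :: s]) = lev k (S `&` [set v0 | v0 \in s]) `|` N v.
    rewrite (@N_lev v k) ?sv//; apply/seteqP; split=> x; rewrite /lev /= inE take_oversize ?size_mkseq//.
      by move=> [Sx /orP[/eqP|]]; [right|left].
    by case=> [[Sx ->]|->]; [rewrite orbT|rewrite eqxx].
  rewrite prDU; [|exact: borel_lev|exact: borel_N|]; last first.
    apply/seteqP; split=> // x [[_ /=]] + xv; rewrite /N /= sv in xv.
    by rewrite xv (negPf vs).
  by rewrite mulrDr -natr1; apply/andP; split; lra.
rewrite asboolF// mul0n add0r.
have -> : lev k (S `&` [set v0 | v0 \in v :: s]) = lev k (S `&` [set v0 | v0 \in s]).
  apply/seteqP; split=> x; rewrite /lev /= inE.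
    by move=> [Sx /orP[/eqP e|]]; [rewrite e in Sx|].
  by move=> [Sx ->]; rewrite orbT.
by rewrite -natr1; apply/andP; split; lra.
Qed.

(** Keep finitely many words of mass above [1 - e / 2], round down with a denominator [K] so large
    that rounding costs at most [e / 2], and pad to exactly [K] words. Padding only raises counts,
    so frequencies are bounded below; the complement gives the upper bound. *)
Lemma freq_approx m k e : 0 < e ->
  exists l, words k l /\ forall S, `|freq R l S - pr m (lev k S)| <= e.
Proof.
move=> e0.
pose D j := [set v : seq nat | size v = k /\ (pickle v < j)%N].
have [j hj] : exists j, 1 - e / 2 < pr m (lev k (D j)).
  have h : pr m \o (fun j => lev k (D j)) @ \oo --> pr m (\bigcup_j lev k (D j)).
    apply: pr_cvg_up; first by move=> j; exact: borel_lev.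
    by move=> j x [sx xj]; split=> //; exact: leq_trans xj _.
  rewrite (_ : \bigcup_j _ = setT) ?prT in h; last first.
    apply/seteqP; split=> x // _; exists (pickle (mkseq x k)).+1 => //.
    by split=> //=; rewrite size_mkseq.
  have [|j _ hj] := @cvgr_gt _ _ _ _ _ _ h (1 - e / 2); first by lra.
  by exists j; exact: (hj j (leqnn j)).
pose s := [seq v <- undup (map enumseq (iota 0 j)) | size v == k].
have Ds v : D j v -> v \in s.
  move=> [sv vj]; rewrite mem_filter sv eqxx mem_undup.
  by apply/mapP; exists (pickle v); rewrite ?enumseqK// mem_iota.
pose K := (Num.truncn ((size s)%:R / (e / 2))).+1.
have K0 : 0 < K%:R :> R by rewrite ltr0n.
have sK : (size s)%:R <= K%:R * (e / 2).
  rewrite -ler_pdivrMr; last by lra.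
  by have /andP[_ /ltW] := truncn_itv (divr_ge0 (ler0n R (size s)) (ltW (divr_gt0 e0 (ltr0n R 2)))).
have [||l [hl H]] := @floor_list m k K s.
- by rewrite filter_uniq// undup_uniq.
- by move=> v; rewrite mem_filter => /andP[/eqP].
have slK : (size l <= K)%N.
  have /andP[_] := H setT; rewrite (eq_count (a2 := predT)); last by move=> v; rewrite asboolT.
  rewrite count_predT -(ler_nat R) => /le_trans; apply.
  by apply: ler_piMr => //; apply: pr_le1; exact: borel_lev.
pose l' := l ++ nseq (K - size l) (nseq k 0%N).
have sl' : size l' = K by rewrite size_cat size_nseq subnKC.
have wl' : words k l'.
  split; first by rewrite -size_eq0 sl'.
  by move=> v; rewrite mem_cat mem_nseq => /orP[/hl//|/andP[_ /eqP ->]]; rewrite size_nseq.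
have lower S : pr m (lev k S) - e <= freq R l' S.
  have h1 : pr m (lev k S) <= pr m (lev k (S `&` [set v | v \in s])) + e / 2.
    have := @prU_le _ _ m (lev k (S `&` [set v | v \in s])) (~` lev k (D j)) (borel_lev k _) (borelC (borel_lev k _)).
    rewrite prC; last exact: borel_lev.
    have : pr m (lev k S) <= pr m (lev k (S `&` [set v | v \in s]) `|` ~` lev k (D j)).
      apply: pr_le; [exact: borel_lev|apply: borelU; [exact: borel_lev|apply: borelC; exact: borel_lev]|].
      move=> x Sx; have [Dx|] := pselect (D j (mkseq x k)); [left|by right].
      by split=> //; exact: Ds.
    lra.
  have h2 : K%:R * pr m (lev k (S `&` [set v | v \in s])) - K%:R * (e / 2) <= K%:R * freq R l' S.
    have -> : K%:R * freq R l' S = (count (fun v => `[< S v >]) l')%:R.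
      by rewrite /freq sl' mulrC divfK// gt_eqF.
    rewrite count_cat natrD.
    have /andP[a _] := H S.
    have := ler0n R (count (fun v => `[< S v >]) (nseq (K - size l) (nseq k 0%N))); lra.
  rewrite -mulrBr ler_pM2l// in h2; lra.
exists l'; split=> // S.
have := lower S; have := lower (~` S).
rewrite freqC; last by case: wl'.
rewrite (_ : lev k (~` S) = ~` lev k S)// prC; last exact: borel_lev.
by move=> h1 h2; rewrite ler_norml; apply/andP; split; lra.
Qed.

(** With this tolerance the lists of levels [k] and [k + 1] differ by less than [2^-1 ^+ k], so that
    they pass the test in [L]. *)
Definition coded m k l := words k l /\
  forall S, `|freq R l S - pr m (lev k S)| <= 2^-1 ^+ k.+2.

Definition coder m k : nat := pickle (xget [::] (coded m k)).

(** The list is picked from the predicate [coded m k], which reads [m] on level [k] only.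
    [diagonal_play] rests on this locality. *)
Lemma coder_local m m' k : (forall S, pr m (lev k S) = pr m' (lev k S)) -> coder m k = coder m' k.
Proof.
move=> h; congr (pickle (xget _ _)); apply/funext => l; apply/propext.
by split=> -[w hl]; split=> // S; have := hl S; rewrite h.
Qed.

Lemma coderP m k : coded m k (xget [::] (coded m k)).
Proof.
by apply: xgetPex; apply: freq_approx; rewrite exprn_gt0.
Qed.

Lemma L_coder m k S : `|freq R (L R (coder m) k) S - pr m (lev k S)| <= 2^-1 ^+ k.+2.
Proof.
elim: k S => [|k IH] S.
  have [S0|nS0] := pselect (S [::]).
    rewrite (_ : lev 0 S = setT); last by apply/seteqP; split.
    rewrite prT (_ : freq _ _ _ = 1) ?subrr ?normr0 ?exprn_ge0//.
    by rewrite /freq /= asboolT// divr1.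
  rewrite (_ : lev 0 S = set0); last by apply/seteqP; split.
  rewrite pr0 (_ : freq _ _ _ = 0) ?subrr ?normr0 ?exprn_ge0//.
  by rewrite /freq /= asboolF// mul0r.
have [w hw] := coderP m k.+1.
rewrite /= {2 4}/coder dec_pickle// asboolT//.
move=> S'; have := IH S'; have := hw [set v | S' (take k v)]; rewrite -lev_take//.
rewrite !exprS; set x := 2^-1 ^+ k.
have x0 : 0 <= x by rewrite exprn_ge0.
set a := freq _ _ _; set b := pr _ _; set c := freq _ _ _ => h1 h2.
apply: (le_trans (ler_distD b _ _)); rewrite [`|b - _|]distrC; lra.
Qed.

Lemma coderK m : kappa R (coder m) = m.
Proof.
apply: Delta_eq_N => u; apply/eqP; rewrite -subr_eq0 -normr_le0.
apply/ler_addgt0Pr => e e0; rewrite add0r.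
have [k hk] := @half_small R e e0.
pose j := maxn k (size u); have kj : (k <= j.+1)%N by rewrite (leq_trans (leq_maxl k (size u))).
have uj : (size u <= j.+1)%N by rewrite (leq_trans (leq_maxr k (size u))).
have uj' : (size u <= j.+2)%N by rewrite (leq_trans uj).
rewrite (N_lev uj').
have h1 := kappa_freq R (coder m) j.+2 [set v | take (size u) v = u].
have h2 := L_coder m j.+2 [set v | take (size u) v = u].
have h3 := hk _ kj.
have x0 : 0 <= 2^-1 ^+ j.+1 :> R by rewrite exprn_ge0.
move: h1 h2; set a := pr _ _; set b := pr _ _; set c := freq _ _ _.
rewrite (exprS _ j.+3) (exprS _ j.+2) (exprS _ j.+1); move: x0 h3; set x := 2^-1 ^+ j.+1 => x0 h3 h1 h2.
apply: (le_trans (ler_distD c _ _)); lra.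
Qed.

End coder.

(** * Lifting measures along continuous maps from Baire space *)

Section lift.
Context (R : realType) (S : topologicalType) (nS : nice R S).
Context (f : Baire -> S) (cf : continuous f) (m : Delta R S).
Context (fm : outer1 m (range f)).

Let hull_closure u : exists H, [/\ borel H, f @` N u `<=` H, H `<=` closure (f @` N u) &
  forall B, borel B -> f @` N u `<=` B -> pr m (H `\` B) = 0].
Proof.
have [H [bH fH hH]] := hull m (f @` N u).
have bc : borel (closure (f @` N u)) by apply: borel_closed; exact: closed_closure.
exists (H `&` closure (f @` N u)); split.
- exact: borelI.
- by move=> x fx; split; [exact: fH|exact: subset_closure].
- by move=> x [].
- move=> B bB fB; apply: (@pr_le0 _ _ m _ (H `\` B)).
  + by apply: borelD => //; exact: borelI.
  + exact: borelD.
  + by move=> x [[]].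
  + exact: hH.
Qed.

(** The images of cylinders need not be Borel. They are replaced by measurable hulls, kept inside
    the closures so that small cylinders still have small hulls. *)
Let h u := projT1 (cid (hull_closure u)).

Let hP u : [/\ borel (h u), f @` N u `<=` h u, h u `<=` closure (f @` N u) &
  forall B, borel B -> f @` N u `<=` B -> pr m (h u `\` B) = 0].
Proof. exact: (projT2 (cid (hull_closure u))). Qed.

Let bh u : borel (h u). Proof. by case: (hP u). Qed.

(** Hulls of siblings may overlap. Each child keeps what earlier siblings leave, so the sets [H u]
    for words of a given length are disjoint. *)
Let D u n := h (rcons u n) `\` \bigcup_(l in [set l | (l < n)%N]) h (rcons u l).

Let bD u n : borel (D u n).
Proof. by apply: borelD => //; apply: borel_bigcup_lt => i. Qed.

Let H u := \bigcap_(k in [set k | (k < size u)%N]) D (take k u) (nth 0%N u k).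

Let H_nil : H [::] = setT. Proof. by apply/seteqP; split. Qed.

Let H_rcons u n : H (rcons u n) = H u `&` D u n.
Proof.
apply/seteqP; split=> x.
  move=> hx; split.
    move=> k /= ku; have := hx k; rewrite /= size_rcons => /(_ (ltnW ku)).
    by rewrite -cats1 take_cat nth_cat ku.
  by have := hx (size u); rewrite /= size_rcons => /(_ (leqnn _)); rewrite -cats1 take_size_cat// nth_cat ltnn subnn.
move=> [hx dx] k /=; rewrite size_rcons ltnS leq_eqVlt => /orP[/eqP ->|ku].
  by rewrite -cats1 take_size_cat// nth_cat ltnn subnn.
by rewrite -cats1 take_cat nth_cat ku; exact: hx.
Qed.

Let bH u : borel (H u).
Proof.
elim/last_ind: u => [|u n IH]; first by rewrite H_nil; exact: borelT.
by rewrite H_rcons; exact: borelI.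
Qed.

Let H_h u : u != [::] -> H u `<=` h u.
Proof. by case/lastP: u => // u n _; rewrite H_rcons => x [_ []]. Qed.

Let H_disj u v : size u = size v -> H u `&` H v !=set0 -> u = v.
Proof.
elim/last_ind: u v => [|u n IH] v; first by case: v.
case/lastP: v => [|v l]; first by rewrite size_rcons.
rewrite !size_rcons => -[suv] [x []]; rewrite !H_rcons => -[Hu [hn nn]] [Hv [hl nl]].
have e : u = v by apply: IH => //; exists x.
move: nl hl; rewrite -e => nl hl; congr rcons.
apply/eqP; rewrite eqn_leq; apply/andP; split; rewrite leqNgt; apply/negP => lt.
  by apply: nn; exists l.
by apply: nl; exists n.
Qed.

(** The hulls of the children cover the image of [N u], and [h u] is minimal up to null sets. At the
    root [fm] takes the place of minimality. *)
Let H_null u : pr m (H u `\` \bigcup_n h (rcons u n)) = 0.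
Proof.
have bU : borel (\bigcup_n h (rcons u n)) by exact: borel_bigcup.
have sub : f @` N u `<=` \bigcup_n h (rcons u n).
  move=> _ [y uy <-]; exists (y (size u)) => //.
  by have [_ + _ _] := hP (rcons u (y (size u))); apply; exists y => //; rewrite N_rcons.
have [u0|u0] := eqVneq u [::].
  rewrite u0 H_nil setTD prC -u0// fm ?subrr//.
  by apply: subset_trans sub; rewrite u0 N_nil.
have [_ _ _ hu] := hP u.
apply: (@pr_le0 _ _ m _ (h u `\` \bigcup_n h (rcons u n))); [exact: borelD|exact: borelD| |exact: hu].
by move=> x [Hx nx]; split=> //; exact: H_h.
Qed.

Let H_sum u : (fun k => \sum_(0 <= n < k) pr m (H (rcons u n))) @ \oo --> pr m (H u).
Proof.
have -> : pr m (H u) = pr m (\bigcup_n H (rcons u n)).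
  have bU : borel (\bigcup_n H (rcons u n)) by exact: borel_bigcup.
  have sub : \bigcup_n H (rcons u n) `<=` H u by move=> x [n _]; rewrite H_rcons => -[].
  apply/eqP; rewrite eq_sym -subr_eq0 -oppr_eq0 opprB -prD//.
  apply/eqP; rewrite -(H_null u); congr pr; apply/seteqP; split=> x [Hx nx]; split=> // -[n _ hx].
    suff [l [hl nl]] : exists l, h (rcons u l) x /\ forall i, (i < l)%N -> ~ h (rcons u i) x.
      by apply: nx; exists l => //; rewrite H_rcons; split=> //; split=> // -[i /= il /(nl i il)].
    have ex : exists l, `[< h (rcons u l) x >] by exists n; apply/asboolP.
    case: (ex_minnP ex) => l /asboolP hl lmin; exists l; split=> // i il hi.
    by have := lmin i (asboolT hi); rewrite leqNgt il.
  by apply: nx; exists n => //; apply: H_h hx; case: (u).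
apply: pr_bigcup_series; first by move=> n; exact: bH.
apply/trivIsetP => i j _ _ ij; apply/seteqP; split=> // x Hx.
move/eqP: ij; apply.
have : rcons u i = rcons u j by apply: H_disj; [rewrite !size_rcons|exists x].
by move/eqP; rewrite eqseq_rcons => /andP[_ /eqP].
Qed.

(** The lifted measure gives [N u] the mass of [H u]. An open [V] receives no more than [m V], since
    its preimage is exhausted by cylinders whose images have closure in [V]; [Delta_le_open] turns
    the inequality into equality. *)
Lemma lift_measure : exists m' : Delta R Baire, push cf m' = m.
Proof.
have [|||m' hm] := @Baire_measure R (fun u => pr m (H u)).
- by move=> u; exact: pr_ge0.
- by rewrite H_nil prT.
- exact: H_sum.
exists m'; apply: Delta_le_open => // V oV.
rewrite pr_push; last exact: borel_open.
(* Length [k.+1] because [H u] lies in [h u] for nonempty words only. *)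
pose W k := [set u : seq nat | size u = k.+1 /\ closure (f @` N u) `<=` V].
have levN k y : N (mkseq y k.+2) `<=` N (mkseq y k.+1).
  by move=> z; rewrite !N_mkseq => zy i ik; apply: zy; exact: leq_trans ik _.
have cv : pr m' \o (fun k => lev k.+1 (W k)) @ \oo --> pr m' (\bigcup_k lev k.+1 (W k)).
  apply: pr_cvg_up => [k|k y [_ yV]]; first exact: borel_lev.
  split; first by rewrite size_mkseq.
  apply: subset_trans yV; apply: closure_subset; apply: image_subset; exact: levN.
have e : \bigcup_k lev k.+1 (W k) = f @^-1` V.
  apply/seteqP; split=> y.
    move=> [k _ [_ yV]]; apply: yV; apply: subset_closure; exists y => //.
    by rewrite N_mkseq; exact: cyl_refl.
  move=> Vfy; have [cS _ _] := nS.
  have [g [cg g01 gy gV]] := cS (f y) V (open_nbhs_nbhs (conj oV Vfy)).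
  have /nbhs_BaireP[k kU] : nbhs y (f @^-1` [set s | g (f y) / 2 < g s]).
    apply: cf; apply: (cg (f y) [set r | g (f y) / 2 < r]); apply: open_nbhs_nbhs; split; [exact: open_gt|rewrite /=; lra].
  exists k => //; split; first by rewrite size_mkseq.
  have cl : closed [set s | g (f y) / 2 <= g s].
    apply: (@closed_comp _ _ g [set r | g (f y) / 2 <= r]); first by move=> x _; exact: cg.
    exact: closed_ge.
  apply: (@subset_trans _ [set s | g (f y) / 2 <= g s]); last first.
    by move=> s /= gs; apply: gV; apply: lt_le_trans gs; lra.
  rewrite [X in _ `<=` X](closure_id _).1//; apply: closure_subset => _ [z zk <-] /=.
  apply: ltW; apply: kU; move: zk; rewrite N_mkseq => zk i ik; apply: zk; exact: leq_trans ik _.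
rewrite -e -(cvg_lim (@Rhausdorff R) cv); apply: limr_le; first by apply/cvg_ex; eexists; exact: cv.
apply: nearW => k /=.
(* The second conjunct keeps one index per word, for disjointness. *)
pose P i := W k (enumseq i) /\ pickle (enumseq i) = i.
pose F1 i := if `[< P i >] then N (enumseq i) else set0.
pose F2 i := if `[< P i >] then H (enumseq i) else set0.
have bF1 i : borel (F1 i) by rewrite /F1; case: asboolP => _; [exact: borel_N|exact: borel0].
have bF2 i : borel (F2 i) by rewrite /F2; case: asboolP => _; [exact: bH|exact: borel0].
have tF1 : trivIset setT F1.
  apply/trivIsetP => i j _ _ ij; rewrite /F1.
  case: asboolP => [[[si _] pi]|_]; last by rewrite set0I.
  case: asboolP => [[[sj _] pj]|_]; last by rewrite setI0.
  apply/seteqP; split=> // y [yi yj]; move/eqP: ij; apply.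
  by rewrite -pi -pj -yi -yj si sj.
have tF2 : trivIset setT F2.
  apply/trivIsetP => i j _ _ ij; rewrite /F2.
  case: asboolP => [[[si _] pi]|_]; last by rewrite set0I.
  case: asboolP => [[[sj _] pj]|_]; last by rewrite setI0.
  apply/seteqP; split=> // y yij; move/eqP: ij; apply.
  by rewrite -pi -pj; congr pickle; apply: H_disj; [rewrite si sj|exists y].
have c1 := @pr_bigcup_series _ _ m' F1 bF1 tF1.
have c2 := @pr_bigcup_series _ _ m F2 bF2 tF2.
have e1 : lev k.+1 (W k) = \bigcup_i F1 i.
  apply/seteqP; split=> y.
    move=> Wy; have Pi : P (pickle (mkseq y k.+1)) by rewrite /P enumseqK.
    exists (pickle (mkseq y k.+1)) => //; rewrite /F1 asboolT// enumseqK.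
    by rewrite N_mkseq; exact: cyl_refl.
  case=> i _; rewrite /F1; case: asboolP => // -[Wi _] yi.
  by have [si _] := Wi; rewrite /lev /= -si yi.
have le2 : \bigcup_i F2 i `<=` V.
  move=> x [i _]; rewrite /F2; case: asboolP => // -[[si ci] _] Hx; apply: ci.
  by have [_ _ + _] := hP (enumseq i); apply; apply: H_h Hx; rewrite -size_eq0 si.
rewrite e1 -(cvg_lim (@Rhausdorff R) c1).
rewrite (_ : (fun n => \sum_(0 <= i < n) pr m' (F1 i)) = (fun n => \sum_(0 <= i < n) pr m (F2 i))).
  rewrite (cvg_lim (@Rhausdorff R) c2); apply: pr_le => //; [exact: borel_bigcup|exact: borel_open].
apply/funext => n; apply: eq_bigr => i _; rewrite /F1 /F2; case: asboolP => _; first exact: hm.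
by rewrite !pr0.
Qed.

End lift.

(** * Retractions onto closed sets and pairing in Baire space *)

Section retraction.
Context (C : set Baire) (c0 : Baire) (cC : closed C) (Cc0 : C c0).

Let meets u := exists y, C y /\ N u y.

Let meets_next u : meets u -> exists n, meets (rcons u n).
Proof.
by move=> [y [Cy uy]]; exists (y (size u)), y; rewrite N_rcons.
Qed.

Let digit u n := if `[< meets (rcons u n) >] then n else get [set n | meets (rcons u n)].

Let digitP u n : meets u -> meets (rcons u (digit u n)).
Proof.
rewrite /digit; case: asboolP => // _ /meets_next h.
exact: (getPex h).
Qed.

Let w (x : nat -> nat) := fix w k := if k is l.+1 then rcons (w l) (digit (w l) (x l)) else [::].

Let wS x k : w x k.+1 = rcons (w x k) (digit (w x k) (x k)). Proof. by []. Qed.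

Let size_w x k : size (w x k) = k.
Proof. by elim: k => // k IH; rewrite wS size_rcons IH. Qed.

Let meets_w x k : meets (w x k).
Proof.
elim: k => [|k IH]; first by exists c0; rewrite N_nil.
by rewrite wS; exact: digitP.
Qed.

Let r (x : Baire) : Baire := fun k => digit (w x k) (x k).

Let r_w x k : mkseq (r x) k = w x k.
Proof. by elim: k => // k IH; rewrite mkseqS IH. Qed.

(** A digit of [x] after which [C] could no longer be met is replaced by one that keeps [C] within
    reach; points of [C] are left unchanged. *)
Lemma closed_retract : exists r : Baire -> Baire, continuous r /\ range r = C.
Proof.
exists r; split.
  apply: Baire_prefix_continuous => i; exists i.+1 => x y xy.
  suff e k : (k <= i.+1)%N -> w x k = w y k by rewrite /r e// xy.
  elim: k => // k IH ki; rewrite !wS IH ?xy//; exact: ltnW.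
apply/seteqP; split=> [_ [x _ <-]|x Cx].
  rewrite (closure_id C).1// => A /nbhs_BaireP[k kA].
  have [y [Cy]] := meets_w x k; rewrite -r_w N_mkseq => yk.
  by exists y; split=> //; exact: kA.
exists x => //; apply/funext => i.
suff e k : w x k = mkseq x k.
  by rewrite -(@nth_mkseq _ 0%N (r x) i.+1)// r_w e nth_mkseq.
elim: k => // k IH; rewrite wS IH mkseqS /digit asboolT//.
by exists x; split=> //; rewrite -mkseqS N_mkseq; exact: cyl_refl.
Qed.

End retraction.

Definition pair_left (y : Baire) : Baire := fun i => y i.*2.
Definition pair_right (y : Baire) : Baire := fun i => y i.*2.+1.
Definition pair_join (x y : Baire) : Baire := fun i => if odd i then y i./2 else x i./2.

Lemma pair_left_continuous : continuous pair_left.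
Proof. by apply: Baire_prefix_continuous => i; exists i.*2.+1 => x y; exact. Qed.

Lemma pair_right_continuous : continuous pair_right.
Proof. by apply: Baire_prefix_continuous => i; exists i.*2.+2 => x y; exact. Qed.

Lemma pair_join_continuous : continuous (fun p : Baire * Baire => pair_join p.1 p.2).
Proof.
apply: Baire_continuous => p i; rewrite /pair_join /=; case: odd.
  exact: (@continuous_Baire_nbhs _ snd p i./2 (@snd_continuous _ _)).
exact: (@continuous_Baire_nbhs _ fst p i./2 (@fst_continuous _ _)).
Qed.

Lemma pair_joinK1 x y : pair_left (pair_join x y) = x.
Proof. by apply/funext => i; rewrite /pair_left /pair_join odd_double doubleK. Qed.

Lemma pair_joinK2 x y : pair_right (pair_join x y) = y.
Proof. by apply/funext => i; rewrite /pair_right /pair_join /= odd_double uphalf_double. Qed.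

(* [column y n] and [columns] identify Baire with its own countable power. *)
Definition column (y : Baire) (n : nat) : Baire := fun i => y (pickle (n, i)).
Definition columns (x : nat -> Baire) : Baire :=
  fun k => if unpickle k is Some (n, i) then x n i else 0%N.

Lemma columnsK x n : column (columns x) n = x n.
Proof. by apply/funext => i; rewrite /column /columns pickleK. Qed.

Lemma column_continuous n : continuous (column ^~ n).
Proof. by apply: Baire_prefix_continuous => i; exists (pickle (n, i)).+1 => x y; exact. Qed.

(** * Suslin sets and closure properties of [nice] *)

Section suslin.

Lemma suslin_closed_image (S : topologicalType) (f : Baire -> S) C :
  continuous f -> closed C -> C !=set0 -> suslin (f @` C).
Proof.
move=> cf cC [c0 Cc0]; have [r [cr <-]] := closed_retract cC Cc0.
by exists (f \o r); [exact: comp_continuous cr cf|rewrite image_comp].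
Qed.

Lemma suslin_setX (S T : topologicalType) (A : set S) (B : set T) :
  suslin A -> suslin B -> suslin (A `*` B).
Proof.
move=> [f cf <-] [g cg <-]; exists (fun y => (f (pair_left y), g (pair_right y))).
  apply: pair_continuous.
    exact: comp_continuous pair_left_continuous cf.
  exact: comp_continuous pair_right_continuous cg.
apply/seteqP; split=> [_ [y _ <-]|[_ _] [/= [x _ <-] [y _ <-]]].
  by split=> /=; [exists (pair_left y)|exists (pair_right y)].
by exists (pair_join x y) => //; rewrite pair_joinK1 pair_joinK2.
Qed.

Lemma suslin_prod (K : nat -> topologicalType) :
  (forall n, suslin [set: K n]) -> suslin [set: prod_topology K].
Proof.
move=> sA; pose f n : Baire -> K n := s2val (cid2 (sA n)).
have cf n : continuous (f n) by exact: (s2valP (cid2 (sA n))).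
have rf n : range (f n) = setT by exact: (s2valP' (cid2 (sA n))).
exists (fun y n => f n (column y n)).
  by apply: prod_continuous => n; exact: comp_continuous (@column_continuous n) (cf n).
apply/seteqP; split=> // x _.
have ex n : exists y, f n y = x n.
  by have [y _ yx] : range (f n) (x n) by [rewrite rf]; exists y.
exists (columns (fun n => projT1 (cid (ex n)))) => //.
apply: functional_extensionality_dep => n; rewrite columnsK.
exact: (projT2 (cid (ex n))).
Qed.

Lemma suslin_closed (S : topologicalType) (A D : set S) :
  suslin A -> closed D -> A `&` D !=set0 -> suslin (A `&` D).
Proof.
move=> [f cf fA] cD [x0 [Ax0 Dx0]]; have [y _ yx] : range f x0 by rewrite fA.
have -> : A `&` D = f @` (f @^-1` D).
  rewrite -fA; apply/seteqP; split=> [_ [[x _ <-] Dx]|_ [x Dx <-]]; first by exists x.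
  by split=> //; exists x.
apply: suslin_closed_image => //; last by exists y; rewrite /= yx.
by apply: closed_comp => // x _; exact: cf.
Qed.

Lemma closed_eq_continuous (Y S : topologicalType) (f g : Y -> S) : hausdorff_space S ->
  continuous f -> continuous g -> closed [set y | f y = g y].
Proof.
move=> hS cf cg y cy; apply: hS => A B fA gB.
have fA' : nbhs y (f @^-1` A) by exact: (cf y _ fA).
have gB' : nbhs y (g @^-1` B) by exact: (cg y _ gB).
have [z [/= e [zA zB]]] := cy _ (filterI fA' gB').
by exists (f z); split=> //; rewrite e.
Qed.

Lemma closed_bigcap_nat (S : topologicalType) (C : nat -> set S) :
  (forall n, closed (C n)) -> closed (\bigcap_n C n).
Proof. by move=> h; apply: closed_bigI => n _; exact: h. Qed.

(** The intersection is parametrised by the closed set of sequences of parameters, one for each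
    [A n], with a common image. *)
Lemma suslin_bigcap (S : topologicalType) (A : nat -> set S) : hausdorff_space S ->
  (forall n, suslin (A n)) -> \bigcap_n A n !=set0 -> suslin (\bigcap_n A n).
Proof.
move=> hS sA [a ha].
have /choice[f hf] : forall n, exists f : Baire -> S, continuous f /\ range f = A n.
  by move=> n; have [f ? ?] := sA n; exists f.
pose C := \bigcap_n [set y | f n (column y n) = f 0%N (column y 0)].
have cfc n : continuous (fun y => f n (column y n)).
  exact: comp_continuous (@column_continuous n) (hf n).1.
have key x : (\bigcap_n A n) x -> exists2 y, C y & f 0%N (column y 0) = x.
  move=> Ax; have /choice[y hy] : forall n, exists y, f n y = x.
    move=> n; have [y _ yx] : range (f n) x by rewrite (hf n).2; exact: Ax.
    by exists y.
  by exists (columns y); [move=> n _ /=; rewrite !columnsK !hy|rewrite columnsK hy].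
have -> : \bigcap_n A n = (fun y => f 0%N (column y 0)) @` C.
  apply/seteqP; split=> [x /key[y Cy <-]|_ [y Cy <-] n _]; first by exists y.
  by rewrite -(Cy n I) -(hf n).2; exists (column y n).
apply: suslin_closed_image => //; last by have [y] := key a ha; exists y.
by apply: closed_bigcap_nat => n; exact: closed_eq_continuous.
Qed.

Lemma suslin_set_type (S : topologicalType) (A : set S) :
  suslin A -> suslin [set: set_type A].
Proof.
move=> [f cf fA].
have fAy y : A (f y) by rewrite -fA; exists y.
exists (fun y => SigSub (mem_set (fAy y)) : set_type A).
  apply/continuousP => _ [B oB <-].
  have -> : (fun y => SigSub (mem_set (fAy y)) : set_type A) @^-1` (set_val @^-1` B) = f @^-1` B by [].
  by move/continuousP : cf; exact.
apply/seteqP; split=> // -[x xA] _; have [y _ yx] : range f x by rewrite fA; exact: set_mem.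
by exists y => //; apply: val_inj.
Qed.

End suslin.

Section nice_closure.
Context (R : realType).

Lemma nice_pair (S T : topologicalType) : nice R S -> nice R T -> nice R (S * T)%type.
Proof.
move=> [cS tS sS] [cT tT sT]; split; [exact: creg_pair|exact: t1_pair|].
by rewrite -setXTT; exact: suslin_setX.
Qed.

Lemma nice_prod (K : nat -> topologicalType) :
  (forall n, nice R (K n)) -> nice R (prod_topology K).
Proof.
move=> nK; split.
- by apply: creg_prod => n; case: (nK n).
- by apply: t1_prod => n; case: (nK n).
- by apply: suslin_prod => n; case: (nK n).
Qed.

Lemma nice_set_type (S : topologicalType) (A : set S) : nice R S -> suslin A -> nice R (set_type A).
Proof.
move=> [cS tS sS] sA; split.
- exact: (@creg_initial R (set_type A) S set_val).
- by apply: (@t1_initial (set_type A) S set_val) => //; exact: val_inj.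
- exact: suslin_set_type.
Qed.

(** One Baire parameter describes every measure carried by a Suslin set; this is how spaces of
    measures are shown to be Suslin. *)
Lemma suslin_push_range (S : topologicalType) (f : Baire -> S) (cf : continuous f)
    (m : Delta R S) : nice R S -> outer1 m (range f) ->
  exists y, push cf (kappa R y) = m.
Proof.
by move=> nS /(lift_measure nS cf)[m' <-]; exists (coder m'); rewrite coderK.
Qed.

Lemma nice_Delta (S : topologicalType) : nice R S -> nice R (Delta R S).
Proof.
move=> nS; split; [exact: creg_Delta|exact: t1_Delta|].
have [_ _ [f cf fT]] := nS.
exists (fun y => push cf (kappa R y)).
  by apply: (@comp_continuous Baire (Delta R Baire) (Delta R S) (kappa R) (fun m => push cf m)); [exact: kappa_continuous|exact: push_continuous (nice_Baire R)].
apply/seteqP; split=> // m _.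
have [|y <-] := @suslin_push_range S f cf m nS; last by exists y.
by move=> B bB; rewrite fT => /(_ _ I) BT; rewrite (_ : B = setT) ?prT//; apply/seteqP; split=> // x _; exact: BT.
Qed.

End nice_closure.

(** * Polish spaces belong to the class *)

Section polish.
Context (R : realType) (T : topologicalType).

Lemma countable_dense_seq (D : set T) (x0 : T) : countable D -> dense D ->
  exists q : nat -> T, forall U, open U -> U !=set0 -> exists n, U (q n).
Proof.
move=> cD dD; have [d0 [_ Dd0]] : [set: T] `&` D !=set0.
  by apply: dD; [exists x0|exact: openT].
have /countable_injP[f fI] := cD.
exists (fun n => if pselect (exists x, D x /\ f x = n) is left h then projT1 (cid h) else d0).
move=> U oU U0; have [x [Ux Dx]] := dD U U0 oU.
exists (f x); case: pselect => [h|]; last by case; exists x.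
have [Dy fy] := projT2 (cid h).
suff -> : projT1 (cid h) = x by [].
by apply: fI; rewrite ?inE.
Qed.

(** For the Suslin part, [x] lists indices into a dense sequence and jumps that are too long are
    ignored: every [x] yields a Cauchy sequence, with a limit continuous in [x]. The point [x0]
    excludes the empty space. *)
Lemma polish_nice (x0 : T) : polish R T -> nice R T.
Proof.
move=> [[D [cD dD]] [d [[d0 dE dS dT] mT cT]]].
have dxx x : d x x = 0 by apply/dE.
have ballo x e : 0 < e -> nbhs x [set y | d x y < e].
  by move=> e0; apply/mT; exists e.
split.
- move=> x A /mT[e e0 eA].
  exists (fun y => Num.max 0 (1 - d x y / e)); split.
  + move=> y; apply: (@continuous_max R T (fun=> 0) (fun y => 1 - d x y / e) y).
      exact: cst_continuous.
    have c1 : (fun y => d x y / e) z @[z --> y] --> d x y / e.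
      apply: cvgMl; apply/cvgrPdist_lt => a a0; apply: filterS (ballo y a a0) => z /= yz.
      have := dT x y z; have := dT x z y; rewrite [d z y]dS => h1 h2.
      by rewrite ltr_norml; apply/andP; split; lra.
    by apply: cvgB => //; exact: cvg_cst.
  + by move=> y; rewrite le_max lexx/= ge_max ler01/= gerBl divr_ge0// ltW.
  + by rewrite dxx mul0r subr0 lt_max ltr01 orbT.
  + move=> y; rewrite lt_max ltxx/= subr_gt0 ltr_pdivrMr// mul1r => h.
    exact: eA.
- move=> x y h; apply/dE/eqP; rewrite eq_le d0 andbT.
  apply/ler_addgt0Pr => e e0; rewrite add0r.
  by have /= := h _ (ballo x e e0); exact: ltW.
have [q hq] := countable_dense_seq x0 cD dD.
pose a := fix a (x : nat -> nat) k := if k is j.+1 then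
  (if d (a x j) (q (x k)) < 2^-1 ^+ j then q (x k) else a x j) else q (x 0%N).
have aS x k : a x k.+1 = if d (a x k) (q (x k.+1)) < 2^-1 ^+ k then q (x k.+1) else a x k by [].
have h0 k : 0 < 2^-1 ^+ k :> R by rewrite exprn_gt0.
have da x k : d (a x k) (a x k.+1) <= 2^-1 ^+ k.
  by rewrite aS; case: ifPn => [/ltW //|_]; rewrite dxx ltW.
have dak x k j : d (a x k) (a x (j + k)%N) <= 2 * 2^-1 ^+ k - 2 * 2^-1 ^+ (j + k).
  elim: j => [|j IH]; first by rewrite add0n dxx subrr.
  apply: (le_trans (dT _ (a x (j + k)%N) _)); have := da x (j + k)%N.
  rewrite addSn exprS; move: IH; set y := 2^-1 ^+ (j + k); lra.
have dak2 x k j : (k <= j)%N -> d (a x k) (a x j) <= 2 * 2^-1 ^+ k.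
  move=> kj; have := dak x k (j - k)%N; rewrite subnK//.
  by have := h0 j; lra.
have /choice[l hl] : forall x, exists l, forall e, 0 < e -> exists K, forall n, (K <= n)%N -> d (a x n) l < e.
  move=> x; apply: cT => e e0; have [k hk] := half_small (divr_gt0 e0 (ltr0n R 2)).
  exists k => m n km kn; apply: (le_lt_trans (dT _ (a x k) _)).
  rewrite [d _ (a x k)]dS; have := dak2 x k m km; have := dak2 x k n kn; have := hk k (leqnn k); lra.
have dl x k : d (a x k) (l x) <= 2 * 2^-1 ^+ k.
  apply/ler_addgt0Pr => e e0; have [K hK] := hl x e e0.
  have := hK _ (leq_maxl K k); have := dak2 x k _ (leq_maxr K k).
  have := dT (a x k) (a x (maxn K k)) (l x); lra.
have aeq x y k : (forall i, (i <= k)%N -> x i = y i) -> a x k = a y k.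
  elim: k => [|k IH] xy; first by rewrite /a xy.
  by rewrite !aS IH ?xy// => i ik; apply: xy; exact: leq_trans ik (leqnSn k).
exists l.
  move=> x A /mT[e e0 eA]; have [k hk] := half_small (divr_gt0 e0 (ltr0n R 2)).
  apply/nbhs_BaireP; exists k.+1 => y xy /=; apply: eA => /=.
  have axy : a y k = a x k by apply: aeq => i ik; exact: xy.
  apply: (le_lt_trans (dT _ (a x k) _)).
  rewrite [d (l x) _]dS; have := dl x k; have := dl y k; rewrite axy; have := hk k (leqnn k); lra.
apply/seteqP; split=> // t _.
(* Consecutive points are then closer than [2^-1 ^+ k.+2 + 2^-1 ^+ k.+3], so no jump is ignored. *)
have /choice[x hx] : forall k, exists n, d t (q n) < 2^-1 ^+ k.+2.
  move=> k; have := ballo t _ (h0 k.+2); rewrite nbhsE => -[U [oU Ut] UB].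
  have [|n Un] := hq U oU; first by exists t.
  by exists n; exact: UB.
have ax k : a x k = q (x k).
  elim: k => // k IH; rewrite aS IH ifT//.
  apply: (le_lt_trans (dT _ t _)); rewrite [d _ t]dS.
  have := hx k; have := hx k.+1; rewrite !exprS; have := h0 k; set y := 2^-1 ^+ k; lra.
exists x => //; apply/esym/dE/eqP; rewrite eq_le d0 andbT.
apply/ler_addgt0Pr => e e0; rewrite add0r.
have [k hk] := half_small (divr_gt0 e0 (ltr0n R 2)).
apply: (le_trans (dT _ (a x k.+2) _)); have := dl x k.+2; have := hx k.+2; rewrite ax.
have := hk k.+2 (ltnW (leqnSn _)); have := hk k.+4 ltac:(by rewrite !leqW).
have := h0 k.+4; lra.
Qed.

End polish.

(** * From codes to types, and the topology of the type spaces *)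

Section type_map.
Context (R : realType) (X : bool -> topologicalType) (nX : forall i, nice R (X i)).
Context (s : forall i, Baire -> X i) (cs : forall i, continuous (s i)).
Context (K : Baire -> Delta R Baire) (cK : continuous K).

Lemma nice_hier n i : nice R (hier R X n i).
Proof.
elim: n i => [|n IH] i /=; first exact: nX.
by apply: nice_pair => //; exact: nice_Delta.
Qed.

Lemma nice_T0 i : nice R (T0 R X i).
Proof. by apply: nice_prod => n; apply: nice_Delta; exact: nice_hier. Qed.

Lemma push_belief_continuous n i (f : Baire -> hier R X n i) (cf : continuous f) :
  continuous (fun z => push cf (K z)).
Proof.
apply: (@comp_continuous Baire (Delta R Baire) (Delta R (hier R X n i)) K (fun m => push cf m)) => //.
exact: push_continuous (nice_Baire R).
Qed.

(* [z : Baire] codes a strategy [s i z] of player [i] and a belief [K z] about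
   the code of the opponent; [code_hier n i] unfolds the code of the opponent of
   [i] to the [n]-th space of uncertainty of [i]. *)
Fixpoint code_hier n i : {f : Baire -> hier R X n i | continuous f} :=
  match n return {f : Baire -> hier R X n i | continuous f} with
  | 0 => exist (fun f : Baire -> hier R X 0 i => continuous f) (s (~~ i)) (@cs (~~ i))
  | m.+1 => exist (fun f : Baire -> hier R X m.+1 i => continuous f)
      (fun z => (proj1_sig (code_hier m i) z, push (proj2_sig (code_hier m (~~ i))) (K z)))
      (pair_continuous (proj2_sig (code_hier m i))
         (@push_belief_continuous m (~~ i) _ (proj2_sig (code_hier m (~~ i)))))
  end.

Definition code_type i (z : Baire) : T0 R X i := fun n => push (proj2_sig (code_hier n i)) (K z).

Lemma code_type_continuous i : continuous (code_type i).
Proof. by apply: prod_continuous => n; exact: push_belief_continuous. Qed.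

Lemma trunc_code n i z : trunc n (s (~~ i) z, code_type (~~ i) z) = proj1_sig (code_hier n i) z.
Proof. by elim: n => //= n ->. Qed.

Lemma code_pair_continuous i : continuous (fun z => (s i z, code_type i z)).
Proof. by apply: pair_continuous; [exact: cs|exact: code_type_continuous]. Qed.

Lemma is_star_code i z : is_star (code_type i z) (push (@code_pair_continuous (~~ i)) (K z)).
Proof. by move=> n; apply: push_comp => y; exact: trunc_code. Qed.

Lemma is_star_T1 i (d : T0 R X i) m : is_star d m -> T1 d.
Proof.
move=> dm n; rewrite -(dm n.+1) -(dm n).
exact: (@push_comp R _ _ _ (trunc n.+1) fst (trunc n)).
Qed.

Lemma code_Tk k i z : Tk k (code_type i z).
Proof.
elim: k i z => [|k IH] i z /=; first exact: is_star_T1 (is_star_code i z).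
split; first exact: is_star_T1 (is_star_code i z).
exists (push (@code_pair_continuous (~~ i)) (K z)); first exact: is_star_code.
apply: prob1_push; first by apply: (@nice_hausdorff R); apply: nice_pair => //; exact: nice_T0.
by apply: (prob1S _ (prob1T _)) => y _; split=> //=.
Qed.

Lemma code_Tset i z : Tset (code_type i z).
Proof. by move=> k _; exact: code_Tk. Qed.

Definition code_types i (z : Baire) : types R X i := SigSub (mem_set (code_Tset i z)).

Lemma code_types_continuous i : continuous (code_types i).
Proof.
apply/continuousP => _ [B oB <-].
by move/continuousP : (@code_type_continuous i) => /(_ B oB).
Qed.

Lemma code_types_pair_continuous i : continuous (fun z => (s i z, code_types i z)).
Proof. by apply: pair_continuous; [exact: cs|exact: code_types_continuous]. Qed.

Lemma is_lambda_code i z :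
  is_lambda (code_types i z) (push (@code_types_pair_continuous (~~ i)) (K z)).
Proof.
rewrite /is_lambda (@push_comp R _ _ _ _ _ _ _ _ (@code_pair_continuous (~~ i)))//.
exact: is_star_code.
Qed.

(** [T1] is closed. At the next level, membership means being the marginal sequence of a measure
    carried by the product of the opponent's strategies and types of the previous level, and [kappa]
    parametrises these measures. *)
Lemma suslin_Tk k i : suslin (@Tk R X k i).
Proof.
pose z0 : Baire := fun=> 0%N.
elim: k i => [|k IH] i.
  have -> : @Tk R X 0 i = [set: T0 R X i] `&` \bigcap_n [set d : T0 R X i | push (@fst_continuous (hier R X n i)
      (Delta R (hier R X n (~~ i)))) (d n.+1) = d n].
    by rewrite setTI; apply/seteqP; split=> d h n; [move=> _; exact: h|exact: h n I].
  apply: suslin_closed; first by case: (nice_T0 i).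
    apply: closed_bigcap_nat => n; apply: closed_eq_continuous.
    - by apply: (@nice_hausdorff R); apply: nice_Delta; exact: nice_hier.
    - apply: (@comp_continuous (T0 R X i) (Delta R (hier R X n.+1 i)) _ (fun d => d n.+1)).
        exact: (@coord_continuous nat (fun n => (Delta R (hier R X n i) : topologicalType)) n.+1).
      exact: push_continuous (nice_hier n.+1 i).
    - exact: (@coord_continuous nat (fun n => (Delta R (hier R X n i) : topologicalType)) n).
  exists (code_type i z0); split=> // n _.
  by have := @code_Tk 0 i z0; exact.
have nXT : nice R (X (~~ i) * T0 R X (~~ i))%type by apply: nice_pair => //; exact: nice_T0.
have [g cg rg] : suslin ([set: X (~~ i)] `*` @Tk R X k (~~ i)).
  by apply: suslin_setX => //; case: (nX (~~ i)).
exists (fun y => (fun n => push (@trunc_continuous R X i n) (push cg (kappa R y))) : T0 R X i).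
  apply: prod_continuous => n.
  apply: (@comp_continuous Baire (Delta R (X (~~ i) * T0 R X (~~ i))%type) _
    (fun y => push cg (kappa R y)) (fun m => push (@trunc_continuous R X i n) m)).
    apply: (@comp_continuous Baire (Delta R Baire) _ (kappa R) (fun m => push cg m)).
      exact: kappa_continuous.
    exact: push_continuous (nice_Baire R).
  exact: push_continuous.
apply/seteqP; split=> [_ [y _ <-]|d [T1d [m dm m1]]].
  split; first by apply: (@is_star_T1 _ _ (push cg (kappa R y))).
  exists (push cg (kappa R y)) => //.
  apply: prob1_push; first exact: nice_hausdorff nXT.
  by apply: (prob1S _ (prob1T _)) => z _; rewrite -rg; exists z.
have [|y ym] := @suslin_push_range R _ g cg m nXT.
  by rewrite rg; exact: prob1_outer1.
by exists y => //; apply: functional_extensionality_dep => n; rewrite ym dm.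
Qed.

Lemma nice_types i : nice R (types R X i).
Proof.
apply: nice_set_type; first exact: nice_T0.
apply: suslin_bigcap.
- by apply: (@nice_hausdorff R); exact: nice_T0.
- by move=> k; exact: suslin_Tk.
- by exists (code_type i (fun=> 0%N)); exact: code_Tset.
Qed.

(** The truncations generate the topology. The sets satisfying [G] form a filter, because a
    condition on one truncation is also a condition on any longer one, so each coordinate can be
    treated separately. *)
Lemma truncated_nbhs i (p : X (~~ i) * types R X (~~ i)) U : nbhs p U ->
  exists n V, [/\ open V, V (trunc n (incl p)) & (fun q => trunc n (incl q)) @^-1` V `<=` U].
Proof.
pose G A := exists n V, [/\ open V, V (trunc n (incl p)) &
  (fun q : X (~~ i) * types R X (~~ i) => trunc n (incl q)) @^-1` V `<=` A].
have lift_n n V k : open V -> V (trunc n (incl p)) -> exists W, [/\ open W, W (trunc (k + n) (incl p)) &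
   forall q : X (~~ i) * types R X (~~ i), W (trunc (k + n) (incl q)) -> V (trunc n (incl q))].
  move=> oV Vp; elim: k => [|k [W [oW Wp Wq]]]; first by exists V.
  exists (fst @^-1` W); split=> //.
  by move/continuousP : (@fst_continuous (hier R X (k + n) i) (Delta R (hier R X (k + n) (~~ i)))); exact.
have FG : Filter (G : set_system _).
  split.
  - by exists 0%N, setT; split => //; exact: openT.
  - move=> A B [n [V [oV Vp VA]]] [k [W [oW Wp WB]]].
    have [V' [oV' V'p hV']] := lift_n n V k oV Vp.
    have [W' [oW' W'p hW']] := lift_n k W n oW Wp; rewrite addnC in W' oW' W'p hW'.
    exists (k + n)%N, (V' `&` W'); split=> //; first exact: openI.
    by move=> q [/hV' /VA qA /hW' /WB].
  - by move=> A B AB [n [V [oV Vp VA]]]; exists n, V; split=> //; exact: subset_trans AB.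
case=> -[P Q] /= [pP pQ] PQU.
have GP : G (fst @^-1` P).
  by move: pP; rewrite nbhsE => -[V [oV Vp] VP]; exists 0%N, V; split=> // q /VP.
have GQ : G (snd @^-1` Q).
  case: pQ => [_ [[B oB <-] Bp BQ]].
  pose G2 : set_system (T0 R X (~~ i)) :=
    fun A => G (fun q : X (~~ i) * types R X (~~ i) => A (set_val q.2)).
  have FG2 : Filter G2.
    split; first exact: (@filterT _ _ FG).
    - by move=> A C; exact: (@filterI _ _ FG).
    - by move=> A C AsubC; apply: (@filterS _ _ FG) => q; exact: AsubC.
  have : G2 --> (set_val p.2 : T0 R X (~~ i)).
    apply: prod_cvg => n C; rewrite nbhsE => -[V [oV Vp] VC].
    exists n.+1, (snd @^-1` V); split=> //.
      by move/continuousP : (@snd_continuous (hier R X n i) (Delta R (hier R X n (~~ i)))); exact.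
    by move=> q /= /VC.
  have Bn : nbhs (set_val p.2 : T0 R X (~~ i)) B by apply: open_nbhs_nbhs.
  move=> /(_ B Bn); apply: (@filterS _ _ FG) => q; exact: BQ.
by apply: (@filterS _ _ FG _ _ _ (@filterI _ _ FG _ _ GP GQ)) => q [? ?]; exact: PQU.
Qed.

(** The uniqueness half of Kolmogorov extension, on the intersection-stable family of preimages of
    open sets under truncations. *)
Lemma is_lambda_unique i (t : types R X i) l l' : is_lambda t l -> is_lambda t l' -> l = l'.
Proof.
move=> tl tl'.
pose G := [set A | exists n V, open V /\ A = (fun q : X (~~ i) * types R X (~~ i) => trunc n (incl q)) @^-1` V].
have ctr n : continuous (fun q : X (~~ i) * types R X (~~ i) => trunc n (incl q)).
  exact: (comp_continuous (@incl_continuous R X (~~ i)) (@trunc_continuous R X i n)).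
have lift_n n (V : set (hier R X n i)) k : open V -> exists W, open W /\
   (fun q : X (~~ i) * types R X (~~ i) => trunc n (incl q)) @^-1` V =
   (fun q : X (~~ i) * types R X (~~ i) => trunc (k + n) (incl q)) @^-1` W.
  move=> oV; elim: k => [|k [W [oW e]]]; first by exists V.
  exists (fst @^-1` W); split=> //.
  by move/continuousP : (@fst_continuous (hier R X (k + n) i) (Delta R (hier R X (k + n) (~~ i)))); exact.
apply: (@Delta_eq_setI R _ G).
- move=> U oU.
  (* The largest open set of level [n] with preimage inside [U]: with one such set per level, [U] is
     a countable union of generators. *)
  pose Vn n := \bigcup_(V in [set V | open V /\ (fun q => trunc n (incl q)) @^-1` V `<=` U]) V.
  have -> : U = \bigcup_n (fun q => trunc n (incl q)) @^-1` (Vn n).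
    apply/seteqP; split=> p.
      move=> Up; have [n [V [oV Vp VU]]] := truncated_nbhs (open_nbhs_nbhs (conj oU Up)).
      by exists n => //; exists V.
    by case=> n _ [V [oV VU] /VU].
  apply: sigma_algebra_bigcup => n; apply: sub_sigma_algebra.
  by exists n, (Vn n); split=> //; apply: bigcup_open => V [].
- move=> _ [n [V [oV ->]]]; apply: borel_preimage; first exact: ctr.
  exact: borel_open.
- move=> _ _ [n [V [oV ->]]] [k [W [oW ->]]].
  have [V' [oV' ->]] := lift_n n V k oV; have [W' [oW' ->]] := lift_n k W n oW.
  rewrite addnC in W' oW' *; rewrite -preimage_setI.
  by exists (k + n)%N, (V' `&` W'); split=> //; exact: openI.
- by exists 0%N, setT; split; [exact: openT|rewrite preimage_setT].
- move=> _ [n [V [oV ->]]].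
  have bV := borel_open oV.
  have := tl n; rewrite -(tl' n) => /(congr1 (fun m => pr m V)).
  rewrite !pr_push//; apply: borel_preimage => //; exact: trunc_continuous.
Qed.

End type_map.

(** * RCBR is justified; codes of iterated belief land in RCBR *)

Section rcbr.
Context (R : realType) (X : bool -> topologicalType) (nX : forall i, nice R (X i)).
Context (E : forall i, set (X i * Delta R (X (~~ i)))%type).

Lemma nice_param : exists s : forall i, Baire -> X i,
  (forall i, continuous (s i)) /\ forall i, range (s i) = setT.
Proof.
have sX i : suslin [set: X i] by case: (nX i).
exists (fun i => s2val (cid2 (sX i))); split=> i.
  exact: (s2valP (cid2 (sX i))).
exact: (s2valP' (cid2 (sX i))).
Qed.

Lemma RCBRi_justified : justified E (RCBRi E).
Proof.
move=> i x [t Ht].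
have [s [cs _]] := nice_param.
have nT := nice_types nX cs (@kappa_continuous R).
have [l0 tl0 El0] := Ht 0%N.
exists (push (@fst_continuous (X (~~ i)) (types R X (~~ i))) l0) => //.
(* Each level of [RB] comes with its own extension of [t]; uniqueness makes [l0] serve for all of
   them. *)
have all_n n : prob1 l0 (@RB R X E n (~~ i)).
  have [_ [l tl l1]] := Ht n.+1.
  by rewrite (is_lambda_unique tl0 tl).
have nXT : nice R (X (~~ i) * types R X (~~ i))%type by exact: nice_pair.
have [_ _ [g cg gT]] := nXT.
have [|y yl] := @suslin_push_range R _ g cg l0 nXT.
  by move=> B bB; rewrite gT => h; rewrite (_ : B = setT) ?prT//; apply/seteqP; split=> // z _; exact: h.
have cfg : continuous (fun z => (g z).1) by exact: (comp_continuous cg (@fst_continuous _ _)).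
rewrite -yl (@push_comp R _ _ _ _ _ _ _ _ cfg)//.
apply: prob1_push; first exact: nice_hausdorff (nX (~~ i)).
apply: (@prob1S _ _ _ (g @^-1` \bigcap_n @RB R X E n (~~ i))).
  by move=> z hz; exists (g z).2 => n; have := hz n I; rewrite -surjective_pairing.
apply: (@prob1_preimage R _ _ g cg); rewrite yl.
exact: prob1_bigcap.
Qed.

Lemma RCBR_sub_RAT : RCBR E `<=` RAT E.
Proof. by move=> p hp i; exists (RCBRi E); [exact: RCBRi_justified|exists p]. Qed.

Context (s : forall i, Baire -> X i) (cs : forall i, continuous (s i)).
Context (K : Baire -> Delta R Baire) (cK : continuous K).
Context (A : bool -> set Baire)
  (AE : forall i z, A i z -> E (s i z, push (@cs (~~ i)) (K z))).

Fixpoint common_belief n i : set Baire :=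
  if n is m.+1 then A i `&` [set z | prob1 (K z) (common_belief m (~~ i))] else setT.

Lemma common_beliefS n i : common_belief n.+1 i `<=` common_belief n i.
Proof.
elim: n i => [|n IH] i z //= [Az h]; split=> //.
by apply: prob1S h; exact: IH.
Qed.

Lemma common_belief_RB n i z :
  common_belief n.+1 i z -> RB E n i (s i z, code_types nX cs cK i z).
Proof.
elim: n i z => [|n IH] i z.
  move=> [Az _]; exists (push (@code_types_pair_continuous R X nX s cs K cK (~~ i)) (K z)).
    exact: is_lambda_code.
  rewrite (@push_comp R _ _ _ _ _ _ _ _ (@cs (~~ i)))//.
  exact: AE.
move=> h; split; first by apply: IH; exact: common_beliefS.
exists (push (@code_types_pair_continuous R X nX s cs K cK (~~ i)) (K z)).
  exact: is_lambda_code.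
case: h => _ h; apply: prob1_push.
  by apply: (@nice_hausdorff R); apply: nice_pair => //; exact: (nice_types nX cs cK).
apply: prob1S h => y; exact: IH.
Qed.

Lemma common_belief_RCBRi i z : (forall n, common_belief n i z) -> RCBRi E (s i z).
Proof. by move=> h; exists (code_types nX cs cK i z) => n; apply: common_belief_RB. Qed.

End rcbr.

(* Player II's moves against the moves [v] of player I, for the strategy coded
   by [tau]; [play_prefix tau v n] is the position after [n] rounds. *)
Fixpoint play_prefix (tau v : nat -> nat) n : seq nat :=
  if n is k.+1 then
    let u := rcons (play_prefix tau v k) (v k) in rcons u (tau (pickle u))
  else [::].

Definition response (tau v : nat -> nat) : Baire :=
  fun k => tau (pickle (rcons (play_prefix tau v k) (v k))).

Lemma mkseq_interleave (a b : Baire) n (T : nat -> seq nat) : T 0%N = [::] ->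
  (forall k, T k.+1 = rcons (rcons (T k) (a k)) (b k)) -> mkseq (pair_join a b) n.*2 = T n.
Proof.
move=> T0 TS; elim: n => [|n IH]; first by rewrite T0.
rewrite doubleS !mkseqS IH TS /pair_join /= odd_double /= doubleK.
by rewrite uphalf_double.
Qed.

Lemma response_followsII (s : strategy) (v : Baire) :
  followsII s (pair_join v (response (fun n => s (enumseq n)) v)).
Proof.
move=> n; set b := response _ _.
have := @mkseq_interleave v b n (play_prefix (fun n => s (enumseq n)) v) erefl (fun k => erefl).
rewrite mkseqS => ->; rewrite /pair_join /= odd_double /= uphalf_double doubleK.
by rewrite /b /response enumseqK.
Qed.

Lemma play_prefix_eq tau v v' n : (forall i, (i < n)%N -> v i = v' i) ->
  play_prefix tau v n = play_prefix tau v' n.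
Proof.
elim: n => //= n IH h; rewrite IH ?h// => i ik; apply: h; exact: leq_trans ik (leqnSn n).
Qed.

Lemma response_eq tau v v' k : (forall i, (i <= k)%N -> v i = v' i) ->
  response tau v k = response tau v' k.
Proof. by move=> h; rewrite /response h// (@play_prefix_eq _ v v' k (fun i ik => h i (ltnW ik))). Qed.

Lemma response_continuous (v : Baire) : continuous (fun tau : Baire => response tau v).
Proof.
apply: Baire_continuous => tau k.
suff nb n : nbhs tau [set tau' : Baire | play_prefix tau' v n = play_prefix tau v n].
  apply: filterS (filterI (nb k) (nbhs_coord tau (pickle (rcons (play_prefix tau v k) (v k))))).
  by move=> tau' [/= e1 e2] /=; rewrite /response e1 e2.
elim: n => [|n IH]; first by apply: filterS filterT.
apply: filterS (filterI IH (nbhs_coord tau (pickle (rcons (play_prefix tau v n) (v n))))).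
by move=> tau' [/= e1 e2]; rewrite e1 e2.
Qed.

Lemma prob1_push_image (R : realType) (f : Baire -> Baire) (cf : continuous f)
    (m : Delta R Baire) C : prob1 m (f @^-1` C) -> prob1 (push cf m) C.
Proof. by apply: prob1_push; exact: nice_hausdorff (nice_Baire R). Qed.

Definition move_fst (v : Baire) : Baire := fun k => (odflt (0%N, 0%N) (unpickle (v k))).1.
Definition move_snd (v : Baire) : Baire := fun k => (odflt (0%N, 0%N) (unpickle (v k))).2.

Lemma move_fst_continuous : continuous move_fst.
Proof.
by apply: Baire_prefix_continuous => i; exists i.+1 => x y xy; rewrite /move_fst (xy i (leqnn _)).
Qed.

Lemma move_snd_continuous : continuous move_snd.
Proof.
by apply: Baire_prefix_continuous => i; exists i.+1 => x y xy; rewrite /move_snd (xy i (leqnn _)).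
Qed.

(** * The comparison game *)

Section comparison_game.
Context (R : realType) (X : bool -> topologicalType) (nX : forall i, nice R (X i)).
Context (E : forall i, set (X i * Delta R (X (~~ i)))%type).
Context (F : forall i, set ((X i * Delta R (X (~~ i))) * Baire)%type).
Context (EF : forall i, @E i = fst @` @F i).
Context (s : forall i, Baire -> X i) (cs : forall i, continuous (s i))
  (sT : forall i, range (s i) = setT).

(* A code [z] interleaves a code of a strategy with a sequence of moves, and a
   move packs a digit of a witness for [E] and a digit of a belief. *)
Definition strat i (z : Baire) : X i := s i (pair_left z).

Lemma strat_continuous i : continuous (strat i).
Proof. exact: comp_continuous pair_left_continuous (@cs i). Qed.

Definition bel (z : Baire) : Delta R Baire := kappa R (move_snd (pair_right z)).

Lemma bel_continuous : continuous bel.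
Proof.
have c : continuous (fun z => move_snd (pair_right z)).
  exact: comp_continuous pair_right_continuous move_snd_continuous.
exact: (@comp_continuous Baire Baire _ _ (kappa R) c (@kappa_continuous R)).
Qed.

Definition rational i : set Baire :=
  [set z | F ((strat i z, push (@strat_continuous (~~ i)) (bel z)), move_fst (pair_right z))].

(** The interface shared by both cases of the theorem, which differ in the sets [O k], in the source
    of determinacy [det] and in the selection principle [unif]. *)
Context (O : nat -> forall i : bool, set Baire).
Context (O0 : forall i z, O 0 i z) (OS : forall k i, O k.+1 i `<=` O k i)
  (Obel : forall k i z, rational i z -> prob1 (bel z) (O k (~~ i)) -> O k.+1 i z)
  (ORCBR : forall i z, (forall k, O k i z) -> RCBRi E (strat i z)).

(* Player I builds a code over [xi] and player II one over [xi']; player I wins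
   when the code of player II is refuted strictly before that of player I. *)
Definition compare i (xi xi' : Baire) : set Baire := [set x |
  exists k, ~ O k (~~ i) (pair_join xi' (pair_right x)) /\ O k i (pair_join xi (pair_left x))].

(** The left half of [p] is a strategy of the opponent, the right half the table of a strategy of
    player II that wins the comparison against it. *)
Definition winningII i xi : set Baire := [set p | forall v k,
  O k i (pair_join xi v) -> O k (~~ i) (pair_join (pair_left p) (response (pair_right p) v))].

Context (det : forall i xi xi', determined (compare i xi xi')).
(** A weak selection principle: [f x] may vary while [pair_left (f x)] is fixed, and outer measure
    one is what [lift_measure] requires. *)
Context (unif : forall i xi (nu : Delta R Baire), prob1 nu (pair_left @` winningII i xi) ->
  exists f : Baire -> Baire, [/\ continuous f, range f `<=` winningII i xi &
    outer1 nu (range (fun x => pair_left (f x)))]).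

Let O_mono k l i : (k <= l)%N -> O l i `<=` O k i.
Proof.
elim: l => [|l IH]; first by rewrite leqn0 => /eqP ->.
rewrite leq_eqVlt => /orP[/eqP -> //|]; rewrite ltnS => /IH h.
by apply: subset_trans h; exact: OS.
Qed.

Let doomed i xi := forall v, exists k, ~ O k i (pair_join xi v).

Section diagonal.
Context (i : bool) (xi : Baire) (f : Baire -> Baire) (cf : continuous f) (m : Delta R Baire).
Context (w : Baire).

Let g (v : Baire) (x : Baire) : Baire :=
  pair_join (pair_left (f x)) (response (pair_right (f x)) v).

Lemma diagonal_map_continuous v : continuous (g v).
Proof.
have c1 : continuous (fun x => pair_left (f x)) by exact: comp_continuous cf pair_left_continuous.
have c2 : continuous (fun x => response (pair_right (f x)) v).
  apply: (@comp_continuous Baire Baire Baire f (fun p => response (pair_right p) v) cf).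
  exact: (@comp_continuous Baire Baire Baire pair_right (fun t => response t v)
    pair_right_continuous (@response_continuous v)).
exact: (@comp_continuous Baire (Baire * Baire)%type Baire _ (fun p => pair_join p.1 p.2)
  (pair_continuous c1 c2) pair_join_continuous).
Qed.

(* Player I plays against the family [f] of strategies of player II so as to
   believe in the distribution of their answers: the [k]-th digit of a belief
   only depends on the [k] first digits of these answers. *)
Lemma diagonal_play : exists v : Baire, move_fst v = w /\
  kappa R (move_snd v) = push (@diagonal_map_continuous v) m.
Proof.
(* After the position [u], the next digit codes the law of the answers to [u] continued by zeros. *)
pose next u := pickle (w (size u), coder (push (@diagonal_map_continuous (nth 0%N u)) m) (size u)).
pose V := fix V k := if k is l.+1 then rcons (V l) (next (V l)) else [::] : seq nat.
have VS k : V k.+1 = rcons (V k) (next (V k)) by [].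
have szV k : size (V k) = k by elim: k => // k IH; rewrite VS size_rcons IH.
pose v : Baire := fun k => next (V k).
have Vv k : V k = mkseq v k by elim: k => // k IH; rewrite mkseqS VS IH /v IH.
(* Digit [j < k] of an answering code involves answers up to index [j./2], hence moves of [v] before
   [k]; the continuation by zeros is invisible there. *)
have gE k x : mkseq (g (nth 0%N (V k)) x) k = mkseq (g v x) k.
  apply: (@eq_from_nth _ 0%N); rewrite !size_mkseq// => j jk.
  rewrite !nth_mkseq// /g /pair_join; case: odd => //; apply: response_eq => l lj.
  rewrite Vv nth_mkseq//; apply: (leq_ltn_trans lj); apply: (leq_ltn_trans _ jk).
  by rewrite -{2}(odd_double_half j) -addnn addnA leq_addl.
have vE k : v k = pickle (w k, coder (push (@diagonal_map_continuous v) m) k).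
  rewrite /v /next szV; congr (pickle (_, _)); apply: coder_local => S.
  rewrite !pr_push; [|exact: borel_lev|exact: borel_lev].
  by congr pr; apply/seteqP; split=> x; rewrite /lev /= gE.
exists v; split.
  by apply/funext => k; rewrite /move_fst vE pickleK.
rewrite -[RHS]coderK; congr kappa; apply/funext => k.
by rewrite /move_snd vE pickleK.
Qed.

End diagonal.

Let winI i xi xi' := exists t : strategy, forall x : Baire, followsI t x -> compare i xi xi' x.

Lemma comparison_step (B : forall i, set (X i)) i xi : justified E B -> B i (s i xi) ->
  doomed i xi -> exists xi', B (~~ i) (s (~~ i) xi') /\ winI i xi xi'.
Proof.
move=> jB Bxi dxi; apply: contrapT => nwin.
have [mu Emu muB] := jB i _ Bxi.
have [[[x mu'] w] Fw [/= ex emu]] : (fst @` @F i) (s i xi, mu) by rewrite -EF.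
rewrite ex emu in Fw.
have [|nu' nuE] := @lift_measure R _ (nX (~~ i)) (s (~~ i)) (@cs (~~ i)) mu.
  move=> D bD; rewrite sT => h; rewrite (_ : D = setT) ?prT//.
  by apply/seteqP; split=> // z _; exact: h.
have nuW : prob1 nu' (pair_left @` winningII i xi).
  rewrite -nuE in muB; apply: prob1S (prob1_preimage muB) => xi' Bxi'.
  have [win|[t ht]] := det i xi xi'; first by exfalso; apply: nwin; exists xi'.
  exists (pair_join xi' (fun n => t (enumseq n))); last exact: pair_joinK1.
  move=> v k Ov; rewrite pair_joinK1 pair_joinK2.
  apply: contrapT => nO; apply: (ht _ (response_followsII t v)).
  by exists k; rewrite pair_joinK1 pair_joinK2.
have [f [cf fW nuf]] := unif nuW.
have cpf : continuous (fun x => pair_left (f x)) by exact: comp_continuous cf pair_left_continuous.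
have [m mE] := @lift_measure R _ (nice_Baire R) _ cpf nu' nuf.
have [v [vw vm]] := diagonal_play cf m w.
set z := pair_join xi v.
have belz : bel z = push (diagonal_map_continuous cf (v := v)) m by rewrite /bel pair_joinK2.
have ratz : rational i z.
  rewrite /rational /= /strat pair_joinK1 pair_joinK2 vw.
  suff -> : push (@strat_continuous (~~ i)) (bel z) = mu by [].
  have cc : continuous (fun x => s (~~ i) (pair_left (f x))).
    exact: (@comp_continuous Baire Baire _ _ (s (~~ i)) cpf (@cs (~~ i))).
  rewrite belz (@push_comp R _ _ _ _ _ _ _ _ cc); last by move=> y; rewrite /strat pair_joinK1.
  by rewrite -nuE -mE (@push_comp R _ _ _ _ _ _ _ _ cc).
(* The circle closes here: if [z] is in [O k], the winning answers to [v] are in [O k] for the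
   opponent; [bel z] is the law of exactly these answers, and [Obel] puts [z] in [O k.+1]. *)
have Oz k : O k i z.
  elim: k => [|k IH]; first exact: O0.
  apply: Obel => //; rewrite belz; apply: prob1_push_image.
  apply: prob1S (prob1T m) => y _.
  by have := fW (f y) (ex_intro2 _ _ y I erefl) v k IH.
by have [k] := dxi v; apply; exact: Oz.
Qed.

Lemma comparison_chain (B : forall i, set (X i)) i xi : justified E B -> B i (s i xi) ->
  doomed i xi -> exists c : nat -> bool * Baire,
    c 0%N = (i, xi) /\ forall n, (c n.+1).1 = ~~ (c n).1 /\ winI (c n).1 (c n).2 (c n.+1).2.
Proof.
move=> jB Bxi dxi.
pose good (p : bool * Baire) := B p.1 (s p.1 p.2) /\ doomed p.1 p.2.
have next (p : {p | good p}) : exists q : {p | good p},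
    (sval q).1 = ~~ (sval p).1 /\ winI (sval p).1 (sval p).2 (sval q).2.
  case: p => -[j zeta] [/= Bz dz]; have [zeta' [Bz' win]] := comparison_step jB Bz dz.
  have gq : good (~~ j, zeta').
    (* Any continuation [v] of [zeta'] can be played by player II against the winning strategy [t];
       the payoff then says that the resulting code is refuted. *)
    split=> // v; have [t ht] := win.
    have [x [tx xv]] : exists x : Baire, followsI t x /\ pair_right x = v.
      pose T := fix T n := if n is k.+1 then rcons (rcons (T k) (t (T k))) (v k) else [::] : seq nat.
      exists (pair_join (fun k => t (T k)) v); split; last exact: pair_joinK2.
      move=> n; rewrite (@mkseq_interleave _ _ n T erefl (fun k => erefl)).
      by rewrite /pair_join odd_double doubleK.
    by have [k [nO _]] := ht x tx; exists k; rewrite -xv.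
  by exists (exist _ _ gq).
have [nx hnx] := choice next.
have g0 : good (i, xi) by [].
exists (fun n => sval (iter n nx (exist _ _ g0))); split=> // n.
by rewrite iterS; exact: hnx.
Qed.

(* The strategies of player I along a chain are played against each other, the
   moves of each being the answers needed by the previous one. *)
Lemma comparison_game i (B : forall i, set (X i)) : justified E B -> B i `<=` RCBRi E (i := i).
Proof.
move=> jB x Bx; apply: contrapT => nx.
have [xi _ xix] : range (s i) x by rewrite sT.
have dxi : doomed i xi.
  move=> v; apply: contrapT => nO; apply: nx; rewrite -xix.
  rewrite (_ : s i xi = strat i (pair_join xi v)); last by rewrite /strat pair_joinK1.
  by apply: ORCBR => k; apply: contrapT => nOk; apply: nO; exists k.
have [|c [c0 hc]] := @comparison_chain B i xi jB _ dxi; first by rewrite xix.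
have /choice[t ht] : forall n, exists t : strategy, forall x : Baire, followsI t x ->
    compare (c n).1 (c n).2 (c n.+1).2 x by move=> n; case: (hc n).
(* [T k n] is the position of the [n]-th game after [k] rounds. The reply of player II there is the
   move of player I in game [n + 1], computed from the position before the round, so recursion on
   rounds defines all games simultaneously. *)
pose T := fix T k n := if k is l.+1 then
  rcons (rcons (T l n) (t n (T l n))) (t n.+1 (T l n.+1)) else [::] : seq nat.
pose a n : Baire := fun k => t n (T k n).
have fol n : followsI (t n) (pair_join (a n) (a n.+1)).
  move=> k; rewrite (@mkseq_interleave _ _ k (T ^~ n) erefl (fun k => erefl)).
  by rewrite /pair_join odd_double doubleK.
(* If the code of stage [n] failed [O k], the win in game [n] would give an [l] at which it survives
   and the next code fails. Monotonicity forces [l < k], against the induction hypothesis at stage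
   [n + 1]. *)
have desc k n : O k (c n).1 (pair_join (c n).2 (a n)).
  elim/ltn_ind: k n => k IH n; apply: contrapT => nO.
  have [l [nOl Ol]] := ht n _ (fol n); rewrite pair_joinK1 pair_joinK2 -(hc n).1 in nOl Ol.
  have lk : (l < k)%N by rewrite ltnNge; apply/negP => kl; apply: nO; exact: O_mono kl _ Ol.
  exact: nOl (IH l lk n.+1).
have [k] := dxi (a 0%N); have := desc k 0%N; rewrite c0 /=.
by move=> h; apply.
Qed.

End comparison_game.

(** * Open determinacy (Gale-Stewart) *)

Section gale_stewart.
Context (A : set Baire).

(** Well-founded wins of player I; the induction replaces ordinal ranks. From a position outside
    [won], player II can stay outside forever, which avoids an open [A]. *)
Inductive won : seq nat -> Prop :=
| won_now u : N u `<=` A -> won u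
| won_I u a : ~~ odd (size u) -> won (rcons u a) -> won u
| won_II u : odd (size u) -> (forall b, won (rcons u b)) -> won u.

Lemma won_strategy u : won u -> exists t : strategy, forall x : Baire, N u x ->
  (forall k, (size u <= k.*2)%N -> x k.*2 = t (mkseq x k.*2)) -> A x.
Proof.
elim=> {u} [u uA|u a ou _ [t ht]|u ou _ IH]; first by exists (fun=> 0%N) => x /uA.
  exists (fun v => if v == u then a else t v) => x ux fx.
  have uE : (size u) = (size u)./2.*2 by rewrite -[LHS]odd_double_half (negPf ou).
  have xa : x (size u) = a.
    by rewrite uE fx -uE// ux eqxx.
  apply: ht; first by rewrite N_rcons.
  rewrite size_rcons => k uk; rewrite fx ?(ltnW uk)// ifN//.
  by apply: contraTneq uk => <-; rewrite size_mkseq ltnn.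
have [t ht] := choice IH.
exists (fun v => t (nth 0%N v (size u)) v) => x ux fx.
apply: (ht (x (size u))); first by rewrite N_rcons.
by rewrite size_rcons => k uk; rewrite fx ?(ltnW uk)// nth_mkseq.
Qed.

Lemma open_determined : open A -> determined A.
Proof.
move=> oA; have [/won_strategy[t ht]|nw] := pselect (won [::]).
  by left; exists t => x fx; apply: ht; [rewrite N_nil|move=> k _; exact: fx].
right.
have /choice[t ht] : forall u, exists b, odd (size u) -> ~ won u -> ~ won (rcons u b).
  move=> u; have [h|h] := pselect (exists b, ~ won (rcons u b)); first by case: h => b hb; exists b.
  exists 0%N => ou nu; exfalso; apply: nu; apply: won_II => // b.
  by apply: contrapT => nb; apply: h; exists b.
exists t => x fx Ax.
have nwx n : ~ won (mkseq x n).
  elim: n => [//|n IH]; rewrite mkseqS; have [on|en] := boolP (odd n).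
    have nE : n = n./2.*2.+1 by rewrite -[LHS]odd_double_half on.
    by rewrite {2}nE fx -nE; apply: ht; rewrite ?size_mkseq.
  by move=> w; apply: IH; apply: won_I w; rewrite size_mkseq.
have /nbhs_BaireP[k kA] : nbhs x A by exact: open_nbhs_nbhs.
by apply: (nwx k); apply: won_now; rewrite N_mkseq.
Qed.

End gale_stewart.

Lemma closed_prob1 (R : realType) (S : topologicalType) (K : Baire -> Delta R S) (C : set S) :
  nice R S -> continuous K -> closed C -> closed [set z | prob1 (K z) C].
Proof.
move=> nS cK cC z clz; have bC := borel_closed cC.
apply/prob1_borel => //; apply: contrapT => ne.
have gt : 0 < pr (K z) (~` C).
  by rewrite prC// subr_gt0 lt_neqAle pr_le1// andbT; apply/eqP.
have nb : nbhs z [set y | 0 < pr (K y) (~` C)].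
  exact: (cK z _ (near_pr_open nS (closed_openC cC) gt)).
have [y [/= /(prob1_borel _ bC) y1]] := clz _ nb.
by rewrite prC// y1 subrr ltxx.
Qed.

(** * Case (a): analytic relations *)

Section closed_case.
Context (R : realType) (X : bool -> topologicalType) (nX : forall i, nice R (X i)).
Context (E : forall i, set (X i * Delta R (X (~~ i)))%type).
Context (F : forall i, set ((X i * Delta R (X (~~ i))) * Baire)%type).
Context (EF : forall i, @E i = fst @` @F i).

Lemma rational_preimage_continuous (s : forall i, Baire -> X i)
    (cs : forall i, continuous (s i)) i : continuous (fun z =>
  ((strat s i z, push (@strat_continuous X s cs (~~ i)) (bel R z)), move_fst (pair_right z))).
Proof.
apply: pair_continuous; last exact: comp_continuous pair_right_continuous move_fst_continuous.
apply: pair_continuous; first exact: strat_continuous.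
apply: (@comp_continuous Baire (Delta R Baire) _ (bel R)
  (fun m => push (@strat_continuous X s cs (~~ i)) m)); first exact: bel_continuous.
exact: push_continuous (nice_Baire R).
Qed.

Lemma RAT_sub_RCBR_closed : (forall i, closed (@F i)) -> RAT E `<=` RCBR E.
Proof.
move=> cF p hp i; have [B jB [q qB <-]] := hp i.
have [s [cs sT]] := nice_param nX.
pose A j := rational F cs j.
have cA j : closed (A j).
  apply: (@closed_comp _ _ _ (@F j) _ (@cF j)) => z _.
  exact: (@rational_preimage_continuous s cs j z).
(* A clopen version of iterated belief: [z] is judged by its first [k] digits, which must extend to
   a rational code [a] that believes in the previous approximation. *)
pose O := fix O k (j : bool) : set Baire := if k is l.+1 then
  [set z | exists a, [/\ A j a, cyl z k a & prob1 (bel R a) (O l (~~ j))]] else setT.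
have OE k j z : O k.+1 j z <-> exists a, [/\ A j a, cyl z k.+1 a & prob1 (bel R a) (O k (~~ j))] by [].
have OS k j : O k.+1 j `<=` O k j.
  elim: k j => [//|k IH] j z /OE[a [Aa za Oa]]; apply/OE; exists a; split=> //.
    by move=> l lk; apply: za; exact: leq_trans lk (leqnSn _).
  by apply: prob1S Oa; exact: IH.
have clO k j : clopen (O k j).
  apply: (@clopen_prefix _ k) => x y; case: k => [//|k] xy /OE[a [Aa xa Oa]].
  apply/OE; exists a; split=> // l lk; by rewrite xa// xy.
have AE j z : A j z -> E (strat s j z, push (@strat_continuous X s cs (~~ j)) (bel R z)).
  by move=> Az; rewrite EF; eexists; [exact: Az|].
have Obel k j z : A j z -> prob1 (bel R z) (O k (~~ j)) -> O k.+1 j z.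
  by move=> Az Oz; apply/OE; exists z; split.
(* The codes [a] attached to growing prefixes of [z] converge to [z]. Both [A j] and belief in a
   clopen set are closed conditions, so [z] inherits them. *)
have Oall j z : (forall k, O k j z) -> A j z /\ forall k, prob1 (bel R z) (O k (~~ j)).
  move=> Oz; split.
    rewrite (closure_id (A j)).1// => V /nbhs_BaireP[k kV].
    have /OE[a [Aa za _]] := Oz k.+1; exists a; split=> //; apply: kV => l lk.
    by apply: za; exact: leq_trans lk (leqnSn _).
  move=> k; have cC : closed [set y | prob1 (bel R y) (O k (~~ j))].
    by apply: closed_prob1; [exact: nice_Baire|exact: bel_continuous|case: (clO k (~~ j))].
  suff : closure [set y | prob1 (bel R y) (O k (~~ j))] z by move=> /cC.
  move=> V /nbhs_BaireP[l lV].
  (* This index gives agreement with [z] on at least [l] digits together with belief in [O (l + k)],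
     which is contained in [O k]. *)
  have /OE[a [Aa za Oa]] := Oz (l + k).+1; exists a; split.
    apply: prob1S Oa; elim: (l) => // n IH; exact: subset_trans (@OS _ _) IH.
  by apply: lV => n nl; apply: za; rewrite ltnS; exact: leq_trans (ltnW nl) (leq_addr _ _).
have Obelief n j z : (forall k, O k j z) -> common_belief (bel R) A n j z.
  elim: n j z => [//|n IH] j z /Oall[Az Oz]; split=> //=.
  by apply: prob1S (prob1_bigcap Oz) => y hy; apply: IH => k; exact: hy.
apply: (@comparison_game R X nX E F EF s cs sT O _ _ _ _ _ _ i B jB) => //.
- move=> j z Oz; apply: (@common_belief_RCBRi R X nX E _ (@strat_continuous X s cs) (bel R) (@bel_continuous R) A AE).
  by move=> n; exact: Obelief.
- move=> j xi xi'; apply: open_determined.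
  have c1 (x : Baire) (h : Baire -> Baire) : continuous h -> continuous (fun y => pair_join x (h y)).
    move=> ch; apply: (@comp_continuous Baire (Baire * Baire)%type Baire (fun y => (x, h y)) (fun p => pair_join p.1 p.2));
      last exact: pair_join_continuous.
    by apply: pair_continuous => //; exact: cst_continuous.
  rewrite (_ : compare _ _ _ _ = \bigcup_k (((fun x => pair_join xi' (pair_right x)) @^-1` ~` O k (~~ j)) `&`
      ((fun x => pair_join xi (pair_left x)) @^-1` O k j))); last first.
    by apply/seteqP; split=> x; [case=> k h; exists k|case=> k _ h; exists k].
  apply: bigcup_open => k _; apply: openI.
    have /continuousP := c1 xi' _ pair_right_continuous; apply.
    by apply: closed_openC; case: (clO k (~~ j)).
  have /continuousP := c1 xi _ pair_left_continuous; apply.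
  by case: (clO k j).
- move=> j xi nu nu1.
  have clW : closed (winningII O j xi).
    rewrite (_ : winningII _ _ _ = \bigcap_(vk in [set vk : Baire * nat | O vk.2 j (pair_join xi vk.1)])
       [set p | O vk.2 (~~ j) (pair_join (pair_left p) (response (pair_right p) vk.1))]); last first.
      by apply/seteqP; split=> y h; [move=> [v k] /= /h|move=> v k Ov; exact: (h (v, k) Ov)].
    apply: closed_bigI => -[v k] _ /=.
    apply: (@closed_comp _ _ (fun y : Baire => pair_join (pair_left y) (response (pair_right y) v)) (O k (~~ j))).
      move=> y _; apply: (@diagonal_map_continuous id) => x; exact: cvg_id.
    by case: (clO k (~~ j)).
  have [_ [w0 Ww0 _]] := prob1_nonempty nu1.
  have [r [cr rW]] := closed_retract clW Ww0.
  exists r; split=> //; first by rewrite rW.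
  suff -> : range (fun x => pair_left (r x)) = pair_left @` winningII O j xi by exact: prob1_outer1.
  by rewrite -rW image_comp.

Qed.

End closed_case.

(** * Closure properties of the projective classes *)

Section projective.
Implicit Types X Y : topologicalType.

Lemma Sigma1_preimage n X Y (f : X -> Y) (A : set Y) :
  continuous f -> Sigma1 n A -> Sigma1 n (f @^-1` A).
Proof.
elim: n X Y f A => [|n IH] X Y f A cf; first by move/continuousP : cf; exact.
move=> [B [sB ->]]; exists ((fun p => (f p.1, p.2)) @^-1` B); split.
  rewrite preimage_setC; apply: IH sB; apply: pair_continuous; last exact: snd_continuous.
  exact: (comp_continuous (@fst_continuous _ _) cf).
apply/seteqP; split=> x; first by move=> [[y d] Bd /= yx]; exists (x, d) => //=; rewrite -yx.
by move=> [[y d] Bd <-]; exists (f y, d).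
Qed.

(** Intersection and union are proved together because the induction passes to complements. *)
Lemma Sigma1_clopen n X (A C : set X) : clopen C -> Sigma1 n A ->
  Sigma1 n (A `&` C) /\ Sigma1 n (A `|` C).
Proof.
elim: n X A C => [|n IH] X A C clC; first by split; [apply: openI|apply: openU] => //; case: clC.
move=> [B [sB ->]].
have clC' : clopen (~` (fst @^-1` C : set (X * Baire)%type)).
  case: clC => oC cC; rewrite preimage_setC; split.
    by move/continuousP : (@fst_continuous X Baire); apply; exact: closed_openC.
  by apply: open_closedC; move/continuousP : (@fst_continuous X Baire); exact.
have [h1 h2] := IH _ _ _ clC' sB.
split; [exists (B `&` fst @^-1` C)|exists (B `|` fst @^-1` C)]; split.
- by rewrite setCI.
- apply/seteqP; split=> x; first by move=> [[p Bp <-] Cp]; exists p.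
  by move=> [p [Bp Cp] <-]; split=> //; exists p.
- by rewrite setCU.
- apply/seteqP; split=> x; last by move=> [p [Bp|Cp] <-]; [left; exists p|right].
  by move=> [[p Bp <-]|Cx]; [exists p => //; left|exists (x, (fun=> 0%N) : Baire) => //; right].
Qed.

Definition shift (d : Baire) : Baire := fun k => d k.+1.
Definition bcons (j : nat) (d : Baire) : Baire := fun k => if k is l.+1 then d l else j.

Lemma shift_continuous : continuous shift.
Proof. by apply: Baire_prefix_continuous => i; exists i.+2 => x y; exact. Qed.

Lemma clopen_digit X (f : X -> Baire) k j : continuous f -> clopen [set x | f x k = j].
Proof.
move=> cf; have cl : clopen [set y : Baire | y k = j].
  by apply: (@clopen_prefix _ k.+1) => x y xy /= <-; rewrite xy.
split; first by move/continuousP : cf => /(_ _ cl.1).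
by apply: (@closed_comp _ _ f [set y | y k = j]) => [x _|]; [exact: cf|case: cl].
Qed.

(** Digit [0] of the witness announces which [A j] it certifies; on complements this is again a
    union, of sets cut by clopen conditions. *)
Lemma Sigma1_bigcup n X (A : nat -> set X) : (forall j, Sigma1 n (A j)) -> Sigma1 n (\bigcup_j A j).
Proof.
elim: n X A => [|n IH] X A; first by move=> h; apply: bigcup_open => i _; exact: h.
move=> /choice[B hB].
have cs2 : continuous (fun p : X * Baire => shift p.2).
  exact: (comp_continuous (@snd_continuous _ _) shift_continuous).
exists [set p | B (p.2 0%N) (p.1, shift p.2)]; split.
  have -> : ~` [set p : X * Baire | B (p.2 0%N) (p.1, shift p.2)] =
      \bigcup_j (((fun p => (p.1, shift p.2)) @^-1` (~` B j)) `&` [set p | p.2 0%N = j]).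
    apply/seteqP; split=> p; first by move=> nB; exists (p.2 0%N).
    by move=> [j _ [/= nB pj]]; rewrite pj.
  apply: IH => j; apply: (Sigma1_clopen _ _).1; first exact: (@clopen_digit (X * Baire)%type snd 0%N j (@snd_continuous X Baire)).
  apply: Sigma1_preimage; last by case: (hB j).
  by apply: pair_continuous => //; exact: fst_continuous.
apply/seteqP; split=> x.
  move=> [j _]; rewrite (hB j).2 => -[[y d] Bd /= yx].
  by exists (x, bcons j d) => //=; rewrite -yx.
by move=> [p /= Bp <-]; exists (p.2 0%N) => //; rewrite (hB _).2; exists (p.1, shift p.2).
Qed.

Lemma Sigma1_setU n X (A B : set X) : Sigma1 n A -> Sigma1 n B -> Sigma1 n (A `|` B).
Proof.
move=> sA sB; have -> : A `|` B = \bigcup_j (if j is 0 then A else B).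
  apply/seteqP; split=> x; first by move=> [Ax|Bx]; [exists 0%N|exists 1%N].
  by move=> [[|j] _ h]; [left|right].
by apply: Sigma1_bigcup => -[|j].
Qed.

(** The columns of a single witness certify all the [A j] at once. *)
Lemma Sigma1_bigcap n X (A : nat -> set X) :
  (forall j, Sigma1 n.+1 (A j)) -> Sigma1 n.+1 (\bigcap_j A j).
Proof.
move=> /choice[B hB].
exists [set p | forall j, B j (p.1, column p.2 j)]; split.
  have -> : ~` [set p : X * Baire | forall j, B j (p.1, column p.2 j)] =
      \bigcup_j ((fun p => (p.1, column p.2 j)) @^-1` (~` B j)).
    apply/seteqP; split=> p; first by move=> /existsNP[j nB]; exists j.
    by move=> [j _ /= nB] h; apply: nB.
  apply: Sigma1_bigcup => j; apply: Sigma1_preimage; last by case: (hB j).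
  apply: pair_continuous; first exact: fst_continuous.
  exact: (comp_continuous (@snd_continuous _ _) (@column_continuous j)).
apply/seteqP; split=> x.
  move=> Ax; have /choice[d hd] : forall j, exists d, B j (x, d).
    by move=> j; have := Ax j I; rewrite (hB j).2 => -[[y d] Bd /= <-]; exists d.
  by exists (x, columns d) => // j /=; rewrite columnsK.
by move=> [p /= Bp <-] j _; rewrite (hB j).2; exists (p.1, column p.2 j).
Qed.

Lemma Sigma1_setI n X (A B : set X) : Sigma1 n.+1 A -> Sigma1 n.+1 B -> Sigma1 n.+1 (A `&` B).
Proof.
move=> sA sB; have -> : A `&` B = \bigcap_j (if j is 0 then A else B).
  apply/seteqP; split=> x; first by move=> [Ax Bx] [|j].
  by move=> h; split; [exact: (h 0%N I)|exact: (h 1%N I)].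
by apply: Sigma1_bigcap => -[|j].
Qed.

Lemma Pi1_Sigma1 n X (A : set X) : Pi1 n A -> Sigma1 n.+1 A.
Proof.
move=> pA; exists (fst @^-1` A); split.
  by rewrite preimage_setC; apply: Sigma1_preimage pA; exact: fst_continuous.
apply/seteqP; split=> x; last by move=> [p Ap <-].
by move=> Ax; exists (x, (fun=> 0%N) : Baire).
Qed.

Lemma Sigma1_exists n X (B : set (X * Baire)%type) : Sigma1 n.+1 B -> Sigma1 n.+1 (fst @` B).
Proof.
move=> [D [sD ->]].
exists [set p | D ((p.1, pair_left p.2), pair_right p.2)]; split.
  apply: (Sigma1_preimage _ sD); apply: pair_continuous.
    apply: pair_continuous; first exact: fst_continuous.
    exact: (comp_continuous (@snd_continuous _ _) pair_left_continuous).
  exact: (comp_continuous (@snd_continuous _ _) pair_right_continuous).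
apply/seteqP; split=> x.
  move=> [_ [[[y d] e] Dde <-] /= <-]; exists (y, pair_join d e) => //=.
  by rewrite pair_joinK1 pair_joinK2.
by move=> [p Dp <-]; exists (p.1, pair_left p.2) => //; eexists; [exact: Dp|].
Qed.

Context (R : realType).

(** The base case is where the space matters: open sets are countable unions of closed sets. *)
Lemma Sigma1S n X (A : set X) : nice R X -> Sigma1 n A -> Sigma1 n.+1 A.
Proof.
elim: n X A => [|n IH] X A nX.
  move=> oA; have [C [cC _ ->]] := nice_Fsigma nX oA.
  by apply: Sigma1_bigcup => j; apply: Pi1_Sigma1; exact: closed_openC.
move=> [B [sB ->]]; exists B; split=> //; apply: IH => //.
by apply: nice_pair => //; exact: nice_Baire.
Qed.

Lemma Sigma1_le m n X (A : set X) : nice R X -> (m <= n)%N -> Sigma1 m A -> Sigma1 n A.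
Proof.
move=> nX; elim: n => [|n IH]; first by rewrite leqn0 => /eqP ->.
by rewrite leq_eqVlt => /orP[/eqP -> //|]; rewrite ltnS => mn /(IH mn); exact: Sigma1S.
Qed.

Lemma Sigma1_open n X (A : set X) : nice R X -> open A -> Sigma1 n A.
Proof. by move=> nX oA; apply: (@Sigma1_le 0). Qed.

Lemma Sigma1_closed n X (A : set X) : nice R X -> closed A -> Sigma1 n.+1 A.
Proof.
by move=> nX cA; apply: (@Sigma1_le 1) => //; apply: Pi1_Sigma1; exact: closed_openC.
Qed.

End projective.

Definition opening (t : strategy) (y : nat -> nat) := fix T n : seq nat :=
  if n is k.+1 then rcons (rcons (T k) (t (T k))) (y k) else [::].

Definition initiative (t : strategy) (y : nat -> nat) : Baire := fun k => t (opening t y k).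

Lemma initiative_followsI t (y : Baire) : followsI t (pair_join (initiative t y) y).
Proof.
move=> n; rewrite (@mkseq_interleave _ _ n (opening t y) erefl (fun k => erefl)).
by rewrite /pair_join odd_double doubleK.
Qed.

Lemma initiative_continuous t : continuous (initiative t : Baire -> Baire).
Proof.
apply: Baire_prefix_continuous => i; exists i => x y xy; rewrite /initiative; congr t.
elim: i xy => //= i IH xy; rewrite IH ?xy// => l li; apply: xy; exact: leq_trans li _.
Qed.

Lemma response_continuous2 : continuous (fun p : Baire * Baire => response p.1 p.2).
Proof.
apply: Baire_continuous => -[tau v] k /=.
have dig l : nbhs (tau, v) [set p : Baire * Baire | p.2 l = v l].
  exact: (@continuous_Baire_nbhs _ snd (tau, v) l (@snd_continuous _ _)).
have digt l : nbhs (tau, v) [set p : Baire * Baire | p.1 l = tau l].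
  exact: (@continuous_Baire_nbhs _ fst (tau, v) l (@fst_continuous _ _)).
have nb n : nbhs (tau, v) [set p : Baire * Baire | play_prefix p.1 p.2 n = play_prefix tau v n].
  elim: n => [|n IH]; first by apply: filterS filterT.
  apply: filterS (filterI IH (filterI (dig n) (digt (pickle (rcons (play_prefix tau v n) (v n)))))).
  by move=> p [/= e1 [e2 e3]]; rewrite e1 e2 e3.
apply: filterS (filterI (nb k) (filterI (dig k) (digt (pickle (rcons (play_prefix tau v k) (v k)))))).
by move=> p [/= e1 [e2 e3]]; rewrite /response e1 e2 e3.
Qed.

(** * The covering game and selection from Pi^1_3 sets *)

Section covering_game.
Context (R : realType).

(* The characteristic function of the graph of [u], after an idle digit [0]. *)
Definition graph_code (u : Baire) : Baire := fun k =>
  if k is l.+1 then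
    if unpickle l is Some (j, n) then nat_of_bool (u j == n) else 0%N
  else 0%N.

Lemma graph_code_inj : injective graph_code.
Proof.
move=> u v uv; apply/funext => j; have := congr1 (fun x : Baire => x (pickle (j, u j)).+1) uv.
by rewrite /graph_code pickleK eqxx; case: eqP.
Qed.

Lemma graph_code_continuous : continuous graph_code.
Proof.
apply: Baire_continuous => u [|k]; rewrite /graph_code; first by apply: filterS filterT.
case: (unpickle k) => [[j n]|]; last by apply: filterS filterT.
by apply: filterS (nbhs_coord u j) => v /= ->.
Qed.

Definition bits (x : Baire) : Baire := fun k => nat_of_bool (x k != 0%N).

Lemma bits_continuous : continuous bits.
Proof.
by apply: Baire_prefix_continuous => i; exists i.+1 => x y xy; rewrite /bits xy.
Qed.

Fixpoint bitseqs k : seq (seq nat) :=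
  if k is j.+1 then [seq rcons b n | b <- bitseqs j, n <- [:: 0%N; 1%N]] else [:: [::]].

Lemma size_bitseqs k : size (bitseqs k) = (2 ^ k)%N.
Proof.
elim: k => // k IH; rewrite -[bitseqs k.+1]/[seq rcons b n | b <- bitseqs k, n <- [:: 0%N; 1%N]].
by rewrite size_allpairs IH expnS mulnC.
Qed.

Lemma mem_bitseqs (x : nat -> nat) k : (forall i, (x i <= 1)%N) -> mkseq x k \in bitseqs k.
Proof.
move=> x1; elim: k => // k IH; rewrite mkseqS.
rewrite -[bitseqs k.+1]/[seq rcons b n | b <- bitseqs k, n <- [:: 0%N; 1%N]].
apply/allpairsP; exists (mkseq x k, x k); split=> //=.
by have := x1 k; case: (x k) => [|[|]].
Qed.

Context (nu : Delta R Baire) (q : Baire -> Baire) (cq : continuous q) (W : set Baire).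
Context (W3 : Pi1 3 W) (det : Pi1_determinacy 3) (a e : R) (a0 : 0 <= a) (e0 : 0 < e).

Let cylinders (l : seq (seq nat)) : set Baire := [set x | exists2 v, v \in l & N v x].

Let clopen_cylinders l : clopen (cylinders l).
Proof.
elim: l => [|v l [IHo IHc]].
  rewrite (_ : cylinders [::] = set0); first by split; [exact: open0|exact: closed0].
  by apply/seteqP; split=> // x [].
have -> : cylinders (v :: l) = N v `|` cylinders l.
  apply/seteqP; split=> x.
    by move=> [w]; rewrite inE => /orP[/eqP ->|wl] Nw; [left|right; exists w].
  by move=> [Nv|[w wl Nw]]; [exists v => //; rewrite inE eqxx|exists w => //; rewrite inE wl orbT].
by case: (clopen_N v) => oN cN; split; [exact: openU|exact: closedU].
Qed.

(** Thanks to the idle digit, move [k] of player II answers [k] bits, so there are [2 ^ k] possible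
    pieces of rank [k]. The bounds make their total measure at most [a + e], of which the first
    piece takes [a]. *)
Let bound k : R := if k is 0 then a else e / 4 ^+ k.

(* The clopen set coded by the [k]-th move of player II, void when it is too
   large. *)
Let piece k (c : nat) : set Baire :=
  let l := odflt ([::], [::]) (unpickle c : option (seq (seq nat) * seq (seq nat))) in
  let U := cylinders l.1 `\` cylinders l.2 in
  if pr nu U <= bound k then U else set0.

Let clopen_piece k c : clopen (piece k c).
Proof.
rewrite /piece; case: ifP => _; last by split; [exact: open0|exact: closed0].
rewrite setDE; set l := odflt _ _.
case: (clopen_cylinders l.1) => o1 c1; case: (clopen_cylinders l.2) => o2 c2.
by split; [apply: openI => //; exact: closed_openC|apply: closedI => //; exact: open_closedC].
Qed.

Let pr_piece k c : pr nu (piece k c) <= bound k.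
Proof.
rewrite /piece; case: ifP => // _; rewrite pr0 /bound; case: k => // k.
by rewrite divr_ge0 ?exprn_ge0//; exact: ltW.
Qed.

Let covered (x u : Baire) := exists k, piece k (pair_right x k) (q u).

(** Player I writes the graph of a point [u] of [W] bit by bit, while player II tries to trap [q u]
    in small clopen pieces. Reading moves through [bits] leaves player I two options per round. *)
Let payoff : set Baire :=
  [set x | exists u, [/\ bits (pair_left x) = graph_code u, W u & ~ covered x u]].

(** The play determines [u], by injectivity of [graph_code]. The complement therefore says that no
    [u] is coded, or that some coded [u] is outside [W] or covered; both alternatives are
    Sigma^1_3. *)
Let Pi1_payoff : Pi1 3 payoff.
Proof.
pose D := [set p : Baire * Baire | bits (pair_left p.1) = graph_code p.2].
have nBB : nice R (Baire * Baire)%type by apply: nice_pair; exact: nice_Baire.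
have c1 : continuous (fun p : Baire * Baire => bits (pair_left p.1)).
  apply: (@comp_continuous _ Baire Baire (fun p : Baire * Baire => pair_left p.1) bits).
    exact: (comp_continuous (@fst_continuous Baire Baire) pair_left_continuous).
  exact: bits_continuous.
have c2 : continuous (fun p : Baire * Baire => graph_code p.2).
  exact: (comp_continuous (@snd_continuous Baire Baire) graph_code_continuous).
have cD : closed D by apply: closed_eq_continuous => //; exact: nice_hausdorff (nice_Baire R).
have cR : continuous (fun p : Baire * Baire => pair_right p.1).
  exact: (comp_continuous (@fst_continuous Baire Baire) pair_right_continuous).
have cqs : continuous (fun p : Baire * Baire => q p.2).
  exact: (comp_continuous (@snd_continuous Baire Baire) cq).
have oC : open [set p : Baire * Baire | covered p.1 p.2].
  have -> : [set p : Baire * Baire | covered p.1 p.2] =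
     \bigcup_(kc in [set: nat * nat]) ([set p | pair_right p.1 kc.1 = kc.2] `&`
        (fun p => q p.2) @^-1` piece kc.1 kc.2).
    apply/seteqP; split=> p; first by move=> [k h]; exists (k, pair_right p.1 k).
    by move=> [[k c] _ [/= <- h]]; exists k.
  apply: bigcup_open => -[k c] _; apply: openI; first by case: (@clopen_digit (Baire * Baire)%type (fun p => pair_right p.1) k c cR).
  by move/continuousP : cqs; apply; case: (clopen_piece k c).
have e1 : ~` payoff = ~` (fst @` D) `|` fst @` (D `&` ((snd @^-1` ~` W) `|` [set p | covered p.1 p.2])).
  apply/seteqP; split=> x.
    move=> nP; have [[[y u] /= Du yx]|h] := pselect ((fst @` D) x); last by left.
    rewrite /= in yx; right; exists (x, u) => //; split; first by rewrite -yx.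
    have [Wu|nWu] := pselect (W u); [right|by left].
    apply: contrapT => nc; apply: nP; exists u; split=> //; by rewrite -yx.
  move=> h [u [xu Wu nc]]; case: h => [|[[y u'] [/= Du' h] yx]].
    by apply; exists (x, u).
  rewrite /= in yx; rewrite yx in Du' h.
  have uu : u' = u by apply: graph_code_inj; rewrite -xu.
  by rewrite uu in h; case: h => /= h; [exact: h|exact: nc].
rewrite /Pi1 e1; apply: Sigma1_setU.
  apply: (@Sigma1_le R 2) => //; first exact: nice_Baire.
  apply: Pi1_Sigma1; rewrite /Pi1 setCK; exists D; split=> //.
  exact: closed_openC.
apply: Sigma1_exists; apply: Sigma1_setI; first exact: (@Sigma1_closed R).
apply: Sigma1_setU; last exact: (@Sigma1_open R).
by apply: Sigma1_preimage => //; exact: snd_continuous.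
Qed.

Let sum_bound n : \sum_(0 <= k < n) (2 ^ k)%:R * bound k <= a + e.
Proof.
case: n => [|n]; first by rewrite big_geq// addr_ge0// ltW.
rewrite big_nat_recl//= mul1r lerD2l.
apply: (le_trans _ (@sum_half_le R e n (ltW e0))); apply: ler_sum => k _.
rewrite (_ : (4 : R) = 2 * 2); last by rewrite -natrM.
have h : (2 : R) ^+ k.+1 != 0 by rewrite expf_neq0.
by rewrite natrX exprMn le_eqVlt; apply/orP; left; apply/eqP; field.
Qed.

Let covering_win (t : strategy) : (forall x, followsII t x -> ~ payoff x) ->
  exists B, [/\ borel B, q @` W `<=` B & pr nu B <= a + e].
Proof.
move=> ht; pose tau n := t (enumseq n).
(* The [0] put before [b] is the idle digit of [graph_code]. *)
pose P k b := piece k (response tau (nth 0%N (0%N :: b)) k).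
pose Q k := \bigcup_(i in [set i | (i < size (bitseqs k))%N]) P k (nth [::] (bitseqs k) i).
have bP k b : borel (P k b) by apply: borel_open; case: (clopen_piece k (response tau (nth 0%N (0%N :: b)) k)).
have bQ k : borel (Q k) by apply: borel_bigcup_lt => i; exact: bP.
exists (\bigcup_k Q k); split; first exact: borel_bigcup.
  move=> _ [u Wu <-]; pose x := pair_join (graph_code u) (response tau (graph_code u)).
  have g1 i : (graph_code u i <= 1)%N by rewrite /graph_code; case: i => // i; case: unpickle => [[j n]|] //; case: (u j == n).
  have : ~ payoff x by apply: ht; exact: response_followsII.
  move=> nP; apply: contrapT => nQ; apply: nP; exists u; split=> //.
    rewrite pair_joinK1; apply/funext => k; rewrite /bits.
    by have := g1 k; case: (graph_code u k) => [|[|]].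
  move=> [k]; rewrite pair_joinK2 => hk; apply: nQ; exists k => //.
  have /(nthP [::])[i isz ib] := @mem_bitseqs (fun i => graph_code u i.+1) k (fun i => g1 i.+1).
  exists i => //; rewrite /P ib.
  by rewrite (@response_eq _ _ (graph_code u))// => -[|l] lk //=; rewrite nth_mkseq.
apply: pr_bigcup_le => // n; apply: (le_trans _ (sum_bound n)); apply: ler_sum => k _.
rewrite -(size_bitseqs k) /Q; move: (bitseqs _) => l.
have : forall j, pr nu (\bigcup_(i in [set i | (i < j)%N]) P k (nth [::] l i)) <= j%:R * bound k.
  elim=> [|j IH].
    by rewrite (_ : \bigcup_(i in _) _ = set0) ?pr0 ?mul0r//; apply/seteqP; split=> // x [].
  have -> : \bigcup_(i in [set i | (i < j.+1)%N]) P k (nth [::] l i) =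
     \bigcup_(i in [set i | (i < j)%N]) P k (nth [::] l i) `|` P k (nth [::] l j).
    apply/seteqP; split=> x.
      move=> [i /=]; rewrite ltnS leq_eqVlt => /orP[/eqP ->|ij] h; first by right.
      by left; exists i.
    by move=> [[i ij h]|h]; [exists i => //; exact: leq_trans ij (leqnSn j)|exists j => /=].
  apply: (le_trans (prU_le _ _ _)); [by apply: borel_bigcup_lt => i; exact: bP|exact: bP|].
  by rewrite -natr1 mulrDl mul1r lerD//; exact: pr_piece.
exact.
Qed.

(** The points built by [t] against all plays have a closed graph, and a retraction onto it yields
    [f]. If a Borel superset of the range had measure below [a], player II would beat [t] by
    exhausting an open superset of measure below [a] with legal pieces. *)
Let building_win (t : strategy) : (forall x, followsI t x -> payoff x) ->
  exists f : Baire -> Baire, [/\ continuous f, range f `<=` W &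
    forall B, borel B -> range (fun x => q (f x)) `<=` B -> a <= pr nu B].
Proof.
move=> ht.
pose C := [set p : Baire | bits (initiative t (pair_left p)) = graph_code (pair_right p)].
have cC : closed C.
  apply: closed_eq_continuous; first exact: nice_hausdorff (nice_Baire R).
    apply: (@comp_continuous Baire Baire Baire (fun p => initiative t (pair_left p)) bits).
      exact: (comp_continuous pair_left_continuous (@initiative_continuous t)).
    exact: bits_continuous.
  exact: (comp_continuous pair_right_continuous graph_code_continuous).
have play (y : Baire) : exists u, [/\ bits (initiative t y) = graph_code u, W u &
    forall k, ~ piece k (y k) (q u)].
  have [u [h1 h2 h3]] := ht _ (initiative_followsI t y).
  rewrite pair_joinK1 in h1; exists u; split=> // k pk; apply: h3; exists k.
  by rewrite pair_joinK2.
have [u0 [h0 _ _]] := play (fun=> 0%N).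
have [|r [cr rC]] := @closed_retract C (pair_join (fun=> 0%N) u0) cC.
  by rewrite /C /= pair_joinK1 pair_joinK2.
exists (fun x => pair_right (r x)); split.
- exact: comp_continuous cr pair_right_continuous.
- move=> _ [x _ <-]; have Cr : C (r x) by rewrite -rC; exists x.
  have [u [h1 Wu _]] := play (pair_left (r x)).
  by rewrite (_ : pair_right (r x) = u)//; apply: graph_code_inj; rewrite -h1 -Cr.
move=> B bB RB; rewrite leNgt; apply/negP => Ba.
have ab0 : 0 < a - pr nu B by rewrite subr_gt0.
have [C' [U [cC' oU C'B BU ltU]]] := @regular R Baire nu B (a - pr nu B) (nice_Baire R) bB ab0.
have bU := borel_open oU; have bC' := borel_closed cC'.
have prU : pr nu U < a.
  have := @prD _ _ nu U C' bU bC' (subset_trans C'B BU).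
  have := @pr_le _ _ nu C' B bC' bB C'B; lra.
pose l n := [seq enumseq i | i <- iota 0 n & `[< N (enumseq i) `<=` U >]].
have memU n x : cylinders (l n) x <-> exists i, [/\ (i < n)%N, N (enumseq i) `<=` U & N (enumseq i) x].
  split=> [[v /mapP[i]]|[i [isz iU ix]]].
    by rewrite mem_filter mem_iota => /andP[/asboolP iU isz] -> ix; exists i.
  exists (enumseq i) => //; apply/mapP; exists i => //.
  by rewrite mem_filter mem_iota; apply/andP; split => //; exact/asboolP.
have subU n : cylinders (l n) `<=` U by move=> x /memU[i [_ iU /iU]].
have bl n : borel (cylinders (l n)) by apply: borel_open; case: (clopen_cylinders (l n)).
have lS n k : (n <= k)%N -> cylinders (l n) `<=` cylinders (l k).
  by move=> nk x /memU[i [isz iU ix]]; apply/memU; exists i; split=> //; exact: leq_trans nk.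
have cv : pr nu \o (fun n => U `\` cylinders (l n)) @ \oo --> 0.
  rewrite -(pr0 nu) (_ : set0 = \bigcap_n (U `\` cylinders (l n))).
    apply: pr_cvg_down => [n|n x [Ux nx]]; first exact: borelD.
    by split=> // h; apply: nx; exact: lS (leqnSn n) _ h.
  apply/seteqP; split=> // x h; have [Ux _] := h 0%N I.
  move: Ux; rewrite (open_Baire_bigcup oU) => -[i iU ix].
  by have [_] := h i.+1 I; apply; apply/memU; exists i.
have /choice[M hM] : forall k : nat, exists n, (k <= n)%N /\
    forall n', (n <= n')%N -> pr nu (U `\` cylinders (l n')) < e / 4 ^+ k.
  move=> k; have [|n _ hn] := @cvgr_lt _ _ _ _ _ _ cv (e / 4 ^+ k).
    by rewrite divr_gt0// exprn_gt0.
  exists (maxn k n); split; first exact: leq_maxl.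
  by move=> n' h; apply: hn; exact: leq_trans (leq_maxr _ _) h.
(* [T k] counts the cylinders examined before move [k]. What is left of [U] then fits in [bound k]:
   for [k = 0] it is all of [U], of measure below [a], and afterwards [M k] ensures it. *)
pose T := fix T k := if k is j.+1 then maxn (T j) (M k) else 0%N.
have TS k : T k.+1 = maxn (T k) (M k.+1) by [].
have ltT k : pr nu (U `\` cylinders (l (T k))) < bound k.
  case: k => [|k]; last by apply: (hM k.+1).2; rewrite TS leq_maxr.
  rewrite /bound (_ : U `\` _ = U)//; apply/seteqP; split=> x; first by case.
  by move=> Ux; split=> // h; have [i []] := (memU 0%N x).1 h.
have geT k : (k <= T k)%N.
  by case: k => // k; rewrite TS; apply: leq_trans (leq_maxr _ _); exact: (hM k.+1).1.
pose y : Baire := fun k => pickle (l (T k.+1), l (T k)).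
have pieceE k : piece k (y k) = cylinders (l (T k.+1)) `\` cylinders (l (T k)).
  rewrite /piece /y pickleK /= ifT//; apply: le_trans (ltW (ltT k)).
  by apply: pr_le; [exact: borelD|exact: borelD|move=> x [/subU Ux nx]].
have [u [h1 Wu nc]] := play y.
have Uq : U (q u).
  apply: BU; apply: RB.
  have : C (pair_join y u) by rewrite /C /= pair_joinK1 pair_joinK2.
  rewrite -rC => -[x _ rx]; exists x => //.
  by rewrite rx pair_joinK2.
have [k hk] : exists k, cylinders (l (T k)) (q u).
  move: Uq; rewrite (open_Baire_bigcup oU) => -[i iU ix].
  by exists i.+1; apply/memU; exists i; split=> //; exact: geT.
elim: k hk => [h|k IH hk]; first by have [i []] := (memU 0%N (q u)).1 h.
have [hk'|nhk] := pselect (cylinders (l (T k)) (q u)); first exact: IH.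
by apply: (nc k); rewrite pieceE.
Qed.

Lemma covering_game :
  (exists B, [/\ borel B, q @` W `<=` B & pr nu B <= a + e]) \/
  exists f : Baire -> Baire, [/\ continuous f, range f `<=` W &
    forall B, borel B -> range (fun x => q (f x)) `<=` B -> a <= pr nu B].
Proof.
have [[t ht]|[t ht]] := det Pi1_payoff; first by right; exact: building_win ht.
by left; exact: covering_win ht.
Qed.

End covering_game.

Section selection.
Context (R : realType) (det : Pi1_determinacy 3).

Lemma digit_cases_continuous (F : nat -> Baire -> Baire) : (forall n, continuous (F n)) ->
  continuous (fun x : Baire => F (x 0%N) (shift x)).
Proof.
move=> cF; apply: Baire_continuous => x k.
have cFs : continuous (fun y : Baire => F (x 0%N) (shift y)).
  exact: (@comp_continuous Baire Baire Baire shift (F (x 0%N)) shift_continuous (@cF (x 0%N))).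
apply: filterS (filterI (nbhs_coord x 0%N) (@continuous_Baire_nbhs _ _ x k cFs)).
by move=> y [/= -> ->].
Qed.

(** The covering alternative is excluded for [a < 1] only, so one map is taken for each
    [a = 1 - 1 / (n + 1)], and the first digit of the argument chooses among them. *)
Lemma Pi3_selection (nu : Delta R Baire) (q : Baire -> Baire) (W : set Baire) :
  continuous q -> Pi1 3 W -> outer1 nu (q @` W) ->
  exists f : Baire -> Baire, [/\ continuous f, range f `<=` W &
    outer1 nu (range (fun x => q (f x)))].
Proof.
move=> cq W3 nuW.
have /choice[F hF] : forall n, exists f : Baire -> Baire, [/\ continuous f, range f `<=` W &
    forall B, borel B -> range (fun x => q (f x)) `<=` B -> 1 - n.+1%:R^-1 <= pr nu B].
  move=> n; have n1 : 0 < n.+1%:R^-1 :> R by rewrite invr_gt0 ltr0n.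
  have n2 : n.+1%:R^-1 <= 1 :> R by rewrite invf_le1 ?ler1n ?ltr0n.
  move: n.+1%:R^-1 n1 n2 => r n1 n2.
  (* With [a = 1 - r] and [e = r / 2] a cover would have measure at most [1 - r / 2], against outer
     measure one. *)
  have [||[B [bB WB ltB]]|//] := @covering_game R nu q cq W W3 det (1 - r) (r / 2).
  - lra.
  - lra.
  - by exfalso; have := nuW B bB WB; lra.
exists (fun x => F (x 0%N) (shift x)); split.
- by apply: digit_cases_continuous => n; case: (hF n).
- by move=> _ [x _ <-]; case: (hF (x 0%N)) => _ + _; apply; exists (shift x).
move=> B bB RB; apply/eqP; rewrite eq_le pr_le1//=; apply/ler_addgt0Pr => e e0.
have [n _ hn] := near_infty_natSinv_lt (PosNum e0).
have := hn n (leqnn n); rewrite /= => ltn.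
have [_ _ /(_ B bB)] := hF n.
have h : range (fun x => q (F n x)) `<=` B.
  by move=> _ [x _ <-]; apply: RB; exists (bcons n x).
by move: ltn; move: n.+1%:R^-1 => r ltn /(_ h); lra.
Qed.

End selection.

(** * Projective complexity of having measure one *)

Section belief.
Context (R : realType).

(** An open set is the disjoint union of its maximal cylinders, given by the [minimal] words. *)
Lemma cylinder_domination (m m' : Delta R Baire) (c : R) (U : set Baire) : 0 <= c ->
  (forall u, pr m (N u) <= c * pr m' (N u)) -> open U -> pr m U <= c * pr m' U.
Proof.
move=> c0 h oU.
pose minimal u := N u `<=` U /\ forall k, (k < size u)%N -> ~ N (take k u) `<=` U.
pose P n := minimal (enumseq n) /\ pickle (enumseq n) = n.
pose F n := if `[< P n >] then N (enumseq n) else set0.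
have FP n x : F n x -> P n /\ N (enumseq n) x by rewrite /F; case: asboolP.
have bN u : borel (N u) by apply: borel_open; case: (clopen_N u).
have bF n : borel (F n) by rewrite /F; case: ifP => _ //; exact: borel0.
have min_unique u v x : minimal u -> minimal v -> N u x -> N v x -> (size u <= size v)%N.
  move=> [_ mu] [vU _] Nu Nv; rewrite leqNgt; apply/negP => vu; apply: (mu _ vu).
  by rewrite -Nu take_mkseq ?(ltnW vu)// Nv.
have tF : trivIset setT F.
  apply/trivIsetP => i j _ _ ij; apply/seteqP; split=> // x [/FP[[mi pi] Ni] /FP[[mj pj] Nj]].
  move/eqP : ij; apply; rewrite -pi -pj; congr pickle; rewrite -Ni -Nj; congr mkseq.
  by apply/eqP; rewrite eqn_leq (min_unique _ _ x)//= (min_unique _ _ x).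
have FU : \bigcup_n F n `<=` U by move=> x [n _ /FP[[[nU _] _] /nU]].
have -> : U = \bigcup_n F n.
  apply/seteqP; split=> // x Ux.
  have ex : exists k, `[< N (mkseq x k) `<=` U >].
    have /nbhs_BaireP[k kU] : nbhs x U by exact: open_nbhs_nbhs.
    by exists k; apply/asboolP; rewrite N_mkseq.
  have [k /asboolP kU kmin] := ex_minnP ex.
  exists (pickle (mkseq x k)) => //; rewrite /F asboolT ?enumseqK ?N_mkseq//.
  split; last by rewrite enumseqK.
  rewrite enumseqK; split=> // l; rewrite size_mkseq => lk; rewrite take_mkseq ?(ltnW lk)// => /asboolP lU.
  by have := kmin l lU; rewrite leqNgt lk.
apply: pr_bigcup_le => // n.
have cv := @pr_bigcup_series _ _ m' F bF tF.
have le n' : \sum_(0 <= i < n') pr m' (F i) <= pr m' (\bigcup_n F n).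
  have nd : {homo (fun n => \sum_(0 <= i < n) pr m' (F i)) : a b / (a <= b)%N >-> a <= b}.
    apply/nondecreasing_seqP => k; rewrite big_nat_recr//= lerDl; exact: pr_ge0.
  have := nondecreasing_cvgn_le nd (cvgP _ cv) n'.
  by rewrite (cvg_lim (@Rhausdorff R) cv).
apply: (@le_trans _ _ (\sum_(0 <= i < n) c * pr m' (F i))).
  by apply: ler_sum => i _; rewrite /F; case: ifP => _; rewrite ?pr0 ?mulr0.
by rewrite -mulr_sumr ler_wpM2l.
Qed.

Lemma cylinder_domination_null (m m' : Delta R Baire) (c : R) (A : set Baire) : 0 <= c ->
  (forall u, pr m (N u) <= c * pr m' (N u)) -> borel A -> pr m' A = 0 -> pr m A = 0.
Proof.
move=> c0 h bA A0; apply/eqP; rewrite eq_le pr_ge0 andbT; apply/ler_addgt0Pr => e e0.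
(* [c + 1] is a safe divisor even when [c] is zero. *)
have c1 : 0 < c + 1 by rewrite ltr_wpDl.
have e1 : 0 < e / (c + 1) by rewrite divr_gt0.
have [C [V [cC oV CA AV lt]]] := @regular R Baire m' A _ (nice_Baire R) bA e1.
have bV := borel_open oV; have bC := borel_closed cC.
have C0 : pr m' C = 0 by exact: (pr_le0 bC bA CA A0).
have prV : pr m' V < e / (c + 1).
  have := @prD _ _ m' V C bV bC (subset_trans CA AV); lra.
rewrite add0r; apply: (le_trans (pr_le m bA bV AV)).
apply: (le_trans (cylinder_domination c0 h oV)).
apply: (@le_trans _ _ ((c + 1) * (e / (c + 1)))); last by rewrite mulrC divfK// gt_eqF.
by apply: ler_pM; rewrite ?pr_ge0//; [rewrite lerDl|exact: ltW].
Qed.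

Lemma pr_clopen_continuous (Y S : topologicalType) (K : Y -> Delta R S) (C : set S) :
  nice R S -> continuous K -> clopen C -> continuous (fun y => pr (K y) C).
Proof.
move=> nS cK [oC cC] y; apply/cvgrPdist_lt => e e0.
have bC := borel_open oC.
have h1 : nbhs y [set z | pr (K y) C - e < pr (K z) C].
  by apply: (cK y _ (near_pr_open nS oC _)); lra.
have h2 : nbhs y [set z | pr (K y) (~` C) - e < pr (K z) (~` C)].
  by apply: (cK y _ (near_pr_open nS (closed_openC cC) _)); lra.
apply: filterS (filterI h1 h2) => z [/= z1].
by rewrite !prC// => z2; rewrite ltr_norml; lra.
Qed.

Context (det : Pi1_determinacy 3).

(** The digits of [w] after the first code a measure on [Q] whose projection is at most [w 0] times
    [m] on cylinders. Such a projection gives the complement of [S] full measure but would ignore it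
    if [m] did; conversely, [m] conditioned on a hull of the complement lifts to [Q] by
    selection. *)
Lemma not_prob1_dominated (m : Delta R Baire) (S Q : set Baire) :
  ~` S = pair_left @` Q -> Pi1 3 Q ->
  ~ prob1 m S <-> exists w : Baire, prob1 (kappa R (shift w)) Q /\
    forall u, pr (kappa R (shift w)) (pair_left @^-1` N u) <= (w 0%N)%:R * pr m (N u).
Proof.
move=> SQ Q3; have bN u : borel (N u) by apply: borel_open; case: (clopen_N u).
split=> [nS|[w [Qw dom]] /prob1P[G [bG GS G1]]].
  (* The complement of [S] may be nonmeasurable; it has outer measure one for [m] conditioned on its
     hull [H]. *)
  have [H [bH SH Hmin]] := hull m (~` S).
  have H0 : 0 < pr m H.
    rewrite lt_neqAle pr_ge0 andbT eq_sym; apply/eqP => H0; apply: nS; apply/prob1P.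
    exists (~` H); split; first exact: borelC.
      by move=> x nH; apply: contrapT => /SH.
    by rewrite prC// H0 subr0.
  have [m' m'E] := pr_cond bH H0.
  have m'1 : outer1 m' (pair_left @` Q).
    rewrite -SQ => B bB SB; rewrite m'E//.
    have := @prIDe _ _ m H B bH bB; rewrite Hmin// addr0 setIC => <-.
    by rewrite divff// gt_eqF.
  have [f [cf fQ f1]] := Pi3_selection det pair_left_continuous Q3 m'1.
  have cpf : continuous (fun x => pair_left (f x)) by exact: comp_continuous cf pair_left_continuous.
  have [m'' m''E] := @lift_measure R _ (nice_Baire R) _ cpf m' f1.
  pose M := push cf m''.
  (* Conditioning on [H] multiplies masses by at most the inverse of [pr m H]; the digit is an
     integer above this inverse. *)
  exists (bcons (Num.truncn (pr m H)^-1).+1 (coder M)).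
  rewrite (_ : shift _ = coder M)// coderK; split.
    by apply: prob1_push_image; apply: prob1S (prob1T m'') => x _; apply: fQ; exists x.
  move=> u.
  have -> : pr M (pair_left @^-1` N u) = pr m' (N u).
    by rewrite -m''E !pr_push//; apply: (@borel_preimage Baire Baire) => //; exact: pair_left_continuous.
  rewrite m'E// mulrC /=; apply: ler_pM.
  - by rewrite invr_ge0 ltW.
  - exact: pr_ge0.
  - by apply: ltW; exact: truncnS_gt.
  - by apply: pr_le => [||x []] //; exact: borelI.
pose P := push pair_left_continuous (kappa R (shift w)).
have P0 : pr P (~` G) = 0.
  apply: (@cylinder_domination_null P m (w 0%N)%:R) => //.
  - by move=> u; rewrite pr_push.
  - exact: borelC.
  - by rewrite prC// G1 subrr.
have : pr P (~` G) = 1.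
  rewrite pr_push; last exact: borelC.
  apply/prob1_borel.
    by apply: borel_preimage; [exact: pair_left_continuous|exact: borelC].
  apply: prob1S Qw => x Qx Gx.
  have : (~` S) (pair_left x) by rewrite SQ; exists x.
  by apply; exact: GS.
by rewrite P0 => /eqP; rewrite eq_sym oner_eq0.
Qed.

(** The failure of [prob1] is the existence of a [w] satisfying a [prob1] statement for a set one
    level lower and countably many non-strict inequalities between continuous functions, a closed
    condition. *)
Lemma Pi1_prob1 n (S : set Baire) (K : Baire -> Delta R Baire) : (n <= 2)%N ->
  continuous K -> Pi1 n S -> Pi1 n [set z | prob1 (K z) S].
Proof.
elim: n S K => [|n IH] S K n2 cK.
  move=> /open_closedC; rewrite setCK => cS; apply: closed_openC.
  exact: (closed_prob1 (nice_Baire R)).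
move=> [Q' [sQ' SQ']].
pose Q := [set u | Q' (pair_left u, pair_right u)].
have cpair : continuous (fun u => (pair_left u, pair_right u)).
  by apply: pair_continuous; [exact: pair_left_continuous|exact: pair_right_continuous].
have Qn : Pi1 n Q.
  rewrite /Pi1 (_ : ~` Q = (fun u => (pair_left u, pair_right u)) @^-1` (~` Q'))//.
  exact: Sigma1_preimage.
have Q3 : Pi1 3 Q.
  by apply: (Sigma1_le (nice_Baire R) _ Qn); exact: leq_trans (ltnW n2) _.
have SQ : ~` S = pair_left @` Q.
  rewrite SQ'; apply/seteqP; split=> x; last by move=> [u Qu <-]; exists (pair_left u, pair_right u).
  move=> [[y z] Qyz /= <-]; exists (pair_join y z); last exact: pair_joinK1.
  by rewrite /Q /= pair_joinK1 pair_joinK2.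
have csh : continuous (fun p : Baire * Baire => kappa R (shift p.2)).
  apply: (@comp_continuous _ Baire _ (fun p : Baire * Baire => shift p.2) (kappa R)).
    exact: (comp_continuous (@snd_continuous _ _) shift_continuous).
  exact: kappa_continuous.
exists ([set p | prob1 (kappa R (shift p.2)) Q] `&`
  [set p | forall u, pr (kappa R (shift p.2)) (pair_left @^-1` N u) <= (p.2 0%N)%:R * pr (K p.1) (N u)]).
split; last first.
  apply/seteqP; split=> z.
    by move=> /(not_prob1_dominated _ SQ Q3)[w hw]; exists (z, w).
  by move=> [[y w] hw /= <-]; apply/(not_prob1_dominated _ SQ Q3); exists w.
rewrite setCI; apply: Sigma1_setU.
  have := IH Q (fun z => kappa R (shift z)) (ltnW n2) _ Qn.
  move=> h; apply: (@Sigma1_preimage n (Baire * Baire)%type Baire snd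
    (~` [set z | prob1 (kappa R (shift z)) Q]) (@snd_continuous _ _)); apply: h.
  exact: (@comp_continuous Baire Baire _ shift (kappa R) shift_continuous (@kappa_continuous R)).
apply: (@Sigma1_open R); first by apply: nice_pair; exact: nice_Baire.
pose V k u := [set p : Baire * Baire | p.2 0%N = k] `&` [set p |
   k%:R * pr (K p.1) (N u) < pr (kappa R (shift p.2)) (pair_left @^-1` N u)].
rewrite (_ : ~` _ = \bigcup_(ku in [set: nat * seq nat]) V ku.1 ku.2); last first.
  apply/seteqP; split=> p.
    move=> /existsNP[u hu]; exists (p.2 0%N, u) => //; split=> //=.
    by rewrite ltNge; apply/negP.
  by move=> [[k u] _ [/= <- hu]] /(_ u); rewrite leNgt hu.
apply: bigcup_open => -[k u] _; apply: openI.
  by case: (@clopen_digit (Baire * Baire)%type snd 0%N k (@snd_continuous _ _)).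
have cK1 : continuous (fun p : Baire * Baire => K p.1).
  exact: (@comp_continuous (Baire * Baire)%type Baire _ fst K (@fst_continuous _ _) cK).
have c1 : continuous (fun p : Baire * Baire => k%:R * pr (K p.1) (N u)).
  move=> p; apply: cvgMr; apply: (pr_clopen_continuous (nice_Baire R) cK1 (clopen_N u)).
have clpN : clopen (pair_left @^-1` N u).
  case: (clopen_N u) => oN cN; split; first by move/continuousP : pair_left_continuous; exact.
  by apply: (@closed_comp _ _ pair_left (N u)) => // x _; exact: pair_left_continuous.
have c2 := pr_clopen_continuous (nice_Baire R) csh clpN.
rewrite (_ : [set p | _] = (fun p : Baire * Baire => pr (kappa R (shift p.2)) (pair_left @^-1` N u) -
   k%:R * pr (K p.1) (N u)) @^-1` [set r | 0 < r]); last first.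
  by apply/seteqP; split=> p /=; rewrite subr_gt0.
have c3 : continuous (fun p : Baire * Baire => pr (kappa R (shift p.2)) (pair_left @^-1` N u) -
   k%:R * pr (K p.1) (N u)) by move=> p; apply: cvgB; [exact: c2|exact: c1].
by move/continuousP : c3; apply; exact: open_gt.
Qed.

End belief.

(** * Case (b): Pi^1_2 relations under determinacy *)

Section determinacy_case.
Context (R : realType) (X : bool -> topologicalType) (nX : forall i, nice R (X i)).
Context (E : forall i, set (X i * Delta R (X (~~ i)))%type).
Context (det : Pi1_determinacy 3) (PE : forall i, Pi1 2 (@E i)).

Lemma RAT_sub_RCBR_det : RAT E `<=` RCBR E.
Proof.
move=> p hp i; have [B jB [q qB <-]] := hp i.
have [s [cs sT]] := nice_param nX.
(* A dummy witness coordinate puts [E] in the form that the comparison game expects. *)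
pose F j := fst @^-1` (@E j) : set ((X j * Delta R (X (~~ j))) * Baire)%type.
have EF j : @E j = fst @` F j.
  apply/seteqP; split=> x; last by move=> [y Fy <-].
  by move=> Ex; exists (x, (fun=> 0%N) : Baire).
pose A j := rational F cs j.
pose O k j := common_belief (bel R) A k j.
have PA j : Pi1 2 (A j).
  have -> : A j = (fun z => (strat s j z, push (@strat_continuous X s cs (~~ j)) (bel R z))) @^-1` @E j by [].
  rewrite /Pi1 preimage_setC; apply: Sigma1_preimage; last exact: PE.
  exact: (comp_continuous (@rational_preimage_continuous R X s cs j) (@fst_continuous _ _)).
have PO k j : Pi1 2 (O k j).
  elim: k j => [|k IH] j.
    by rewrite /Pi1 setCT; apply: (@Sigma1_open R); [exact: nice_Baire|exact: open0].
  rewrite /Pi1 (_ : O k.+1 j = A j `&` [set z | prob1 (bel R z) (O k (~~ j))])// setCI.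
  apply: Sigma1_setU; first exact: PA.
  exact: (@Pi1_prob1 R det 2 _ (bel R) isT (@bel_continuous R) (IH (~~ j))).
(* [O k j] and its complement are now both Sigma^1_3. The complements of the comparison payoff and
   of [winningII] are built from them by countable operations and one projection, hence Sigma^1_3 as
   well. *)
have sO k j : Sigma1 3 (O k j) by exact: Pi1_Sigma1.
have sCO k j : Sigma1 3 (~` O k j) by apply: (Sigma1S (nice_Baire R)); exact: PO.
have c1 (Y : topologicalType) (x : Baire) (h : Y -> Baire) :
    continuous h -> continuous (fun y => pair_join x (h y)).
  move=> ch; apply: (@comp_continuous Y (Baire * Baire)%type Baire (fun y => (x, h y)) (fun p => pair_join p.1 p.2));
    last exact: pair_join_continuous.
  by apply: pair_continuous => //; exact: cst_continuous.
have cresp : continuous (fun z : Baire * Baire =>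
    pair_join (pair_left z.1) (response (pair_right z.1) z.2)).
  apply: (@comp_continuous _ (Baire * Baire)%type Baire
    (fun z : Baire * Baire => (pair_left z.1, response (pair_right z.1) z.2)) (fun p => pair_join p.1 p.2));
    last exact: pair_join_continuous.
  apply: pair_continuous.
    exact: (comp_continuous (@fst_continuous _ _) pair_left_continuous).
  apply: (@comp_continuous _ (Baire * Baire)%type Baire
    (fun z : Baire * Baire => (pair_right z.1, z.2)) (fun p => response p.1 p.2));
    last exact: response_continuous2.
  apply: pair_continuous; last exact: snd_continuous.
  exact: (comp_continuous (@fst_continuous _ _) pair_right_continuous).
apply: (@comparison_game R X nX E F EF s cs sT O _ _ _ _ _ _ i B jB) => //.
- by move=> k j; exact: common_beliefS.
- move=> j z Oz.
  exact: (@common_belief_RCBRi R X nX E _ (@strat_continuous X s cs) (bel R) (@bel_continuous R) A (fun _ _ => id)).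
- move=> j xi xi'; apply: det; rewrite /Pi1.
  rewrite (_ : ~` _ = \bigcap_k (((fun x => pair_join xi' (pair_right x)) @^-1` O k (~~ j)) `|`
      ((fun x => pair_join xi (pair_left x)) @^-1` ~` O k j))); last first.
    apply/seteqP; split=> x.
      move=> nc k _; have [h|h] := pselect (O k (~~ j) (pair_join xi' (pair_right x))); [by left|right].
      by move=> h'; apply: nc; exists k.
    by move=> h [k [h1 h2]]; case: (h k I).
  apply: (@Sigma1_bigcap 2 Baire) => k; apply: (@Sigma1_setU 3 Baire); apply: Sigma1_preimage => //.
    exact: (c1 _ xi' _ pair_right_continuous).
  exact: (c1 _ xi _ pair_left_continuous).
- move=> j xi nu nu1.
  apply: (Pi3_selection det pair_left_continuous); last exact: prob1_outer1.
  rewrite /Pi1 (_ : ~` _ = fst @` \bigcup_k (((fun z : Baire * Baire => pair_join xi z.2) @^-1` O k j) `&`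
    ((fun z : Baire * Baire => pair_join (pair_left z.1) (response (pair_right z.1) z.2)) @^-1` ~` O k (~~ j))));
    last first.
    apply/seteqP; split=> y.
      move=> /existsNP[v] /existsNP[k] /not_implyP[h1 h2].
      by exists (y, v) => //; exists k.
    by move=> [[y' v] [k _ [/= h1 h2]] <-] /(_ v k h1).
  apply: (@Sigma1_exists 2 Baire); apply: (@Sigma1_bigcup 3) => k; apply: (@Sigma1_setI 2); apply: Sigma1_preimage => //.
  exact: (c1 _ xi _ (@snd_continuous _ _)).
Qed.

End determinacy_case.

Theorem mainTheorem7 (R : realType) (X : bool -> topologicalType)
    (polX : forall i, polish R (X i))
    (E : forall i, set (X i * Delta R (X (~~ i)))%type) :
  ((forall i, Sigma1 1 (E i)) -> RAT E = RCBR E) /\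
  (Pi1_determinacy 3 -> (forall i, Pi1 2 (E i)) -> RAT E = RCBR E).
Proof.
(* Each inclusion starts from a point [p] of the product, which excludes empty strategy spaces. *)
have nX (p : forall i, X i) i : nice R (X i) by exact: polish_nice (p i) (polX i).
split=> [sE|det pE]; apply/seteqP; split=> p hp.
- pose F i := projT1 (cid (sE i)); have FP i := projT2 (cid (sE i)).
  apply: (@RAT_sub_RCBR_closed R X (nX p) E F) => // i; last first.
    by rewrite -[X in closed X]setCK; apply: open_closedC; case: (FP i).
  by case: (FP i).
- exact: (RCBR_sub_RAT (nX p)).
- exact: (RAT_sub_RCBR_det (nX p) det pE).
- exact: (RCBR_sub_RAT (nX p)).
Qed.
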